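(* Consider Maxwell's system with zero conductivity, written abstractly as $y'=Ay+Bg$ on $(0,T)$, $y(0)=y_0\in Y$ (with $Y,U,A,B$ as in the context, so that $A^*=-A$), together with the functional $$J(g)=\int_0^T\big(\|Cy(t)\|_Y^2+\|g(t)\|_U^2\big)\,dt+\|Gy(T)\|_Y^2$$ to be minimized over $g\in L^2(0,T;U)$. Assume $C,G\in\mathcal L(Y)$ and that $G$ is an isomorphism. Then: a) The Riccati (optimal cost) operator $P(t)$, which occurs in the feedback formula $\hat g(t)=-B^*P(t)\hat y(t)$ for the optimal pair $(\hat g,\hat y)$, coincides with $Q(t)^{-1}$ for $t\in[0,T]$, where $Q(\cdot)$ is the unique solution of the Cauchy problem for the dual Riccati equation $$\frac{d}{dt}(Q(t)x,y)_Y=(Q(t)x,A^*y)_Y+(A^*x,Q(t)y)_Y-(B^*x,B^*y)_U+(CQ(t)x,CQ(t)y)_Y,\quad x,y\in\mathcal D(A^* ),\ t\in[0,T),$$ $$Q(T)=(G^*G)^{-1}.$$ b) The optimal pair $(\hat g,\hat y)$ (with initial time $0$ and initial state $y_0$) admits the representation $$\hat g(t)=-B^*z(t),\qquad \hat y(t)=Q(t)z(t),$$ where $z(\cdot)$ solves (in the mild sense) the non-autonomous system $z'=[A-C^*CQ(t)]z$, $z(0)=Q(0)^{-1}y_0$. c) In particular, if $C=0$ and $G=I$, then $$\hat g(t)=-B^*e^{tA}Q(0)^{-1}y_0,\qquad \hat y(t)=Q(t)e^{tA}Q(0)^{-1}y_0,$$ where $$Q(t)x=\int_t^Te^{(r-t)A^*}BB^*e^{(r-t)A}x\,dr+e^{(T-t)A^*}e^{(T-t)A}x,\qquad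 x\in Y,\ t\in[0,T].$$
   Context: Setting. $T>0$; $\Omega\subset\mathbb R^3$ is a bounded, open, connected set with $C^{1,1}$ boundary $\Gamma$ and exterior unit normal $\nu$. $\varepsilon,\mu$ are $3\times3$ real-symmetric, uniformly positive definite matrix functions with entries in $W^{1,\infty}(\Omega)$; the conductivity is $\sigma=0$. Maxwell's system for $y=(e,h)$: $\varepsilon e_t-\nabla\times h=0$, $\mu h_t+\nabla\times e=0$ in $\Omega$, $\nu\times h=g$ on $\Gamma$. Spaces. $Y=L^2(\Omega,\mathbb C^6)$ with inner product $(y,z)_Y=(y_1,\varepsilon z_1)_{L^2(\Omega)}+(y_2,\mu z_2)_{L^2(\Omega)}$. $U=H^{1/2}_{\mathrm{tan}}(\Gamma)$ (tangential $\mathbb C^3$-valued fields in $H^{1/2}(\Gamma)$) with inner product $(f,g)_U=(\sqrt{-\Delta_\Gamma}f,g)_{L^2(\Gamma)}$, where $-\Delta_\Gamma$ is the Laplace–Beltrami operator on $\Gamma$, taken to be positive, self-adjoint and invertible. $H(\mathrm{curl},\Omega)=\{u\in L^2(\Omega,\mathbb C^3):\nabla\times u\in L^2(\Omega,\mathbb C^3)\}$, $H_0(\mathrm{curl},\Omega)=\{u\in H(\mathrm{curl},\Omega):\nu\times u=0\text{ on }\Gamma\}$. Operators. $\mathcal D(A)=H(\mathrm{curl},\Omega)\times H_0(\mathrm{curl},\Omega)$, $Ay=(\varepsilon^{-1}\nabla\times y_2,\,-\mu^{-1}\nabla\times y_1)$. $A$ is skew-adjoint in $Y$ and generates a unitary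 $C_0$-group $e^{tA}$. $A$ extends to a bounded operator $Y\to[\mathcal D(A^* )]'$ by $(Ay,z)=(y,A^*z)_Y$ (duality with pivot $Y$), and $e^{tA}$ extends to $[\mathcal D(A^* )]'$. The Green map $\mathcal G\colon U\to H(\mathrm{curl},\Omega)^2$ sends $g$ to the solution $y=(y_1,y_2)$ of $\varepsilon y_1-\nabla\times y_2=0$, $\mu y_2+\nabla\times y_1=0$ in $\Omega$, $\nu\times y_2=g$ on $\Gamma$. $B=(I-A)\mathcal G\colon U\to[\mathcal D(A^* )]'$ and $B^*\colon\mathcal D(A^* )\to U$, $(B^*z,g)_U=((I-A^* )z,\mathcal Gg)_Y$. Known well-posedness facts: $g\mapsto\int_s^{\cdot}e^{(\cdot-r)A}Bg(r)\,dr$ is bounded from $L^2(s,T;U)$ to $C([s,T],Y)$; equivalently $\int_0^T\|B^*e^{tA^*}x\|_U^2dt\le c_T\|x\|_Y^2$ for $x\in\mathcal D(A^* )$, so $B^*e^{\cdot A^*}$ (hence, $A$ generating a group, also $B^*e^{\cdot A}$) extends continuously to an operator $Y\to L^2(0,T;U)$. Expressions such as $B^*e^{tA}x$ with $x\in Y$, $B^*z(t)$, and $B^*P(t)\hat y(t)$ are understood through such extensions, as elements of $L^2(0,T;U)$; the integral in c) is understood accordingly, i.e. as the bounded operator with quadratic form $\int_t^T\|B^*e^{(r-t)A}x\|_U^2dr$. Optimal cost operator: $P(t)$, $t\in[0,T]$, is the bounded self-adjoint operator on $Y$ such that $(P(t)x,x)_Y=\min_{g\in L^2(t,T;U)}\big\{\int_t^T(\|Cy(r)\|_Y^2+\|g(r)\|_U^2)dr+\|Gy(T)\|_Y^2\big\}$,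 where $y(r)=e^{(r-t)A}x+\int_t^re^{(r-\tau)A}Bg(\tau)d\tau$. A solution of the dual Riccati problem is a strongly continuous family $Q\colon[0,T]\to\mathcal L(Y)$ of self-adjoint operators with $Q(T)=(G^*G)^{-1}$ such that $t\mapsto(Q(t)x,y)_Y$ is differentiable on $[0,T)$ and satisfies the equation for all $x,y\in\mathcal D(A^* )$. *)

(* Defs.v *)
From HB Require Import structures.
From mathcomp Require Import all_boot all_order all_algebra.
From mathcomp Require Import all_classical all_reals all_analysis.
From mathcomp Require Import complex.

Set Implicit Arguments.
Unset Strict Implicit.
Unset Printing Implicit Defensive.

Import Order.TTheory GRing.Theory Num.Theory.
Import numFieldNormedType.Exports.

Local Open Scope classical_set_scope.
Local Open Scope complex_scope.
Local Open Scope ring_scope.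

Section DotNorm.
Variables (R : realType) (V : lmodType R[i]) (f : {dot V for Num.conj}).

Definition dot_norm (x : V) : R := Num.sqrt (complex.Re (f x x)).

Definition dot_complete :=
  forall u : nat -> V,
    (forall e : R, 0 < e -> exists N, forall m n,
        (N <= m)%N -> (N <= n)%N -> dot_norm (u m - u n) < e) ->
    exists x, (fun n => dot_norm (u n - x)) @ \oo --> (0 : R).
End DotNorm.

(* The inner product is linear in its first argument. *)
Record hilbert (R : realType) := Hilbert {
  hcar :> lmodType R[i];
  hdot : {dot hcar for Num.conj};
  hcomplete : dot_complete hdot }.

Definition ip (R : realType) (H : hilbert R) (x y : H) : R[i] := hdot H x y.
Definition hnorm (R : realType) (H : hilbert R) (x : H) : R :=
  dot_norm (hdot H) x.

Definition hcvg (R : realType) (H : hilbert R) (u : nat -> H) (x : H) :=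
  (fun n => hnorm (u n - x)) @ \oo --> (0 : R).

Definition hcontinuous_on (R : realType) (H : hilbert R) (D : set R)
    (f : R -> H) :=
  forall s, D s -> (fun t => hnorm (f t - f s)) @ within D (nbhs s) --> (0 : R).

Definition hdense (R : realType) (H : hilbert R) (D : set H) :=
  forall x, exists2 u : nat -> H, (forall n, D (u n)) & hcvg u x.

Definition bounded_op (R : realType) (H K : hilbert R) (F : H -> K) :=
  linear F /\ exists M : R, forall x, hnorm (F x) <= M * hnorm x.

Section Bounded.
Variables (R : realType) (H K : hilbert R).

Definition isomorphism (F : H -> K) :=
  bounded_op F /\
  exists2 F' : K -> H, bounded_op F' & cancel F F' /\ cancel F' F.

(* F^-1, meaningful for bijective F *)
Definition opinv (F : H -> K) (y : K) : H := xget 0 [set x | F x = y].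

(* F^*, meaningful for bounded F *)
Definition hadj (F : H -> K) (y : K) : H :=
  xget 0 [set w | forall x, ip (F x) y = ip x w].
End Bounded.

Definition self_adjoint_op (R : realType) (H : hilbert R) (F : H -> H) :=
  bounded_op F /\ forall x y, ip (F x) y = ip x (F y).

(* Unbounded operators are represented by their graphs: A x y stands for
   "x is in the domain of A and y = Ax". *)
Section Graphs.
Variables (R : realType) (H : hilbert R).
Implicit Types A M : H -> H -> Prop.

Definition dom A : set H := [set x | exists y, A x y].

Definition gadj A (z w : H) := forall x y, A x y -> ip y z = ip x w.

(* the value A^* z, meaningful for z in the domain of A^*, A being densely
   defined *)
Definition opstar A (z : H) : H := xget 0 [set w | gadj A z w].

Definition self_adjoint A :=
  hdense (dom A) /\ forall z w, gadj A z w <-> A z w.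

Definition skew_adjoint A :=
  hdense (dom A) /\ forall z w, gadj A z w <-> A z (- w).

Definition positive_op A := forall x y, A x y -> 0 <= ip y x.

Definition invertible_op A :=
  (forall y, exists x, A x y) /\
  exists M : R, forall x y, A x y -> hnorm x <= M * hnorm y.

Definition is_sqrt_op A M :=
  [/\ self_adjoint M, positive_op M
    & forall x y, A x y <-> exists2 v, M x v & M v y].

Definition unitary_C0_group (S : R -> H -> H) :=
  [/\ forall t, linear (S t),
      forall x, S 0 x = x,
      forall s t x, S (s + t) x = S s (S t x),
      forall t x y, ip (S t x) (S t y) = ip x y
    & forall x, hcontinuous_on setT (S^~ x)].

Definition is_generator (S : R -> H -> H) A :=
  forall x y, A x y <->
    (fun t : R => hnorm ((t^-1)%:C *: (S t x - x) - y)) @ 0^' --> (0 : R).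
End Graphs.

Definition cintegral d (X : measurableType d) (R : realType)
    (m : {measure set X -> \bar R}) (D : set X) (f : X -> R[i]) : R[i] :=
  (Rintegral m D (fun x => complex.Re (f x)))
  +i* (Rintegral m D (fun x => complex.Im (f x))).

Section L2time.
Variables (R : realType) (H : hilbert R).
Local Notation leb := (@lebesgue_measure R).

Definition simple_hfun (s : R -> H) :=
  exists (N : nat) (E : nat -> set R) (u : nat -> H),
    (forall k, measurable (E k)) /\
    forall r, s r = \sum_(k < N) (\1_(E k) r : R)%:C *: u k.

Definition strongly_measurable (D : set R) (g : R -> H) :=
  exists2 s : nat -> R -> H, (forall n, simple_hfun (s n)) &
    forall r, D r -> hcvg (s^~ r) (g r).

Definition L2sq (a b : R) (g : R -> H) : \bar R :=
  (\int[leb]_(r in `[a, b]) ((hnorm (g r) ^+ 2)%R)%:E)%E.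

Definition is_L2 (a b : R) (g : R -> H) :=
  strongly_measurable `[a, b] g /\ (L2sq a b g < +oo)%E.
End L2time.

(* The control problem y' = Ay + Bg with B = [I - A] Gr *)
Section Control.
Variables (R : realType) (Y U : hilbert R).
Variables (A : Y -> Y -> Prop) (S : R -> Y -> Y) (Gr : U -> Y).
Variable T : R.
Local Notation leb := (@lebesgue_measure R).

(* The value of Bg, an element of the dual of D[A^*], at z in D[A^*]: A being
   extended by (Ay, z) = (y, A^* z), it is (Gr g, [I - A^*] z). *)
Definition Bpair (g : U) (z : Y) : R[i] := ip (Gr g) (z - opstar A z).

(* (B^* z, g) = ([I - A^*] z, Gr g), for z in D[A^*] *)
Definition Bstar (z : Y) : U :=
  xget 0 [set u | forall g, ip u g = ip (z - opstar A z) (Gr g)].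

Definition admissible :=
  exists c : R, forall x, dom (gadj A) x ->
    (L2sq 0%R T (fun t => Bstar (hadj (S t) x)) <= (c * hnorm x ^+ 2)%:E)%E.

(* y r = e^{(r-t)A} x + \int_t^r e^{(r-tau)A} B g(tau) dtau on [t, T], the
   integral being taken in the dual of D[A^*], i.e. tested against D[A^*] *)
Definition is_state (t : R) (x : Y) (g : R -> U) (y : R -> Y) :=
  forall r, t <= r <= T -> forall z, dom (gadj A) z ->
    ip (y r) z = ip (S (r - t) x) z
      + cintegral leb `[t, r] (fun tau => Bpair (g tau) (hadj (S (r - tau)) z)).

(* zeta(t) = e^{tA} zeta(0) + \int_0^t e^{(t-s)A} f(s) ds on [0, T] *)
Definition is_mild (f zeta : R -> Y) :=
  forall t, 0 <= t <= T -> forall w,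
    ip (zeta t) w = ip (S t (zeta 0)) w
      + cintegral leb `[0, t] (fun s => ip (S (t - s) (f s)) w).

(* "h = B^* zeta in L^2(0,T;U)" for a mild trajectory zeta of
   zeta' = A zeta + f with f in C([0,T];Y): the extension by continuity in the
   data (zeta(0), f) of the map zeta |-> B^* zeta(.), which is defined
   pointwise when zeta(0) lies in D(A) and f in C([0,T];D(A)).
   The case f = 0 is the extension of x |-> B^* e^{.A} x. *)
Definition is_Bstar_along (zeta : R -> Y) (h : R -> U) :=
  is_L2 0 T h /\
  exists f : R -> Y,
    [/\ hcontinuous_on `[0, T] f, is_mild f zeta &
    exists (fn fn' zn : nat -> R -> Y),
    [/\ forall n, [/\ dom A (zn n 0), is_mild (fn n) (zn n),
                     hcontinuous_on `[0, T] (fn n),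
                     hcontinuous_on `[0, T] (fn' n)
                   & forall t, 0 <= t <= T -> A (fn n t) (fn' n t)],
        hcvg (fun n => zn n 0) (zeta 0),
        (forall e : R, 0 < e -> exists N, forall n t,
           (N <= n)%N -> 0 <= t <= T -> hnorm (fn n t - f t) < e)
      & (fun n => L2sq 0 T (fun t => Bstar (zn n t) - h t)) @ \oo
          --> (0 : \bar R)%E]].

Variables C G : Y -> Y.

Definition cost (t : R) (g : R -> U) (y : R -> Y) : \bar R :=
  (\int[leb]_(r in `[t, T]) ((hnorm (C (y r))) ^+ 2 + (hnorm (g r)) ^+ 2)%:E
   + ((hnorm (G (y T))) ^+ 2)%:E)%E.

Definition optimal_pair (t : R) (x : Y) (g : R -> U) (y : R -> Y) :=
  [/\ is_L2 t T g, is_state t x g y &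
      forall g' y', is_L2 t T g' -> is_state t x g' y' ->
        (cost t g y <= cost t g' y')%E].

Definition optimal_cost_operator (P : R -> Y -> Y) :=
  forall t, 0 <= t <= T -> self_adjoint_op (P t) /\
    forall x, exists g y, optimal_pair t x g y /\
      cost t g y = (complex.Re (ip (P t x) x))%:E.

(* phi has derivative l at t relatively to D; one-sided at an endpoint of D *)
Definition cderiv_within (D : set R) (phi : R -> R[i]) (t : R) (l : R[i]) :=
  (fun s : R => complex.Re `|(phi s - phi t) / (s - t)%:C - l|)
    @ within D (t^') --> (0 : R).

Definition dual_riccati_solution (Q : R -> Y -> Y) :=
  [/\ forall t, 0 <= t <= T -> self_adjoint_op (Q t),
      forall x, hcontinuous_on `[0, T] (Q^~ x),
      forall x, Q T x = opinv (fun v => hadj G (G v)) x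
    & forall x x' y y', gadj A x x' -> gadj A y y' ->
      forall t, 0 <= t < T ->
        cderiv_within `[0, T[ (fun s => ip (Q s x) y) t
          (ip (Q t x) y' + ip x' (Q t y) - ip (Bstar x) (Bstar y)
           + ip (C (Q t x)) (C (Q t y)))].
End Control.

Notation pt3 R := (R * R * R)%type.
(* the same type, with the measurable structure of the Lebesgue measure *)
Notation mpt3 R :=
  (measurableTypeR R * measurableTypeR R * measurableTypeR R)%type.

Section Space.
Variable R : realType.
Local Notation E := (pt3 R).
Local Notation mE := (mpt3 R).

Definition leb3 : {measure set mE -> \bar R} :=
  ((@lebesgue_measure R \x @lebesgue_measure R) \x @lebesgue_measure R)%E.

Definition leb2 : {measure set (measurableTypeR R * measurableTypeR R)%type -> \bar R} :=
  (@lebesgue_measure R \x @lebesgue_measure R)%E.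

Definition to_col (x : E) : 'cV[R]_3 := \col_k [:: x.1.1; x.1.2; x.2]`_k.
Definition of_col (v : 'cV[R]_3) : E := (v 0 0, v 1 0, v (-1) 0).

Definition basis3 (k : 'I_3) : E := of_col (delta_mx k 0).

Definition pderiv (k : 'I_3) (phi : E -> R) (x : E) : R := 'D_(basis3 k) phi x.

Fixpoint of_class (n : nat) (phi : E -> R) : Prop :=
  if n is n'.+1 then
    (forall x k, derivable phi x (basis3 k)) /\
    continuous phi /\ forall k, of_class n' (pderiv k phi)
  else continuous phi.

Definition smooth (phi : E -> R) := forall n, of_class n phi.

Definition test_function (Omega : set E) (phi : E -> R) :=
  smooth phi /\
  exists K, [/\ compact K, K `<=` Omega & forall x, ~ K x -> phi x = 0].

Definition vcomp (F : Type) (u : E -> 'cV[F]_3) (i : 'I_3) : E -> F :=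
  fun x => u x i 0.

(* indices are taken modulo 3, in the ring structure of 'I_3 *)
Definition curl (psi : E -> 'cV[R]_3) (x : E) : 'cV[R]_3 :=
  \col_k (pderiv (k + 1) (vcomp psi (k - 1)) x
          - pderiv (k - 1) (vcomp psi (k + 1)) x).

Definition cmx m n (M : 'M[R]_(m, n)) : 'M[R[i]]_(m, n) :=
  map_mx (real_complex R) M.

Definition mxdot m n (a b : 'M[R[i]]_(m, n)) : R[i] :=
  \sum_i \sum_j a i j * (b i j)^*.

Definition mxnorm2 m n (a : 'M[R[i]]_(m, n)) : R := complex.Re (mxdot a a).

Definition L2_field (m : {measure set mE -> \bar R}) (D : set E) p q
    (u : E -> 'M[R[i]]_(p, q)) :=
  (forall i j, measurable_fun (D : set mE) (fun x => complex.Re (u x i j)) /\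
               measurable_fun (D : set mE) (fun x => complex.Im (u x i j))) /\
  (\int[m]_(x in D) (mxnorm2 (u x))%:E < +oo)%E.

(* [H], with the class map [j], is the inner product space of the fields in
   [L2] with form [form], fields at distance 0 being identified *)
Definition is_space_of_fields (V : lmodType R[i]) (L2 : set (E -> V))
    (form : (E -> V) -> (E -> V) -> R[i]) (H : hilbert R) (j : (E -> V) -> H) :=
  [/\ forall a u v, L2 u -> L2 v -> j (fun x => a *: u x + v x) = a *: j u + j v,
      forall u v, L2 u -> L2 v -> ip (j u) (j v) = form u v
    & forall y, exists2 u, L2 u & j u = y].

(* A rigid motion together with a function whose graph describes the boundary:
   in the frame [ch_O] centred at [ch_c], Omega is the region below the graph of
   [ch_g] inside the cylinder |xi| < [ch_r], |s| < [ch_h]. *)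
Record chart := Chart {
  ch_c : E; ch_O : 'M[R]_3; ch_r : R; ch_h : R; ch_g : R * R -> R }.

Definition ch_pt (ch : chart) (xi : R * R) (s : R) : E :=
  of_col (to_col (ch_c ch) + ch_O ch *m to_col (xi, s)).

Definition ch_base (ch : chart) : set (R * R) := [set xi | `|xi| < ch_r ch].

Definition d1 (g : R * R -> R) (xi : R * R) : R := 'D_((1, 0) : R * R) g xi.
Definition d2 (g : R * R -> R) (xi : R * R) : R := 'D_((0, 1) : R * R) g xi.

Definition C11_on (B : set (R * R)) (g : R * R -> R) :=
  (forall xi, B xi -> derivable g xi ((1, 0) : R * R) /\
                      derivable g xi ((0, 1) : R * R)) /\
  exists L : R, forall xi eta, B xi -> B eta ->
    `|d1 g xi - d1 g eta| <= L * `|xi - eta| /\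
    `|d2 g xi - d2 g eta| <= L * `|xi - eta|.

Definition is_chart (Omega : set E) (ch : chart) :=
  [/\ (ch_O ch)^T *m ch_O ch = 1%:M, 0 < ch_r ch /\ 0 < ch_h ch,
      C11_on (ch_base ch) (ch_g ch),
      forall xi, ch_base ch xi -> `|ch_g ch xi| < ch_h ch
    & forall xi s, ch_base ch xi -> `|s| < ch_h ch ->
        (Omega (ch_pt ch xi s) <-> s < ch_g ch xi)].

(* the boundary of an open set *)
Definition bdry (Omega : set E) : set E := closure Omega `\` Omega.

Definition C11_domain (Omega : set E) :=
  [/\ open Omega, bounded_set Omega, connected Omega &
      forall p, bdry Omega p -> exists2 ch, is_chart Omega ch &
        p = ch_pt ch (0, 0) (ch_g ch (0, 0))].

Definition jac (g : R * R -> R) (xi : R * R) : R :=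
  Num.sqrt (1 + d1 g xi ^+ 2 + d2 g xi ^+ 2).

Definition is_exterior_normal (Omega : set E) (nu : E -> 'cV[R]_3) :=
  forall ch, is_chart Omega ch -> forall xi, ch_base ch xi ->
    nu (ch_pt ch xi (ch_g ch xi)) =
    (jac (ch_g ch) xi)^-1 *:
      (ch_O ch *m to_col (- d1 (ch_g ch) xi, - d2 (ch_g ch) xi, 1)).

Definition is_surface_measure (Omega : set E)
    (sg : {measure set mE -> \bar R}) :=
  sg (~` bdry Omega) = 0%E /\
  forall ch, is_chart Omega ch -> forall F : set mE, measurable F ->
    let gr xi := ch_pt ch xi (ch_g ch xi) in
    (sg (F `&` (gr @` ch_base ch)) =
     \int[leb2]_(xi in ch_base ch `&` (gr @^-1` F)) (jac (ch_g ch) xi)%:E)%E.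

Definition ess_bounded (Omega : set E) (f : E -> R) :=
  measurable_fun (Omega : set mE) f /\
  exists M : R, {ae leb3, forall x, Omega x -> `|f x| <= M}.

Definition W1infty (Omega : set E) (f : E -> R) :=
  ess_bounded Omega f /\
  forall k, exists2 fk, ess_bounded Omega fk &
    forall phi, test_function Omega phi ->
      Rintegral leb3 Omega (fun x => f x * pderiv k phi x) =
      - Rintegral leb3 Omega (fun x => fk x * phi x).

Definition is_coefficient (Omega : set E) (eps : E -> 'M[R]_3) :=
  [/\ forall i j, W1infty Omega (fun x => eps x i j),
      {ae leb3, forall x, Omega x -> (eps x)^T = eps x}
    & exists2 alpha : R, 0 < alpha &
      {ae leb3, forall x, Omega x -> forall xi : 'cV[R]_3,
        alpha * \sum_i xi i 0 ^+ 2 <= (xi^T *m eps x *m xi) 0 0}].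

Definition is_weak_curl (Omega : set E) (u w : E -> 'cV[R[i]]_3) :=
  [/\ L2_field leb3 Omega u, L2_field leb3 Omega w &
      forall psi : E -> 'cV[R]_3,
        (forall i, test_function Omega (vcomp psi i)) ->
        cintegral leb3 Omega (fun x => mxdot (u x) (cmx (curl psi x))) =
        cintegral leb3 Omega (fun x => mxdot (w x) (cmx (psi x)))].

(* nu x u = g on the boundary, for u in H(curl) with w = curl u, through
   \int_Omega (curl u . psi - u . curl psi) = \int_Gamma (nu x u) . psi *)
Definition has_tangential_trace (Omega : set E) (sg : {measure set mE -> \bar R})
    (u w g : E -> 'cV[R[i]]_3) :=
  forall psi : E -> 'cV[R]_3, (forall i, smooth (vcomp psi i)) ->
    cintegral leb3 Omega (fun x => mxdot (w x) (cmx (psi x))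
                                   - mxdot (u x) (cmx (curl psi x))) =
    cintegral sg (bdry Omega) (fun x => mxdot (g x) (cmx (psi x))).

Definition L2_tangential (Omega : set E) (nu : E -> 'cV[R]_3)
    (sg : {measure set mE -> \bar R}) (f : E -> 'cV[R[i]]_3) :=
  L2_field sg (bdry Omega) f /\
  {ae sg, forall x, bdry Omega x -> mxdot (f x) (cmx (nu x)) = 0}.

(* the Sobolev-Slobodeckij condition for H^{1/2} on a surface *)
Definition H_half (Omega : set E) (sg : {measure set mE -> \bar R})
    (f : E -> 'cV[R[i]]_3) :=
  (\int[sg]_(x in bdry Omega) \int[sg]_(y in bdry Omega)
     (mxnorm2 (f x - f y)
      / Num.sqrt (mxnorm2 (cmx (to_col x - to_col y))) ^+ 3)%:E < +oo)%E.

(* row i is the tangential part of the gradient of the i-th component *)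
Definition smooth_surface_grad (nu : E -> 'cV[R]_3) (phi : E -> 'cV[R[i]]_3)
    (x : E) : 'M[R[i]]_3 :=
  (\matrix_(i, k) ((pderiv k (fun y => complex.Re (phi y i 0)) x)
                   +i* (pderiv k (fun y => complex.Im (phi y i 0)) x)))
  *m cmx (1%:M - nu x *m (nu x)^T).

(* f has components in H^1 of the surface, with surface gradients the rows of p:
   closure of the smooth fields in the H^1 norm *)
Definition is_surface_grad (Omega : set E) (nu : E -> 'cV[R]_3)
    (sg : {measure set mE -> \bar R}) (f : E -> 'cV[R[i]]_3)
    (p : E -> 'M[R[i]]_3) :=
  [/\ L2_field sg (bdry Omega) f, L2_field sg (bdry Omega) p &
  exists phi : nat -> E -> 'cV[R[i]]_3,
  [/\ forall n i, smooth (fun x => complex.Re (phi n x i 0)) /\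
                  smooth (fun x => complex.Im (phi n x i 0)),
      (fun n => \int[sg]_(x in bdry Omega) (mxnorm2 (phi n x - f x))%:E)%E
        @ \oo --> (0 : \bar R)%E
    & (fun n => \int[sg]_(x in bdry Omega)
         (mxnorm2 (smooth_surface_grad nu (phi n) x - p x))%:E)%E
        @ \oo --> (0 : \bar R)%E]].

End Space.

Section Maxwell.
Variable R : realType.
Local Notation E := (pt3 R).
Local Notation mE := (mpt3 R).
Local Notation vec := 'cV[R[i]]_3.
Variables (Omega : set E) (nu : E -> 'cV[R]_3) (sg : {measure set mE -> \bar R}).
Variables eps mu : E -> 'M[R]_3.

Definition is_L2_Omega (Y : hilbert R) (jY : (E -> vec * vec) -> Y) :=
  is_space_of_fields
    [set y | L2_field (leb3 R) Omega (fun x => (y x).1) /\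
             L2_field (leb3 R) Omega (fun x => (y x).2)]
    (fun y z =>
       cintegral (leb3 R) Omega (fun x => mxdot (y x).1 (cmx (eps x) *m (z x).1))
     + cintegral (leb3 R) Omega (fun x => mxdot (y x).2 (cmx (mu x) *m (z x).2)))
    jY.

Definition is_L2_tan_Gamma (H : hilbert R) (jH : (E -> vec) -> H) :=
  is_space_of_fields (L2_tangential Omega nu sg)
    (fun f g => cintegral sg (bdry Omega) (fun x => mxdot (f x) (g x))) jH.

(* - Delta_Gamma on tangential fields: the operator of the Dirichlet form
   \int_Gamma \sum_i grad_Gamma f_i . grad_Gamma g_i with tangential f, g *)
Definition laplace_beltrami (H : hilbert R) (jH : (E -> vec) -> H) (a b : H) :=
  exists f k p,
    [/\ L2_tangential Omega nu sg f /\ jH f = a,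
        L2_tangential Omega nu sg k /\ jH k = b,
        is_surface_grad Omega nu sg f p &
        forall g q, L2_tangential Omega nu sg g ->
          is_surface_grad Omega nu sg g q ->
          cintegral sg (bdry Omega) (fun x => mxdot (p x) (q x)) =
          cintegral sg (bdry Omega) (fun x => mxdot (k x) (g x))].

(* U is the space of tangential fields in H^{1/2}, seen in H = L^2_tan through
   the embedding iU, with (f, g)_U = (sqrt(-Delta_Gamma) f, g).  The formula is
   only literal for f in the domain of sqrtL; since sqrtL is onto, that domain
   is dense in U, so the formula determines the inner product. *)
Definition is_H_half_tan (H : hilbert R) (jH : (E -> vec) -> H)
    (sqrtL : H -> H -> Prop) (U : hilbert R) (iU : U -> H) :=
  [/\ linear iU, injective iU,
      range iU = [set jH f | f in L2_tangential Omega nu sg `&` H_half Omega sg]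
    & forall f g v, sqrtL (iU f) v -> ip f g = ip v (iU g)].

Definition maxwell_op (Y : hilbert R) (jY : (E -> vec * vec) -> Y) (y w : Y) :=
  exists e h ce ch : E -> vec,
    [/\ is_weak_curl Omega e ce, is_weak_curl Omega h ch,
        has_tangential_trace Omega sg h ch (fun=> 0),
        y = jY (fun x => (e x, h x))
      & w = jY (fun x => (cmx (invmx (eps x)) *m ch x,
                          - (cmx (invmx (mu x)) *m ce x)))].

Definition is_green_map (H : hilbert R) (jH : (E -> vec) -> H)
    (U : hilbert R) (iU : U -> H) (Y : hilbert R) (jY : (E -> vec * vec) -> Y)
    (Gr : U -> Y) :=
  bounded_op Gr /\
  forall g, exists y1 y2 c1 c2 f : E -> vec,
    [/\ is_weak_curl Omega y1 c1 /\ is_weak_curl Omega y2 c2,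
        {ae (leb3 R), forall x, Omega x -> cmx (eps x) *m y1 x - c2 x = 0},
        {ae (leb3 R), forall x, Omega x -> cmx (mu x) *m y2 x + c1 x = 0},
        [/\ L2_tangential Omega nu sg f, jH f = iU g
          & has_tangential_trace Omega sg y2 c2 f]
      & Gr g = jY (fun x => (y1 x, y2 x))].

End Maxwell.

(* Main.v *)
(* Pulling everything back by the group e^{tA} removes the free dynamics: the
   pulled back state is y(r) = x + \int_t^r e^{-sA} B g(s) ds, where admissibility
   defines the integral by duality. The Euler-Lagrange identity then gives
   P(t) y(t) = p(t), where p is the adjoint state, p' = - C^*C y and
   p(T) = G^*G y(T) (pulled back). As G is an isomorphism, P(t) is uniformly
   coercive, and Q(t) = P(t)^{-1} maps z to the state at time t of the optimal
   trajectory whose adjoint state there is z. For z in D(A) the control of that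
   trajectory is - B^* e^{(r-t)A} z up to O(s - t) in L^2(t,s;U), so that the
   increments of (Q(t)z, w) give the dual Riccati equation, in which only
   B^* e^{rA} z with z in D(A) occurs.

   Uniqueness is a contraction argument in an exponentially weighted norm, applied
   to the quadratic form of the difference of two solutions on D(A); the bound on
   the second solution comes from the uniform boundedness principle.

   Since y = Qp, the adjoint state of the optimal trajectory is the mild solution z
   of (b), unique by Gronwall's lemma. That - g = B^* z is again the Euler-Lagrange
   identity: an integration by parts shows that B^* along the regularised
   trajectories e^{tA} J_n e^{-tA} z(t), J_n being averages of the group, converges
   to the L^2 function representing that identity. If C = 0 and G = I, the adjoint
   states are free, and for z in D(A) the quadratic form of Q(t) - I at z is the
   squared norm of B^* e^{rA} z in L^2(0,T-t;U); the general case follows by density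
   and translation invariance. *)
Require Import Defs.
From HB Require Import structures.
From mathcomp Require Import all_boot all_order all_algebra.
From mathcomp Require Import all_classical all_reals all_analysis.
From mathcomp Require Import measurable_realfun complex ring lra.
Import Order.TTheory GRing.Theory Num.Theory.
Import numFieldNormedType.Exports.
Local Open Scope classical_set_scope.
Local Open Scope complex_scope.
Local Open Scope ring_scope.

Set Implicit Arguments.
Unset Strict Implicit.
Unset Printing Implicit Defensive.

(** * Hilbert spaces and bounded operators *)

(** The difficulties come from the unbounded [B]: [B g] lies outside [Y], so its integrals exist
    only as Riesz vectors on D(A), and admissibility is what makes them bounded in [Y]. An optimal
    control is merely square integrable, so its values at single points are of no use. Derivatives
    are therefore read off increments over short intervals, compared with the integral of a
    continuous candidate, and the missing smallness is supplied by the absolute continuity of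
    integrals of squares. The inverse [Q] is the object to differentiate because P(t) has no reason
    to preserve D(A): B^* P(t) has no pointwise meaning, whereas fixing the adjoint state [z] in
    D(A) gives the control near its start an explicit continuous approximation. Minimisers come with
    [optimal_cost_operator], so only first order conditions are derived. Minimality yields real
    identities; hence most of the work is done with the real part [rip] of the inner product, and
    imaginary parts are recovered by replacing a vector [y] with ['i%C *: y], an operation that
    preserves D(A). *)

Lemma discriminant_le (R : realType) (a b c : R) :
  (forall l, 0 <= a + 2 * l * b + l ^+ 2 * c) -> b ^+ 2 <= a * c.
Proof.
move=> h.
have c0 : 0 <= c.
  rewrite leNgt; apply/negP => c0.
  have a0 : 0 <= a by have := h 0; rewrite mulr0 mul0r expr0n mul0r !addr0.
  (* If [c < 0], a large [l] makes the trinomial negative: the quotient pushes [l * - c] beyond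
     [a + 2 * b], and the last [+ 1] ensures [1 <= l], so that [a <= l * a]. *)
  have h1 := h ((a + 1 + `|b| * 2 + 1) / - c + 1).
  set l := _ + 1 in h1.
  have lc : l * - c = a + 1 + `|b| * 2 + 1 - c by rewrite /l; field; lra.
  have l1 : 1 <= l.
    rewrite /l lerDr divr_ge0 //; last by lra.
    by have := normr_ge0 b; lra.
  have bb : b <= `|b| by exact: ler_norm.
  have : l * (a + 2 * b - l * - c) >= 0.
    apply: le_trans h1 _.
    rewrite (_ : l * _ = l * a + 2 * l * b + l ^+ 2 * c); last by ring.
    by rewrite !lerD2r ler_peMl.
  rewrite pmulr_rge0 ?lc; last by lra.
  by have := normr_ge0 b; lra.
have [c00|cn] := eqVneq c 0.
  subst c; rewrite mulr0.
  suff -> : b = 0 by rewrite expr0n.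
  apply/eqP; rewrite -[_ == _]negbK; apply/negP => b0.
  have := h (- (a + 1) / (2 * b)).
  rewrite mulr0 addr0 (_ : 2 * _ * b = - (a + 1)); first lra.
  by field.
have cp : 0 < c by rewrite lt_def cn.
have := h (- b / c).
rewrite (_ : _ + _ = (a * c - b ^+ 2) / c); last by field.
rewrite pmulr_lge0 ?invr_gt0 //; lra.
Qed.

Section RealInner.
Variables (R : realType) (H : hilbert R).
Implicit Types (x y z w : H) (a : R).

(** The real part turns [H] into a real Hilbert space with the same norm; [ipE] recovers the complex
    product from it. *)
Definition rip x y : R := complex.Re (ip x y).
Definition rscale a x : H := a%:C *: x.

Lemma ipDl x y z : ip (x + y) z = ip x z + ip y z.
Proof. by rewrite /ip linearDl. Qed.

Lemma ipDr x y z : ip x (y + z) = ip x y + ip x z.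
Proof. by rewrite /ip linearDr. Qed.

Lemma ipNl x z : ip (- x) z = - ip x z.
Proof. by rewrite /ip linearNl. Qed.

Lemma ipNr x z : ip x (- z) = - ip x z.
Proof. by rewrite /ip linearNr. Qed.

Lemma ip0l z : ip 0 z = 0.
Proof. by rewrite /ip linear0l. Qed.

Lemma ip0r z : ip z 0 = 0.
Proof. by rewrite /ip linear0r. Qed.

Lemma ipZl (a : R[i]) x z : ip (a *: x) z = a * ip x z.
Proof. by rewrite /ip linearZl_LR. Qed.

Lemma ipZr (a : R[i]) x z : ip x (a *: z) = a^* * ip x z.
Proof. by rewrite /ip linearZr_LR. Qed.

Lemma ipC x y : ip x y = (ip y x)^*.
Proof. by rewrite /ip (hermitian_subproof (s:=hdot H)) expr0 mul1r. Qed.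

Lemma ripDl x y z : rip (x + y) z = rip x z + rip y z.
Proof. by rewrite /rip ipDl raddfD. Qed.

Lemma ripDr x y z : rip x (y + z) = rip x y + rip x z.
Proof. by rewrite /rip ipDr raddfD. Qed.

Lemma ripNl x z : rip (- x) z = - rip x z.
Proof. by rewrite /rip ipNl raddfN. Qed.

Lemma ripNr x z : rip x (- z) = - rip x z.
Proof. by rewrite /rip ipNr raddfN. Qed.

Lemma rip0l z : rip 0 z = 0.
Proof. by rewrite /rip ip0l. Qed.

Lemma rip0r z : rip z 0 = 0.
Proof. by rewrite /rip ip0r. Qed.

Lemma ripZl a x z : rip (rscale a x) z = a * rip x z.
Proof. by rewrite /rip /rscale ipZl; case: (ip x z) => u v; rewrite /= mul0r subr0. Qed.

Lemma ripZr a x z : rip x (rscale a z) = a * rip x z.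
Proof.
rewrite /rip /rscale ipZr; case: (ip x z) => u v; simpc => /=.
by [].
Qed.

Lemma ripC x y : rip x y = rip y x.
Proof. by rewrite /rip ipC; case: (ip y x). Qed.

Definition ripE := (ripDl, ripDr, ripNl, ripNr, ripZl, ripZr, rip0l, rip0r).

Lemma Im_ip x y : complex.Im (ip x y) = rip x ('i%C *: y).
Proof.
rewrite /rip ipZr; case: (ip x y) => a b; simpc => /=.
by lra.
Qed.

Lemma ipE x y : ip x y = rip x y +i* rip x ('i%C *: y).
Proof. by rewrite -Im_ip /rip; case: (ip x y). Qed.

Lemma scaleiN x : 'i%C *: ('i%C *: x) = - x :> H.
Proof.
rewrite scalerA (_ : 'i%C * 'i%C = -1) ?scaleN1r //.
by rewrite -expr2 sqr_i.
Qed.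

Lemma rip_il x y : rip ('i%C *: x) y = - rip x ('i%C *: y).
Proof.
rewrite /rip ipZl ipZr; case: (ip x y) => a b; simpc => /=.
by lra.
Qed.

Lemma rip_ii x y : rip ('i%C *: x) ('i%C *: y) = rip x y.
Proof. by rewrite rip_il scaleiN ripNr opprK. Qed.

Lemma rip_ge0 x : 0 <= rip x x.
Proof.
have [->|x0] := eqVneq x 0; first by rewrite rip0l.
have := neq0_dnorm_gt0 (s:=hdot H) x x0.
by rewrite ltcE /rip /ip => /andP[_ /ltW].
Qed.

Lemma rip_eq0 x : rip x x = 0 -> x = 0.
Proof.
move=> h; apply/eqP; rewrite -[_ == _]negbK; apply/negP => x0.
have := neq0_dnorm_gt0 (s:=hdot H) x x0.
by rewrite ltcE -/(ip x x) -/(rip x x) h ltxx andbF.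
Qed.

Lemma rip_inj x y : (forall w, rip x w = rip y w) -> x = y.
Proof.
move=> h; apply/eqP; rewrite -subr_eq0; apply/eqP/rip_eq0.
by rewrite ripDl ripNl h subrr.
Qed.

Lemma rscaleN1 x : rscale (-1) x = - x.
Proof. by apply: rip_inj => w; rewrite !ripE mulN1r. Qed.

Lemma rip_injr x y : (forall w, rip w x = rip w y) -> x = y.
Proof. by move=> h; apply: rip_inj => w; rewrite ripC h ripC. Qed.

Lemma ip_inj x y : (forall w, ip w x = ip w y) -> x = y.
Proof. by move=> h; apply: rip_injr => w; rewrite /rip h. Qed.

Lemma hnorm_sqr x : hnorm x ^+ 2 = rip x x.
Proof. by rewrite /hnorm /dot_norm sqr_sqrtr // rip_ge0. Qed.

Lemma hnorm_ge0 x : 0 <= hnorm x.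
Proof. exact: sqrtr_ge0. Qed.
Hint Resolve hnorm_ge0 : core.

Lemma hnorm0 : hnorm (0 : H) = 0.
Proof. by rewrite /hnorm /dot_norm -/(ip 0 0) ip0l sqrtr0. Qed.

Lemma hnorm_eq0 x : hnorm x = 0 -> x = 0.
Proof. by move=> h; apply: rip_eq0; rewrite -hnorm_sqr h expr0n. Qed.

Lemma rip_le x y : `|rip x y| <= hnorm x * hnorm y.
Proof.
rewrite -(@ler_pXn2r _ 2) ?nnegrE ?mulr_ge0 //.
rewrite real_normK ?num_real // exprMn !hnorm_sqr.
apply: discriminant_le => l.
suff -> : rip x x + 2 * l * rip x y + l ^+ 2 * rip y y =
  rip (x + rscale l y) (x + rscale l y) by exact: rip_ge0.
by rewrite !ripE (ripC y x); ring.
Qed.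

Lemma rip_leW x y : rip x y <= hnorm x * hnorm y.
Proof. exact: le_trans (ler_norm _) (rip_le _ _). Qed.

Lemma hnorm_add x y : hnorm (x + y) <= hnorm x + hnorm y.
Proof.
rewrite -(@ler_pXn2r _ 2) ?nnegrE ?addr_ge0 // sqrrD !hnorm_sqr !ripE (ripC y x).
have := rip_leW x y; lra.
Qed.

Lemma hnorm_scale a x : hnorm (rscale a x) = `|a| * hnorm x.
Proof.
apply/eqP; rewrite -(@eqrXn2 _ 2) ?mulr_ge0 // exprMn !hnorm_sqr !ripE.
by rewrite real_normK ?num_real //; apply/eqP; ring.
Qed.

Lemma hnorm_opp x : hnorm (- x) = hnorm x.
Proof.
by apply/eqP; rewrite -(@eqrXn2 _ 2) // !hnorm_sqr !ripE opprK.
Qed.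

Lemma hnormi x : hnorm ('i%C *: x) = hnorm x.
Proof. by apply/eqP; rewrite -(@eqrXn2 _ 2) // !hnorm_sqr rip_ii. Qed.

Lemma hnorm_sym x y : hnorm (x - y) = hnorm (y - x).
Proof. by rewrite -hnorm_opp opprB. Qed.

Lemma hnorm_tri z x y : hnorm (x - y) <= hnorm (x - z) + hnorm (z - y).
Proof. by apply: le_trans (hnorm_add _ _); rewrite addrA subrK. Qed.

Lemma hnorm_dist x y : `|hnorm x - hnorm y| <= hnorm (x - y).
Proof.
have h1 := hnorm_add (x - y) y; have h2 := hnorm_add (y - x) x.
rewrite subrK in h1; rewrite subrK hnorm_sym in h2.
by rewrite ler_norml; apply/andP; split; lra.
Qed.

Lemma hnorm_dual x (M : R) : 0 <= M ->
  (forall y, rip x y <= M * hnorm y) -> hnorm x <= M.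
Proof.
move=> M0 /(_ x); rewrite -hnorm_sqr => h.
have [->//|n0] := eqVneq (hnorm x) 0.
have p : 0 < hnorm x by rewrite lt_def n0 /=.
by rewrite -(ler_pM2r p) -expr2.
Qed.

Definition hlim (u : nat -> H) x :=
  forall e : R, 0 < e -> exists N, forall n, (N <= n)%N -> hnorm (u n - x) < e.

Lemma hcvgP (u : nat -> H) x : hcvg u x <-> hlim u x.
Proof.
split.
  move=> /cvgrPdist_lt h e e0; have [N _ HN] := h e e0.
  exists N => n Nn; have := HN n Nn.
  by rewrite /= sub0r normrN ger0_norm.
move=> h; apply/cvgrPdist_lt => e e0; have [N HN] := h e e0.
exists N => // n /= Nn; rewrite sub0r normrN ger0_norm //; exact: HN.
Qed.

Lemma hcomplete_seq (u : nat -> H) :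
  (forall e : R, 0 < e -> exists N, forall m n,
     (N <= m)%N -> (N <= n)%N -> hnorm (u m - u n) < e) ->
  exists x, hlim u x.
Proof. by move=> /(@hcomplete R H u)[x /hcvgP]; exists x. Qed.

End RealInner.
Arguments rscale {R H} a x.
#[export] Hint Extern 0 (is_true (0 <= hnorm _)) => exact: hnorm_ge0 : core.
#[export] Hint Extern 0 (is_true (0 <= rip _ _)) => exact: rip_ge0 : core.

(** * The Lax-Milgram and Riesz theorems, and density arguments *)

Section LaxMilgram.
Variables (R : realType) (H : hilbert R).
Implicit Types (x y z : H).

Definition rsubspace (D : set H) :=
  [/\ D 0, forall x y, D x -> D y -> D (x + y)
    & forall a x, D x -> D (rscale a x)].

Definition rlinear_on (D : set H) (phi : H -> R) :=
  (forall x y, D x -> D y -> phi (x + y) = phi x + phi y) /\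
  (forall a x, D x -> phi (rscale a x) = a * phi x).

(* The representing vector is the limit of a minimizing sequence of
   b x x - 2 phi x on D. *)
Lemma lax_milgram (b : H -> H -> R) (D : set H) (phi : H -> R) (K c M : R) :
  (forall x y, b x y = b y x) ->
  (forall x y z, b (x + y) z = b x z + b y z) ->
  (forall a x z, b (rscale a x) z = a * b x z) ->
  (forall x y, `|b x y| <= K * hnorm x * hnorm y) ->
  0 < c -> (forall x, c * hnorm x ^+ 2 <= b x x) ->
  rsubspace D -> rlinear_on D phi ->
  (forall x, D x -> `|phi x| <= M * hnorm x) ->
  exists u, forall v, D v -> b u v = phi v.
Proof.
move=> bC bD bZ bK c0 bc [D0 DD DZ] [pD pZ] pM.
pose F x := b x x - 2 * phi x.
have FM x : D x -> - (M ^+ 2 / c) <= F x.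
  move=> Dx; rewrite /F; have h1 := bc x; have h2 := pM x Dx.
  have h3 : phi x <= M * hnorm x by exact: le_trans (ler_norm _) h2.
  have : 0 <= (c * hnorm x - M) ^+ 2 / c by rewrite divr_ge0 ?sqr_ge0 // ltW.
  rewrite (_ : _ / c = c * hnorm x ^+ 2 - 2 * (M * hnorm x) + M ^+ 2 / c); last by field; lra.
  lra.
pose E := F @` D.
have hE : has_inf E.
  split; first by exists (F 0), 0.
  by exists (- (M ^+ 2 / c)) => _ [x Dx <-]; exact: FM.
pose m := inf E.
have Fm x : D x -> m <= F x by move=> Dx; apply: ge_inf; [case: hE|exists x].
have /(@choice nat H)[u uP] : forall n, exists x, D x /\ F x < m + n.+1%:R^-1.
  move=> n.
  have n0 : (0 : R) < n.+1%:R^-1 by rewrite invr_gt0 ltr0n.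
  have [y [x Dx <-] xm] := @inf_adherent _ _ _ n0 hE.
  by exists x.
have bN x z : b (- x) z = - b x z.
  by rewrite -rscaleN1 bZ mulN1r.
have bDr x y z : b z (x + y) = b z x + b z y by rewrite bC bD !(bC z).
have bZr a x z : b z (rscale a x) = a * b z x by rewrite bC bZ (bC z).
have bNr x z : b z (- x) = - b z x by rewrite bC bN (bC z).
pose bl := (bD, bDr, bZ, bZr, bN, bNr).
(* The midpoint lies in [D] as well, where [F] is at least [m]; by coercivity every minimizing
   sequence is then Cauchy. *)
have par x y : D x -> D y -> c * hnorm (x - y) ^+ 2 <= 2 * (F x + F y - 2 * m).
  move=> Dx Dy; apply: le_trans (bc _) _.
  have Dh : D (rscale 2^-1 (x + y)) by apply: DZ; exact: DD.
  have := Fm _ Dh; rewrite /F pZ ?pD //; last exact: DD.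
  rewrite !bl (bC y x); lra.
have h1 : forall e : R, 0 < e -> exists N : nat, forall n, (N <= n)%N -> n.+1%:R^-1 < e.
  move=> e e0; exists (Num.truncn e^-1) => n Nn.
  rewrite invf_plt ?posrE ?ltr0n //.
  apply: lt_le_trans (truncnS_gt _) _; by rewrite ler_nat.
have [w wP] : exists w, hlim u w.
  apply: hcomplete_seq => e e0.
  have [N HN] := h1 (c * e ^+ 2 / 4) ltac:(by rewrite divr_gt0 // mulr_gt0 // exprn_gt0).
  exists N => i j Ni Nj.
  have := par _ _ (uP i).1 (uP j).1.
  have := (uP i).2; have := (uP j).2; have := HN i Ni; have := HN j Nj.
  have -> : (hnorm (u i - u j) < e) = (c * hnorm (u i - u j) ^+ 2 < c * e ^+ 2).
    by rewrite ltr_pM2l // ltr_pXn2r ?nnegrE // ltW.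
  move: (F (u i)) (F (u j)) (i.+1%:R^-1) (j.+1%:R^-1) => *; lra.
exists w => v Dv.
(* [D] is not assumed closed, so [w] may lie outside it: the first variation is taken at [u n] and
   passed to the limit. A nonnegative trinomial without constant term has no linear term either. *)
have key l : 0 <= 0 + 2 * l * (b w v - phi v) + l ^+ 2 * b v v.
  apply/ler_addgt0Pr => e e0.
  pose Z := 2 * `|l| * (`|K| * hnorm v + 1) + 1.
  have Z0 : 0 < Z.
    by rewrite /Z ltr_wpDl // !mulr_ge0 // ?addr_ge0 ?mulr_ge0.
  have [N1 HN1] := wP (e / (2 * Z)) ltac:(by rewrite divr_gt0 // mulr_gt0).
  have [N2 HN2] := h1 (e / 2) ltac:(by rewrite divr_gt0).
  pose n := maxn N1 N2.
  have a1 := HN1 n (leq_maxl _ _); have a2 := HN2 n (leq_maxr _ _).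
  have [Dn Fn] := uP n.
  have := Fm _ (DD _ _ Dn (DZ l _ Dv)).
  rewrite /F pD ?pZ //; last exact: DZ.
  rewrite !bl (bC v (u n)).
  move: Fn; rewrite /F => Fn h.
  have h4 : 2 * l * (b (u n) v - b w v) <= e / 2.
    have -> : b (u n) v - b w v = b (u n - w) v by rewrite bD bN.
    apply: le_trans (ler_norm _) _.
    rewrite !normrM (ger0_norm (_ : 0 <= 2)) //.
    have h5 : `|b (u n - w) v| <= hnorm (u n - w) * (`|K| * hnorm v + 1).
      apply: le_trans (bK _ _) _.
      have k1 : K * (hnorm (u n - w) * hnorm v) <= `|K| * (hnorm (u n - w) * hnorm v).
        by rewrite ler_wpM2r ?mulr_ge0 // ler_norm.
      have := hnorm_ge0 (u n - w); lra.
    apply: (@le_trans _ _ (hnorm (u n - w) * Z)).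
      apply: (@le_trans _ _ (2 * `|l| * (hnorm (u n - w) * (`|K| * hnorm v + 1)))).
        by rewrite ler_wpM2l // mulr_ge0.
      rewrite /Z; have := hnorm_ge0 (u n - w); lra.
    move: a1; rewrite ltr_pdivlMr ?mulr_gt0 //; lra.
  by move: (n.+1%:R^-1) a2 Fn => q *; lra.
have := discriminant_le key; rewrite mul0r => h.
apply/eqP; rewrite -subr_eq0 -sqrf_eq0; apply/eqP/le_anti.
by rewrite h sqr_ge0.
Qed.

(** The subspace need not be closed: the functional that defines [Lam] below lives only on D(A). *)
Lemma riesz_on (D : set H) (phi : H -> R) (M : R) :
  rsubspace D -> rlinear_on D phi ->
  (forall x, D x -> `|phi x| <= M * hnorm x) ->
  exists u, forall v, D v -> rip u v = phi v.
Proof.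
move=> sD lD hM.
apply: (@lax_milgram (@rip R H) D phi 1 1 M) => //.
- exact: ripC.
- exact: ripDl.
- exact: ripZl.
- by move=> x y; rewrite mul1r rip_le.
- by move=> x; rewrite mul1r hnorm_sqr.
Qed.

Lemma rsubspaceT : rsubspace setT. Proof. by []. Qed.

Lemma riesz (phi : H -> R) (M : R) :
  (forall x y, phi (x + y) = phi x + phi y) ->
  (forall a x, phi (rscale a x) = a * phi x) ->
  (forall x, `|phi x| <= M * hnorm x) ->
  exists u, forall v, rip u v = phi v.
Proof.
move=> pD pZ pM.
have [u uP] := @riesz_on setT phi M rsubspaceT
  ltac:(by split => *; [exact: pD|exact: pZ]) (fun x _ => pM x).
by exists u => v; exact: uP.
Qed.

Lemma dense_rip_le (D : set H) x (M : R) : hdense D -> 0 <= M ->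
  (forall v, D v -> rip x v <= M * hnorm v) -> hnorm x <= M.
Proof.
move=> dD M0 h; apply: hnorm_dual => // y.
have [u Du /hcvgP uy] := dD y.
apply/ler_addgt0Pr => e e0.
have Z0 : 0 < hnorm x + M + 1 by rewrite ltr_wpDl // addr_ge0.
have [N HN] := uy (e / (hnorm x + M + 1)) ltac:(by rewrite divr_gt0).
have {HN} := HN N (leqnn _).
rewrite ltr_pdivlMr // => HN.
have h1 := h _ (Du N).
have h2 := rip_leW x (y - u N); rewrite ripDr ripNr hnorm_sym in h2.
have h3 : M * hnorm (u N) <= M * (hnorm y + hnorm (u N - y)).
  by rewrite ler_wpM2l // -lerBlDl; have := hnorm_dist (u N) y; rewrite ler_norml; lra.
have := hnorm_ge0 (u N - y); nra.
Qed.

Lemma dense_rip_inj (D : set H) x y : hdense D ->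
  (forall v, D v -> rip x v = rip y v) -> x = y.
Proof.
move=> dD h; apply/eqP; rewrite -subr_eq0; apply/eqP/hnorm_eq0/le_anti.
rewrite hnorm_ge0 andbT; apply: (dense_rip_le dD) => // v Dv.
by rewrite mul0r ripDl ripNl h // subrr.
Qed.

Lemma dense_near (D : set H) x e : hdense D -> 0 < e ->
  exists2 y, D y & hnorm (y - x) < e.
Proof.
move=> dD e0; have [u Du /hcvgP/(_ e e0)[N HN]] := dD x.
by exists (u N) => //; exact: HN.
Qed.
End LaxMilgram.

(** * Bounded operators, adjoints and inverses *)

Section BoundedOps.
Variables (R : realType).

Section Two.
Variables (H K : hilbert R) (F : H -> K).
Hypothesis Fb : bounded_op F.

Lemma bopD x y : F (x + y) = F x + F y.
Proof. by case: Fb => h _; have := h 1 x y; rewrite !scale1r. Qed.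

Lemma bop0 : F 0 = 0.
Proof. by apply: (addIr (F 0)); rewrite -bopD !add0r. Qed.

Lemma bopZ (a : R[i]) x : F (a *: x) = a *: F x.
Proof. by case: Fb => h _; have := h a x 0; rewrite !addr0 bop0 addr0. Qed.

Lemma bopZr (a : R) x : F (rscale a x) = rscale a (F x).
Proof. exact: bopZ. Qed.

Lemma bopN x : F (- x) = - F x.
Proof. by rewrite -scaleN1r bopZ scaleN1r. Qed.

Lemma bopB x y : F (x - y) = F x - F y.
Proof. by rewrite bopD bopN. Qed.

Lemma bop_bound : exists2 M : R, 0 <= M & forall x, hnorm (F x) <= M * hnorm x.
Proof.
case: Fb => _ [M HM]; exists `|M| => // x.
by apply: le_trans (HM x) _; rewrite ler_wpM2r // ler_norm.
Qed.

Lemma bop_adj_ex y : exists w, forall x, ip (F x) y = ip x w.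
Proof.
have [M M0 HM] := bop_bound.
have [w wP] := @riesz _ H (fun x => rip (F x) y) (M * hnorm y)
  ltac:(by move=> x z /=; rewrite bopD ripDl)
  ltac:(by move=> a x /=; rewrite bopZr ripZl)
  ltac:(move=> x; apply: le_trans (rip_le _ _) _;
        by rewrite mulrAC ler_wpM2r).
have wP' x : rip (F x) y = rip x w by rewrite -wP ripC.
exists w => x; rewrite !ipE wP'; congr (_ +i* _).
(* The real identity at ['i%C *: x] is the imaginary one at [x]. *)
have := wP' ('i%C *: x); rewrite bopZ !rip_il; lra.
Qed.

Lemma hadjE x y : ip (F x) y = ip x (hadj F y).
Proof. exact: (xgetPex 0 (bop_adj_ex y)). Qed.

Lemma hadjEr x y : rip (F x) y = rip x (hadj F y).
Proof. by rewrite /rip hadjE. Qed.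

Lemma hadj_eq y w : (forall x, rip (F x) y = rip x w) -> hadj F y = w.
Proof. by move=> h; apply: rip_injr => x; rewrite -hadjEr h. Qed.

End Two.

Lemma hadj_bounded (H K : hilbert R) (F : H -> K) : bounded_op F -> bounded_op (hadj F).
Proof.
move=> Fb; split.
  move=> a x y; apply: ip_inj => z.
  by rewrite -hadjE // !(ipDr, ipZr) -!hadjE.
have [M M0 HM] := bop_bound Fb; exists M => x.
apply: hnorm_dual; first by rewrite mulr_ge0.
move=> y; rewrite ripC -hadjEr //; apply: le_trans (rip_leW _ _) _.
by rewrite mulrAC ler_wpM2r.
Qed.

Lemma comp_bounded (H K L : hilbert R) (F : H -> K) (G : K -> L) :
  bounded_op F -> bounded_op G -> bounded_op (G \o F).
Proof.
move=> Fb Gb; split.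
  by move=> a x y; rewrite /= (bopD Fb) (bopZ Fb) (bopD Gb) (bopZ Gb).
have [M M0 HM] := bop_bound Fb; have [N N0 HN] := bop_bound Gb.
exists (N * M) => x; apply: le_trans (HN _) _.
by rewrite -mulrA ler_wpM2l.
Qed.

Lemma scale_bop (H : hilbert R) (a : R[i]) : bounded_op (fun x : H => a *: x : H).
Proof.
split; first by move=> c x y; rewrite scalerDr !scalerA mulrC.
exists (`|complex.Re a| + `|complex.Im a|) => x.
have -> : a *: x = rscale (complex.Re a) x + 'i%C *: rscale (complex.Im a) x.
  by rewrite /rscale scalerA -scalerDl; congr (_ *: _); case: a => p q; simpc.
apply: le_trans (hnorm_add _ _) _.
by rewrite hnormi !hnorm_scale mulrDl.
Qed.

Lemma opinvK (H K : hilbert R) (F : H -> K) x : injective F -> opinv F (F x) = x.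
Proof.
move=> Fi; apply: Fi; exact: (@xgetPex _ 0 [set z | F z = F x] (ex_intro _ x erefl)).
Qed.

Lemma opinvKr (H K : hilbert R) (F : H -> K) y : (exists x, F x = y) -> F (opinv F y) = y.
Proof. by move=> h; exact: (@xgetPex _ 0 [set z | F z = y] h). Qed.

(** Coercivity bounds [F] from below, which gives injectivity and the bound on the inverse;
    surjectivity is Lax-Milgram for the form [rip (F x) z]. *)
Lemma coercive_iso (H : hilbert R) (F : H -> H) (c : R) : self_adjoint_op F ->
  0 < c -> (forall x, c * hnorm x ^+ 2 <= rip (F x) x) ->
  [/\ forall y, F (opinv F y) = y, forall x, opinv F (F x) = x,
      self_adjoint_op (opinv F) & forall x, hnorm (opinv F x) <= c^-1 * hnorm x].
Proof.
move=> [Fb Fs] c0 hc.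
have Fsr x y : rip (F x) y = rip x (F y) by rewrite /rip Fs.
have low x : c * hnorm x <= hnorm (F x).
  have [->|x0] := eqVneq (hnorm x) 0; first by rewrite mulr0.
  have p : 0 < hnorm x by rewrite lt_def x0 /=.
  rewrite -(ler_pM2r p).
  by rewrite -mulrA -expr2; apply: le_trans (hc x) (rip_leW _ _).
have Fi : injective F.
  move=> x y e; apply/eqP; rewrite -subr_eq0; apply/eqP/hnorm_eq0.
  have := low (x - y); rewrite (bopB Fb) e subrr hnorm0 pmulr_rle0 // => h.
  by apply/le_anti; rewrite h hnorm_ge0.
have Fs' y : exists x, F x = y.
  have [M M0 HM] := bop_bound Fb.
  have [u uP] := @lax_milgram _ H (fun x z => rip (F x) z) setT (fun z => rip y z) M c (hnorm y)
   ltac:(by move=> x z /=; rewrite Fsr ripC) ltac:(by move=> * /=; rewrite (bopD Fb) ripDl)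
   ltac:(by move=> * /=; rewrite (bopZr Fb) ripZl)
   ltac:(by move=> x z; apply: le_trans (rip_le _ _) _; rewrite ler_wpM2r)
   c0 hc (@rsubspaceT _ H) ltac:(by split => * /=; rewrite ?ripDr ?ripZr)
   ltac:(by move=> *; exact: rip_le).
  by exists u; apply: rip_inj => w; exact: uP.
have K1 y : F (opinv F y) = y by exact: opinvKr.
have K2 x : opinv F (F x) = x by exact: opinvK.
have bd x : hnorm (opinv F x) <= c^-1 * hnorm x.
  by rewrite mulrC ler_pdivlMr // mulrC -{2}(K1 x).
split => //; split.
  split; last by exists c^-1.
  by move=> a x y; apply: Fi; rewrite K1 (bopD Fb) (bopZ Fb) !K1.
by move=> x y; rewrite -{1}(K1 y) -Fs K1.
Qed.

End BoundedOps.

(** * The uniform boundedness principle *)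

Section UniformBoundedness.
Variables (R : realType) (H K : hilbert R) (I : Type) (F : I -> H -> K).
Hypothesis Fb : forall i, bounded_op (F i).

(* Sokal's proof: if F i is large at v, it is large at x + v or at x - v. *)
Lemma sokal_step i (x v : H) : exists2 x' : H,
  hnorm (x' - x) <= hnorm v & hnorm (F i v) <= hnorm (F i x').
Proof.
have [h|h] := leP (hnorm (F i v)) (hnorm (F i (x + v))).
  by exists (x + v) => //; rewrite addrAC subrr add0r.
exists (x - v); first by rewrite addrAC subrr add0r hnorm_opp.
have E : rscale 2 (F i v) = F i (x + v) - F i (x - v).
  by rewrite !(bopD (Fb i)) (bopN (Fb i)); apply: rip_inj => w; rewrite !ripE; ring.
have := hnorm_scale 2 (F i v); rewrite E ger0_norm //.
have := hnorm_add (F i (x + v)) (- F i (x - v)); rewrite hnorm_opp.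
lra.
Qed.

Lemma uniform_bound :
  (forall x, exists M : R, forall i, hnorm (F i x) <= M) ->
  exists2 M : R, 0 <= M & forall i x, hnorm (F i x) <= M * hnorm x.
Proof.
move=> pb; apply: contrapT => nb.
have big (m r : R) : 0 <= m -> 0 < r -> exists i, exists2 v, hnorm v <= r & m <= hnorm (F i v).
  move=> m0 r0; apply: contrapT => h; apply: nb; exists (m / r); first by rewrite divr_ge0 // ltW.
  move=> i x; have [x0|xn] := eqVneq (hnorm x) 0.
    by rewrite (hnorm_eq0 x0) (bop0 (Fb i)) !hnorm0 mulr0.
  have xp : 0 < hnorm x by rewrite lt_def xn /=.
  have q0 : 0 <= r / hnorm x by rewrite divr_ge0 // ltW.
  rewrite leNgt; apply/negP => lt; apply: h; exists i, (rscale (r / hnorm x) x).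
    by rewrite hnorm_scale ger0_norm // divfK.
  rewrite (bopZr (Fb i)) hnorm_scale ger0_norm //.
  have : m / r * hnorm x * (r / hnorm x) <= hnorm (F i x) * (r / hnorm x).
    by rewrite ler_wpM2r // ltW.
  rewrite (_ : m / r * _ * _ = m); first by rewrite mulrC.
  by field; rewrite xn /= gt_eqF.
have step (a : nat * (H * R)) : exists b : H * R, 0 < a.2.2 ->
    [/\ hnorm (b.1 - a.2.1) <= a.2.2 / 2, 0 < b.2, b.2 <= a.2.2 / 2, b.2 <= a.1.+1%:R^-1 &
      exists i, forall u, hnorm u <= b.2 -> a.1%:R <= hnorm (F i (b.1 + u))].
  case: a => n [x r] /=; have [r0|r0] := ltP 0 r; last by exists (x, r).
  have [i [v vr Fv]] := big n.+1%:R (r / 2) ltac:(by []) ltac:(by rewrite divr_gt0).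
  have [x' xx' Fx'] := sokal_step i x v.
  have [M M0 hM] := bop_bound (Fb i); have M1 : 0 < M + 1 by rewrite ltr_wpDl.
  (* The half keeps the closed balls nested, [n.+1%:R^-1] shrinks them, and [(M + 1)^-1] lets [F i]
     vary by at most 1 on the new ball, which is why [n.+1%:R] was asked of [v]. *)
  exists (x', Num.min (r / 2) (Num.min n.+1%:R^-1 (M + 1)^-1)) => _ /=; split.
  - exact: le_trans xx' vr.
  - by rewrite !lt_min divr_gt0 // !invr_gt0 ltr0n.
  - by rewrite ge_min lexx.
  - by rewrite !ge_min lexx orbT.
  exists i => u; rewrite !le_min => /andP[_ /andP[_ hu]].
  rewrite (bopD (Fb i)).
  have h1 := hnorm_add (F i x' + F i u) (- F i u); rewrite addrK hnorm_opp in h1.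
  have h2 := hM u; have : M * hnorm u <= 1.
    apply: le_trans (_ : M * (M + 1)^-1 <= 1); first exact: ler_wpM2l.
    by rewrite ler_pdivrMr // mul1r lerDl.
  have : (n.+1%:R : R) = n%:R + 1 by rewrite -addn1 natrD.
  by move: (le_trans Fv Fx') => *; lra.
have [f fP] := choice step.
have [x0 _] : exists x : H, True by exists 0.
pose s := fix s n := if n is m.+1 then f (m, s m) else (x0, 1).
have s0 n : 0 < (s n).2 by elim: n => [|n IH] //=; have [] := fP (n, s n) IH.
have sP n := fP (n, s n) (s0 n).
have near m n : hnorm ((s (n + m)%N).1 - (s n).1) <= (s n).2 - (s (n + m)%N).2.
  elim: m => [|m IH]; first by rewrite addn0 !subrr hnorm0.
  rewrite addnS /=; have [h1 _ h2 _ _] := sP (n + m)%N; rewrite /= in h1 h2.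
  by apply: le_trans (hnorm_tri (s (n + m)%N).1 _ _) _; lra.
have near' m n : (n <= m)%N -> hnorm ((s m).1 - (s n).1) <= (s n).2.
  by move=> nm; have := near (m - n)%N n; rewrite subnKC //; have := s0 m; lra.
have h1 : forall e : R, 0 < e -> exists N : nat, (N.+1%:R^-1 : R) < e.
  move=> e e0; exists (Num.truncn e^-1).
  rewrite invf_plt ?posrE ?ltr0n //; exact: truncnS_gt.
have [x xP] : exists x, hlim (fun n => (s n).1) x.
  apply: hcomplete_seq => e e0; have [N HN] := h1 (e / 2) ltac:(by rewrite divr_gt0).
  exists N.+1 => m n Nm Nn; have a1 := near' m _ Nm; have a2 := near' n _ Nn.
  have [_ _ _ a3 _] := sP N; rewrite /= in a3 a1 a2; rewrite hnorm_sym in a2.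
  apply: le_lt_trans (hnorm_tri (s N.+1).1 _ _) _ => /=.
  by move: (N.+1%:R^-1) HN a3 => q *; lra.
have [M hM] := pb x.
pose n := (Num.truncn M).+1.
have [_ _ _ _ [i hi]] := sP n.
have : n%:R <= hnorm (F i x).
  rewrite -[x](subrK (s n.+1).1) addrC; apply: hi.
  apply/ler_addgt0Pr => e e0; have [N HN] := xP e e0.
  have a1 := HN (maxn N n.+1) (leq_maxl _ _); have a2 := near' (maxn N n.+1) n.+1 (leq_maxr _ _).
  rewrite hnorm_sym in a1; apply: le_trans (hnorm_tri (s (maxn N n.+1)).1 _ _) _.
  by rewrite addrC; apply: lerD; [exact: a2|exact: ltW].
move=> a1; have := le_trans a1 (hM i); rewrite leNgt => /negP; apply.
by rewrite /n truncnS_gt.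
Qed.

End UniformBoundedness.

(** * Integrals and derivatives relative to an interval *)

Section RealIntegral.
Variable R : realType.
Implicit Types (a b c r s t e l M : R) (f g : R -> R).
Local Notation leb := (@lebesgue_measure R).

Definition rI a b f : R := Rintegral leb `[a, b] f.
Definition intg a b f := leb.-integrable `[a, b] (EFin \o f).

Definition rcont a b f := forall s, a <= s <= b -> forall e : R, 0 < e ->
  exists2 d : R, 0 < d & forall t, a <= t <= b -> `|t - s| < d -> `|f t - f s| < e.

Lemma rcontP a b f : rcont a b f <-> {within `[a, b], continuous f}.
Proof.
split.
  move=> h; apply/subspace_continuousP => x; rewrite /= in_itv /= => xab.
  apply/cvgrPdist_lt => e e0; have [d d0 hd] := h x xab e e0.
  rewrite /= near_withinE; apply/nbhs_ballP; exists d => //= t.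
  rewrite /ball /= in_itv /= => td tab; rewrite distrC; apply: hd => //.
  by rewrite distrC.
move=> /subspace_continuousP h s sab e e0.
have /cvgrPdist_lt/(_ e e0) : f x @[x --> within `[a, b] (nbhs s)] --> f s.
  by apply: h; rewrite /= in_itv.
rewrite near_withinE => /nbhs_ballP [d /= d0 hd].
exists d => // t tab ts; rewrite distrC; apply: (hd t) => //=.
  by rewrite /ball /= distrC.
Qed.

Lemma sub_itv a b c d : c <= a -> b <= d -> `[a, b] `<=` `[c, d].
Proof.
move=> ca bd x /=; rewrite !in_itv /= => /andP[ax xb].
by rewrite (le_trans ca ax) (le_trans xb bd).
Qed.

Lemma rcontW a b c d f : c <= a -> b <= d -> rcont c d f -> rcont a b f.
Proof.
move=> ca bd h s /andP[s1 s2] e e0; have [dd d0 hd] := h s (introT andP (conj (le_trans ca s1) (le_trans s2 bd))) e e0.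
exists dd => // t /andP[t1 t2]; apply: hd.
by rewrite (le_trans ca t1) (le_trans t2 bd).
Qed.

Lemma rcont_intg a b f : rcont a b f -> intg a b f.
Proof.
move=> /rcontP h; apply: continuous_compact_integrable => //.
exact: segment_compact.
Qed.

Lemma intgW a b c d f : c <= a -> b <= d -> intg c d f -> intg a b f.
Proof. by move=> ca bd; apply: integrableS => //; exact: sub_itv. Qed.

Lemma eq_rI a b f g : (forall r, a <= r <= b -> f r = g r) -> rI a b f = rI a b g.
Proof.
move=> h; apply: eq_Rintegral => r; rewrite inE /= in_itv /=; exact: h.
Qed.

Lemma eq_intg a b f g : (forall r, a <= r <= b -> f r = g r) -> intg a b f -> intg a b g.
Proof.
move=> h; apply: eq_integrable => // r; rewrite inE /= in_itv /= => rab.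
by rewrite h.
Qed.

Lemma intgD a b f g : intg a b f -> intg a b g -> intg a b (fun r => f r + g r).
Proof. by move=> hf hg; apply: (integrableD _ hf hg). Qed.

Lemma intgZ a b f l : intg a b f -> intg a b (fun r => l * f r).
Proof. by move=> hf; apply: (integrableZl _ _ hf). Qed.

Lemma intgN a b f : intg a b f -> intg a b (fun r => - f r).
Proof. by move=> /(intgZ (-1)); apply: eq_intg => r _; rewrite mulN1r. Qed.

Lemma intgB a b f g : intg a b f -> intg a b g -> intg a b (fun r => f r - g r).
Proof. by move=> hf /intgN hg; exact: intgD. Qed.

Lemma rID a b f g : intg a b f -> intg a b g ->
  rI a b (fun r => f r + g r) = rI a b f + rI a b g.
Proof. by move=> hf hg; apply: RintegralD. Qed.

Lemma rIZ a b f l : intg a b f -> rI a b (fun r => l * f r) = l * rI a b f.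
Proof. by move=> hf; apply: RintegralZl. Qed.

Lemma rIB a b f g : intg a b f -> intg a b g ->
  rI a b (fun r => f r - g r) = rI a b f - rI a b g.
Proof. by move=> hf hg; apply: RintegralB. Qed.

Lemma rIN a b f : intg a b f -> rI a b (fun r => - f r) = - rI a b f.
Proof.
by move=> hf; rewrite -mulN1r -rIZ //; apply: eq_rI => r _; rewrite mulN1r.
Qed.

Lemma rI_EFin a b f : intg a b f ->
  (\int[leb]_(r in `[a, b]) (f r)%:E)%E = (rI a b f)%:E.
Proof. by move=> hf; rewrite /rI /Rintegral fineK //; exact: integrable_fin_num. Qed.

Lemma rI_ge0 a b f : (forall r, a <= r <= b -> 0 <= f r) -> 0 <= rI a b f.
Proof. by move=> h; apply: Rintegral_ge0 => r; rewrite /= in_itv /=; exact: h. Qed.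

Lemma le_rI a b f g : intg a b f -> intg a b g ->
  (forall r, a <= r <= b -> f r <= g r) -> rI a b f <= rI a b g.
Proof.
by move=> hf hg h; apply: le_Rintegral => // r; rewrite /= in_itv /=; exact: h.
Qed.

Lemma intg_cst a b l : intg a b (cst l).
Proof. by apply: rcont_intg => s _ e e0; exists 1 => // t _ _; rewrite subrr normr0. Qed.

Lemma rI_cst a b l : a <= b -> rI a b (cst l) = l * (b - a).
Proof.
move=> ab; rewrite /rI Rintegral_cst //=; congr (_ * _).
have := @lebesgue_measure_itv R `[a, b]; rewrite /= lte_fin => ->.
by case: ltgtP ab => //= -> _; rewrite subrr.
Qed.

Lemma rI_ub a b f M : a <= b -> intg a b f ->
  (forall r, a <= r <= b -> f r <= M) -> rI a b f <= M * (b - a).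
Proof.
move=> ab hf h; rewrite -rI_cst //; apply: le_rI => //; exact: intg_cst.
Qed.

Lemma abs_rI_ub a b f M : a <= b -> intg a b f ->
  (forall r, a <= r <= b -> `|f r| <= M) -> `|rI a b f| <= M * (b - a).
Proof.
move=> ab hf h; rewrite ler_norml -mulNr; apply/andP; split; last first.
  by apply: rI_ub => // r /h; rewrite ler_norml => /andP[].
rewrite mulNr lerNl -rIN //; apply: rI_ub => //; first exact: intgN.
by move=> r /h; rewrite ler_norml => /andP[]; rewrite lerNl.
Qed.

Lemma rI_split c a b f : a <= c <= b -> intg a b f ->
  rI a b f = rI a c f + rI c b f.
Proof.
move=> /andP[ac cb] hf.
have := @Rintegral_itvB R f (BLeft a) (BRight b) c hf.
rewrite !bnd_simp => /(_ ac cb) h.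
rewrite /rI -(@Rintegral_itv_obnd_cbnd R c (BRight b)) -?h; last first.
  apply: integrableS hf => // x /=; rewrite !in_itv /= => /andP[cx ->].
  by rewrite (le_trans ac (ltW cx)).
by rewrite addrC subrK.
Qed.

Lemma rI_aa a f : rI a a f = 0.
Proof. by rewrite /rI set_itv1 Rintegral_set1. Qed.

(** This is the continuity of the indefinite integral at [r]. Both ends are free because the
    intervals met later may lie on either side of [r]. *)
Lemma rI_abscont a b f : intg a b f -> forall r, a <= r <= b -> forall e : R, 0 < e ->
  exists2 d : R, 0 < d & forall s t, a <= s <= b -> a <= t <= b ->
    s <= t -> `|s - r| < d -> `|t - r| < d -> `|rI s t f| < e.
Proof.
move=> hf r rab e e0.
have ab : a <= b by case/andP: rab => h1 h2; exact: le_trans h1 h2.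
have /rcontP h := parameterized_integral_continuous ab hf.
have [d d0 hd] := h r rab _ (divr_gt0 e0 (ltr0n R 2)).
exists d => // s t sab tab st sr tr.
have split1 : rI a t f = rI a s f + rI s t f.
  apply: rI_split; first by case/andP: sab => -> _.
  by apply: intgW hf => //; case/andP: tab.
have := hd s sab sr; have := hd t tab tr; rewrite /parameterized_integral -!/(rI _ _ _) split1.
rewrite !ltr_norml; lra.
Qed.

(** The derivative relative to [[a, b]], one-sided at an end; multiplied out, so that [s = t] needs
    no exception. *)
Definition rder a b f t l := forall e : R, 0 < e -> exists2 d : R, 0 < d &
  forall s, a <= s <= b -> `|s - t| < d -> `|f s - f t - l * (s - t)| <= e * `|s - t|.

Lemma rderW a b c d f t l : c <= a -> b <= d -> rder c d f t l -> rder a b f t l.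
Proof.
move=> ca bd h e e0; have [dd d0 hd] := h e e0; exists dd => // s /andP[s1 s2].
by apply: hd; rewrite (le_trans ca s1) (le_trans s2 bd).
Qed.

Lemma rderD a b f g t l m : rder a b f t l -> rder a b g t m ->
  rder a b (fun r => f r + g r) t (l + m).
Proof.
move=> hf hg e e0; have e2 : 0 < e / 2 by rewrite divr_gt0.
have [d d0 hd] := hf _ e2; have [d' d0' hd'] := hg _ e2.
exists (Num.min d d'); first by rewrite lt_min d0.
move=> s sab; rewrite lt_min => /andP[s1 s2].
rewrite (_ : _ - _ - _ = (f s - f t - l * (s - t)) + (g s - g t - m * (s - t))); last by ring.
have := hd s sab s1; have := hd' s sab s2; have := ler_normD (f s - f t - l * (s - t)) (g s - g t - m * (s - t)); lra.
Qed.

Lemma rderZ a b f t l c : rder a b f t l -> rder a b (fun r => c * f r) t (c * l).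
Proof.
move=> hf e e0; have c1 : 0 < `|c| + 1 by rewrite ltr_wpDl.
have [d d0 hd] := hf _ (divr_gt0 e0 c1); exists d => // s sab st.
rewrite -!mulrA -!mulrBr normrM.
apply: le_trans (_ : `|c| * (e / (`|c| + 1) * `|s - t|) <= _).
  by rewrite ler_wpM2l // hd.
rewrite mulrA ler_wpM2r // mulrCA ger_pMr // ler_pdivrMr //; lra.
Qed.

Lemma rderN a b f t l : rder a b f t l -> rder a b (fun r => - f r) t (- l).
Proof.
move=> hf; rewrite -mulN1r; have := rderZ (-1) hf.
by under [X in _ -> rder _ _ X _ _]eq_fun do rewrite -mulN1r.
Qed.

Lemma rder_cont a b f t l : rder a b f t l -> forall e : R, 0 < e ->
  exists2 d : R, 0 < d & forall s, a <= s <= b -> `|s - t| < d -> `|f s - f t| < e.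
Proof.
move=> h e e0; have [d d0 hd] := h 1 ltr01.
have l0 : 0 < `|l| + 2 by rewrite ltr_wpDl.
exists (Num.min d (e / (`|l| + 2))); first by rewrite lt_min d0 divr_gt0.
move=> s sab; rewrite lt_min => /andP[s1]; rewrite ltr_pdivlMr // => s2.
have := hd s sab s1; rewrite mul1r => h1.
have h2 := ler_normD (f s - f t - l * (s - t)) (l * (s - t)).
rewrite subrK normrM in h2; have := normr_ge0 (s - t); nra.
Qed.

Lemma rder_rcont a b f (l : R -> R) : (forall t, a <= t <= b -> rder a b f t (l t)) -> rcont a b f.
Proof. by move=> h s sab e e0; exact: rder_cont (h s sab) e e0. Qed.

Lemma rder_is_derive a b f t l : a < t < b -> rder a b f t l -> is_derive t 1 f l.
Proof.
move=> /andP[a_t tb] h.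
have hc : (fun x => x^-1 *: ((f \o shift t) (x *: 1) - f t)) @ 0^' --> l.
  apply/cvgrPdist_le => e e0; have [d d0 hd] := h e e0.
  have m0 : 0 < Num.min d (Num.min (t - a) (b - t)) by rewrite !lt_min d0 !subr_gt0 a_t.
  apply/nbhs_ballP; exists (Num.min d (Num.min (t - a) (b - t))) => //= y.
  rewrite /ball /= sub0r normrN !lt_min => /andP[yd /andP[ya yb]] y0.
  rewrite /shift /= [y *: 1]mulr1.
  have yy : y + t - t = y by rewrite addrK.
  have := hd (y + t); rewrite yy => /(_ _ yd) hh.
  have y1 : 0 < `|y| by rewrite normr_gt0.
  have : `|y| * `|l - y^-1 *: (f (y + t) - f t)| <= `|y| * e.
    rewrite -normrM mulrBr [_ *: _]/(_ * _) mulrA divff // mul1r distrC (mulrC y) (mulrC `|y|).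
    apply: hh; move: ya yb; rewrite !ltr_norml; lra.
  by rewrite ler_pM2l.
apply: DeriveDef; first by apply/cvg_ex; exists l.
by rewrite /derive; apply/cvg_lim.
Qed.

Lemma rder_le0 a b f : a <= b -> rcont a b f ->
  (forall t, a < t < b -> exists2 l, l <= 0 & rder a b f t l) -> f b <= f a.
Proof.
move=> ab /rcontP fc h.
have h' t : t \in `]a, b[ -> exists2 l, l <= 0 & is_derive t 1 f l.
  rewrite in_itv /= => tab; have [l l0 hl] := h t tab; exists l => //.
  exact: rder_is_derive hl.
apply: (@ler0_derive1_nincr R f a b) => //.
  by move=> x /h'[l _ []].
by move=> x /h'[l l0 fd]; rewrite derive1E derive_val.
Qed.

Lemma rder_eq0 a b f : a <= b -> rcont a b f ->
  (forall t, a < t < b -> rder a b f t 0) -> f b = f a.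
Proof.
move=> ab fc h; apply/le_anti/andP; split.
  by apply: rder_le0 => // t /h; exists 0.
rewrite -lerN2; apply: (@rder_le0 a b (fun r => - f r)) => //.
  by move=> s sab e e0; have [d d0 hd] := fc s sab e e0; exists d => // t tab ts;
     rewrite -opprD normrN; exact: hd.
by move=> t /h/rderN; rewrite oppr0; exists 0.
Qed.

Lemma rI_rder a b f t : rcont a b f -> a <= t <= b -> rder a b (fun r => rI a r f) t (f t).
Proof.
move=> fc /andP[a_t tb] e e0.
have [d d0 hd] := fc t (introT andP (conj a_t tb)) e e0.
exists d => // s /andP[sa sb] st.
have ff r r' : a <= r -> r' <= b -> intg r r' f by move=> *; apply: rcont_intg; apply: rcontW fc.
have key r r' : a <= r -> r <= r' -> r' <= b -> `|r - t| < d -> `|r' - t| < d ->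
    `|rI r r' f - f t * (r' - r)| <= e * `|r' - r|.
  move=> ar rr rb rd rd'; rewrite -rI_cst // -rIB; [|exact: ff|exact: intg_cst].
  rewrite (ger0_norm (_ : 0 <= r' - r)) ?subr_ge0 //.
  apply: abs_rI_ub => //.
    by apply: intgB; [exact: ff|exact: intg_cst].
  move=> x /andP[x1 x2]; apply/ltW/hd.
    by rewrite (le_trans ar x1) (le_trans x2 rb).
  by move: rd rd'; rewrite !ltr_norml; lra.
have tt : `|t - t| < d by rewrite subrr normr0.
case: (leP t s) => ts.
  rewrite (@rI_split t a s) ?a_t ?ts //; last exact: ff.
  rewrite [rI a t f + _]addrC addrK; exact: key.
rewrite (@rI_split s a t) ?sa ?(ltW ts) //; last exact: ff.
have := key s t sa (ltW ts) tb st tt; rewrite (distrC t s).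
rewrite -normrN; congr (_ <= _); rewrite -normrN; congr `|_|; ring.
Qed.

Lemma rcontD a b f g : rcont a b f -> rcont a b g -> rcont a b (fun r => f r + g r).
Proof.
move=> hf hg s sab e e0.
have [d d0 hd] := hf s sab _ (divr_gt0 e0 (ltr0n R 2)).
have [d' d0' hd'] := hg s sab _ (divr_gt0 e0 (ltr0n R 2)).
exists (Num.min d d'); first by rewrite lt_min d0.
move=> t tab; rewrite lt_min => /andP[t1 t2].
by have := hd t tab t1; have := hd' t tab t2; rewrite !ltr_norml; lra.
Qed.

Lemma rcontN a b f : rcont a b f -> rcont a b (fun r => - f r).
Proof.
move=> hf s sab e e0; have [d d0 hd] := hf s sab e e0.
by exists d => // t tab ts; rewrite -opprD normrN; exact: hd.
Qed.

Lemma FTC_rder a b f (F : R -> R) : a <= b -> rcont a b f ->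
  rcont a b F -> (forall t, a < t < b -> rder a b F t (f t)) -> rI a b f = F b - F a.
Proof.
move=> ab fc Fc h.
have ii : rcont a b (fun r => rI a r f) by exact: (rder_rcont (fun t => @rI_rder a b f t fc)).
have := @rder_eq0 a b (fun r => rI a r f - F r) ab.
rewrite rI_aa sub0r => E; apply/eqP; rewrite -subr_eq0 opprD opprK addrA addrC.
rewrite E ?subrr //; first by apply: rcontD => //; exact: rcontN.
move=> t tab; rewrite -(subrr (f t)).
apply: rderD; last exact/rderN/h.
by apply: rI_rder => //; case/andP: tab => /ltW -> /ltW ->.
Qed.

Lemma is_derive_rder a b f t l : is_derive t 1 f l -> rder a b f t l.
Proof.
move=> [/cvg_ex [m hm] hl] e e0.
have ml : m = l by rewrite -hl; apply/esym/cvg_lim.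
move/cvgrPdist_le: hm => /(_ e e0); rewrite ml => /nbhs_ballP [d /= d0 hd].
exists d => // s sab st; have [->|st0] := eqVneq s t.
  by rewrite !subrr mulr0 subrr normr0 mulr0.
have /= := hd (s - t); rewrite /ball /= sub0r normrN => /(_ st).
rewrite subr_eq0 st0 => /(_ isT); rewrite /shift /= [(s - t) *: 1]mulr1 subrK.
rewrite /GRing.scale /= => h.
have p : 0 < `|s - t| by rewrite normr_gt0 subr_eq0.
rewrite -(ler_pM2r p) -normrM in h.
apply: le_trans h; rewrite -normrN le_eqVlt; apply/orP; left; apply/eqP.
by congr `|_|; field; rewrite subr_eq0.
Qed.

Lemma rder_expR a b l t : rder a b (fun r => expR (l * r)) t (l * expR (l * t)).
Proof.
apply: is_derive_rder; apply: is_derive_eq; rewrite /GRing.scale /=; ring.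
Qed.

Lemma rI_expR a b l : a <= b ->
  rI a b (fun r => l * expR (l * r)) = expR (l * b) - expR (l * a).
Proof.
move=> ab; have c1 m : rcont a b (fun r => expR (m * r)).
  by apply: rder_rcont => t _; exact: rder_expR.
apply: (@FTC_rder a b _ (fun r => expR (l * r))) => //.
  by apply: rder_rcont => t _; apply: rderZ; exact: rder_expR.
by move=> t _; exact: rder_expR.
Qed.

Lemma rcont_bounded a b f : rcont a b f ->
  exists2 M, 0 <= M & forall s, a <= s <= b -> `|f s| <= M.
Proof.
move=> fc; have [ab|ba] := leP a b; last first.
  by exists 0 => // s /andP[s1 s2]; move: (le_lt_trans (le_trans s1 s2) ba); rewrite ltxx.
have [c _ hc] := EVT_max ab (proj1 (rcontP a b f) fc).
have [c' _ hc'] := EVT_min ab (proj1 (rcontP a b f) fc).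
exists (`|f c| + `|f c'|) => [|s sab]; first by rewrite addr_ge0.
have h1 := hc s; have h2 := hc' s; rewrite !in_itv /= in h1 h2.
have := h1 sab; have := h2 sab; have := ler_norm (f c); have := ler_norm (- f c').
have := normr_ge0 (f c); have := normr_ge0 (f c'); rewrite normrN ler_norml; lra.
Qed.

End RealIntegral.

(** * Translation invariance of Lebesgue measure *)

Lemma leb_shift (R : realType) (t : R) (A : set R) : measurable A ->
  pushforward (@lebesgue_measure R) (fun r : measurableTypeR R => r - t : measurableTypeR R) A =
  @lebesgue_measure R A.
Proof.
have mf : measurable_fun setT (fun r : measurableTypeR R => r - t : measurableTypeR R).
  exact: measurable_funB.
pose m := pushforward (@lebesgue_measure R) (fun r : measurableTypeR R => r - t : measurableTypeR R).
move=> mA; apply/esym.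
(* By uniqueness it is enough to compare the two measures on half-open intervals. *)
apply: (@lebesgue_measure_unique R m) => //= _ [[a b]] _ <-.
rewrite /m/pushforward.
rewrite (_ : _ @^-1` _ = `]a + t, b + t]%classic); last first.
  by apply/seteqP; split => r /=; rewrite !in_itv /= ltrBrDr lerBlDr.
rewrite /= !lebesgue_measure_itv /= !lte_fin ltrD2r -!EFinD.
by case: ifP => // _; congr EFin; ring.
Qed.
Lemma integral_shift (R : realType) (a b t : R) (f : R -> \bar R) :
  measurable_fun `[a, b] f -> (forall x, 0 <= f x)%E ->
  (\int[@lebesgue_measure R]_(r in `[(a + t)%R, (b + t)%R]) f (r - t)%R =
   \int[@lebesgue_measure R]_(r in `[a, b]) f r)%E.
Proof.
move=> mf f0.
have mp : measurable_fun setT (fun r : measurableTypeR R => r - t : measurableTypeR R).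
  exact: measurable_funB.
rewrite (_ : `[(a + t)%R, (b + t)%R]%classic = (fun r : measurableTypeR R => r - t : measurableTypeR R) @^-1` `[a, b]); last first.
  by apply/seteqP; split => r /=; rewrite !in_itv /= lerBrDr lerBlDr.
rewrite -(@ge0_integral_pushforward _ _ _ _ R _ mp) //.
by apply: eq_measure_integral => A mA _; rewrite /= leb_shift.
Qed.

(** * Vector-valued functions *)

Section VectorFunctions.
Variables (R : realType).
Implicit Types (a b c r s t e l M : R).
Local Notation leb := (@lebesgue_measure R).

Section Continuity.
Variable H : hilbert R.
Implicit Types f g : R -> H.

Definition hcont a b f := forall s, a <= s <= b -> forall e : R, 0 < e ->
  exists2 d : R, 0 < d & forall t, a <= t <= b -> `|t - s| < d -> hnorm (f t - f s) < e.

Lemma hcontP a b f : hcontinuous_on `[a, b] f <-> hcont a b f.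
Proof.
split => h s sab.
  move=> e e0; have /cvgrPdist_lt/(_ e e0) := h s ltac:(by rewrite /= in_itv).
  rewrite near_withinE => /nbhs_ballP [d /= d0 hd].
  exists d => // t tab ts.
  have := hd t; rewrite /ball /= distrC in_itv => /(_ ts tab).
  by rewrite sub0r normrN ger0_norm.
rewrite /= in_itv /= in sab; apply/cvgrPdist_lt => e e0; have [d d0 hd] := h s sab e e0.
rewrite near_withinE; apply/nbhs_ballP; exists d => //= t.
rewrite /ball /= in_itv /= => td tab; rewrite sub0r normrN ger0_norm //.
by apply: hd => //; rewrite distrC.
Qed.

Lemma hcontW a b c d f : c <= a -> b <= d -> hcont c d f -> hcont a b f.
Proof.
move=> ca bd h s /andP[s1 s2] e e0; have [dd d0 hd] := h s (introT andP (conj (le_trans ca s1) (le_trans s2 bd))) e e0.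
exists dd => // t /andP[t1 t2]; apply: hd.
by rewrite (le_trans ca t1) (le_trans t2 bd).
Qed.

Lemma eq_hcont a b f g : (forall t, a <= t <= b -> f t = g t) -> hcont a b f -> hcont a b g.
Proof.
move=> h hf s sab e e0; have [d d0 hd] := hf s sab e e0; exists d => // t tab ts.
by rewrite -!h //; exact: hd.
Qed.

Lemma hcont_cst a b (x : H) : hcont a b (cst x).
Proof. by move=> s _ e e0; exists 1 => // t _ _; rewrite subrr hnorm0. Qed.

Lemma hcontD a b f g : hcont a b f -> hcont a b g -> hcont a b (fun r => f r + g r).
Proof.
move=> hf hg s sab e e0.
have [d d0 hd] := hf s sab _ (divr_gt0 e0 (ltr0n R 2)).
have [d' d0' hd'] := hg s sab _ (divr_gt0 e0 (ltr0n R 2)).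
exists (Num.min d d'); first by rewrite lt_min d0.
move=> t tab; rewrite lt_min => /andP[t1 t2].
have := hd t tab t1; have := hd' t tab t2.
have := hnorm_add (f t - f s) (g t - g s); rewrite addrACA -opprD; lra.
Qed.

Lemma hcontN a b f : hcont a b f -> hcont a b (fun r => - f r).
Proof.
move=> hf s sab e e0; have [d d0 hd] := hf s sab e e0; exists d => // t tab ts.
by rewrite -opprD hnorm_opp; exact: hd.
Qed.

Lemma hcontB a b f g : hcont a b f -> hcont a b g -> hcont a b (fun r => f r - g r).
Proof. by move=> hf /hcontN; exact: hcontD. Qed.

Lemma hcont_norm a b f : hcont a b f -> rcont a b (fun r => hnorm (f r)).
Proof.
move=> hf s sab e e0; have [d d0 hd] := hf s sab e e0; exists d => // t tab ts.
by apply: le_lt_trans (hnorm_dist _ _) _; exact: hd.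
Qed.

Lemma hcont_bounded a b f : hcont a b f ->
  exists2 M : R, 0 <= M & forall s, a <= s <= b -> hnorm (f s) <= M.
Proof.
move=> /hcont_norm/rcont_bounded [M M0 h]; exists M => // s /h.
by rewrite ger0_norm.
Qed.

Lemma hcont_family (K : hilbert R) a b (F : R -> H -> K) f M :
  (forall s, a <= s <= b -> bounded_op (F s)) ->
  (forall s x, a <= s <= b -> hnorm (F s x) <= M * hnorm x) ->
  (forall x, forall s, a <= s <= b -> forall e : R, 0 < e ->
    exists2 d : R, 0 < d & forall t, a <= t <= b -> `|t - s| < d -> hnorm (F t x - F s x) < e) ->
  hcont a b f ->
  forall s, a <= s <= b -> forall e : R, 0 < e ->
    exists2 d : R, 0 < d & forall t, a <= t <= b -> `|t - s| < d -> hnorm (F t (f t) - F s (f s)) < e.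
Proof.
move=> Fb FM Fc fc s sab e e0.
have e2 : 0 < e / 2 by rewrite divr_gt0.
have M1 : 0 < `|M| + 1 by rewrite ltr_wpDl.
have [d d0 hd] := Fc (f s) s sab _ e2.
have [d' d0' hd'] := fc s sab _ (divr_gt0 e2 M1).
exists (Num.min d d'); first by rewrite lt_min d0.
move=> t tab; rewrite lt_min => /andP[t1 t2].
have h1 := hd t tab t1; have h2 := hd' t tab t2; rewrite ltr_pdivlMr // in h2.
apply: le_lt_trans (hnorm_tri (F t (f s)) _ _) _.
rewrite -(bopB (Fb t tab)).
have h3 := FM t (f t - f s) tab; have h4 := ler_norm M.
have := hnorm_ge0 (f t - f s); nra.
Qed.

End Continuity.

Lemma hcont_op (H K : hilbert R) (F : H -> K) a b f : bounded_op F ->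
  hcont a b f -> hcont a b (fun r => F (f r)).
Proof.
move=> Fb fc; have [M M0 HM] := bop_bound Fb.
apply: (@hcont_family H K a b (fun _ => F) f M) => //.
by move=> x s _ e e0; exists 1 => // t _ _; rewrite subrr hnorm0.
Qed.

(** * Weak integrals of continuous functions *)

Section Weak.
Variable H : hilbert R.
Implicit Types f g : R -> H.

Lemma hcont_rip a b f g : hcont a b f -> hcont a b g -> rcont a b (fun r => rip (f r) (g r)).
Proof.
move=> fc gc s sab e e0.
have [M M0 hM] := hcont_bounded fc.
have N0 : 0 < M + hnorm (g s) + 1 by rewrite ltr_wpDl // addr_ge0.
have [d d0 hd] := fc s sab _ (divr_gt0 e0 N0).
have [d' d0' hd'] := gc s sab _ (divr_gt0 e0 N0).
exists (Num.min d d'); first by rewrite lt_min d0.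
move=> t tab; rewrite lt_min => /andP[t1 t2].
have := hd t tab t1; have := hd' t tab t2; rewrite !ltr_pdivlMr // => h1 h2.
rewrite (_ : _ - _ = rip (f t) (g t - g s) + rip (f t - f s) (g s)); last first.
  by rewrite !ripE; ring.
apply: le_lt_trans (ler_normD _ _) _.
have h3 := rip_le (f t) (g t - g s); have h4 := rip_le (f t - f s) (g s).
have h5 := hM t tab; have h6 := hnorm_ge0 (f t - f s); have h7 := hnorm_ge0 (g t - g s).
have h8 := hnorm_ge0 (g s).
have h9 : hnorm (f t) * hnorm (g t - g s) <= M * hnorm (g t - g s) by rewrite ler_wpM2r.
have h10 : (hnorm (f t - f s) + hnorm (g t - g s)) * (M + hnorm (g s) + 1) < 2 * e.
  lra.
pose A := hnorm (f t - f s); pose B := hnorm (g t - g s).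
have a1 : A * (M + hnorm (g s) + 1) < e by [].
have a2 : B * (M + hnorm (g s) + 1) < e by [].
have [AB|BA] := leP A B.
  have : A * hnorm (g s) <= B * hnorm (g s) by rewrite ler_wpM2r.
  rewrite -/A -/B in h3 h4 h9 *; nra.
have : M * B <= M * A by rewrite ler_wpM2l // ltW.
rewrite -/A -/B in h3 h4 h9 *; nra.
Qed.

Lemma hcont_ripr a b f w : hcont a b f -> rcont a b (fun r => rip (f r) w).
Proof. by move=> fc; exact: hcont_rip fc (@hcont_cst _ a b w). Qed.

Lemma hcont_intg a b f w : hcont a b f -> intg a b (fun r => rip (f r) w).
Proof. by move=> fc; exact/rcont_intg/hcont_ripr. Qed.

(** A weak integral: for [a <= b] and continuous [f] the Riesz theorem provides the vector. *)
Definition vint a b f : H :=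
  xget 0 [set v | forall w, rip v w = rI a b (fun s => rip (f s) w)].

Lemma vintE a b f w : a <= b -> hcont a b f ->
  rip (vint a b f) w = rI a b (fun s => rip (f s) w).
Proof.
move=> ab fc; have [M M0 hM] := hcont_bounded fc.
suff h : exists v, forall w, rip v w = rI a b (fun s => rip (f s) w).
  exact: (xgetPex 0 h).
apply: (@riesz _ _ _ (M * (b - a))).
- move=> x y; rewrite -rID; [|exact: hcont_intg|exact: hcont_intg].
  by apply: eq_rI => r _; rewrite ripDr.
- move=> k x; rewrite -rIZ; last exact: hcont_intg.
  by apply: eq_rI => r _; rewrite ripZr.
- move=> x; rewrite mulrAC; apply: abs_rI_ub => //; first exact: hcont_intg.
  move=> r rab; apply: le_trans (rip_le _ _) _.
  by rewrite ler_wpM2r // hM.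
Qed.

Lemma vint_norm a b f M : a <= b -> hcont a b f -> 0 <= M ->
  (forall s, a <= s <= b -> hnorm (f s) <= M) -> hnorm (vint a b f) <= M * (b - a).
Proof.
move=> ab fc M0 hM; apply: hnorm_dual; first by rewrite mulr_ge0 ?subr_ge0.
move=> y; rewrite vintE // mulrAC; apply: rI_ub => //; first exact: hcont_intg.
move=> r rab; apply: le_trans (rip_leW _ _) _.
by rewrite ler_wpM2r // hM.
Qed.

Lemma vint_split c a b f : a <= c <= b -> hcont a b f ->
  vint a b f = vint a c f + vint c b f.
Proof.
move=> acb fc; have /andP[ac cb] := acb; have ab := le_trans ac cb.
apply: rip_inj => w; rewrite ripDl !vintE //; try by apply: hcontW fc.
by apply: rI_split => //; exact: hcont_intg.
Qed.

Lemma vintD a b f g : a <= b -> hcont a b f -> hcont a b g ->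
  vint a b (fun s => f s + g s) = vint a b f + vint a b g.
Proof.
move=> ab fc gc; apply: rip_inj => w; rewrite ripDl !vintE //; last exact: hcontD.
rewrite -rID; [|exact: hcont_intg|exact: hcont_intg].
by apply: eq_rI => r _; rewrite ripDl.
Qed.

Lemma vint_aa a f : hcont a a f -> vint a a f = 0.
Proof.
by move=> fc; apply: rip_inj => w; rewrite vintE // rI_aa rip0l.
Qed.

Lemma vint0 a b f : a <= b -> (forall r, f r = 0) -> vint a b f = 0.
Proof.
move=> ab f0; have fE : f = cst 0 by apply/funext.
have c0 : hcont a b (cst (0 : H)) by exact: hcont_cst.
apply: rip_inj => w; rewrite fE (vintE w ab c0) rip0l.
by rewrite (@eq_rI _ a b _ (cst 0)) ?rI_cst ?mul0r // => r _; rewrite rip0l.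
Qed.

End Weak.

Lemma vint_op (H K : hilbert R) (F : H -> K) a b f : a <= b -> bounded_op F ->
  hcont a b f -> F (vint a b f) = vint a b (fun r => F (f r)).
Proof.
move=> ab Fb fc; apply: rip_inj => w; rewrite vintE //; last exact: hcont_op.
rewrite hadjEr // vintE //; apply: eq_rI => r _; by rewrite -hadjEr.
Qed.

(** * Square integrable functions with values in a Hilbert space *)

Section SquareIntegrable.
Variable H : hilbert R.
Implicit Types f g h : R -> H.

Lemma simple_hfun_lin (al : R) f g : simple_hfun f -> simple_hfun g ->
  simple_hfun (fun r => f r + rscale al (g r)).
Proof.
move=> [N [E [u [mE fE]]]] [N' [E' [u' [mE' gE]]]].
exists (N + N')%N, (fun k => if (k < N)%N then E k else E' (k - N)%N),
  (fun k => if (k < N)%N then u k else rscale al (u' (k - N)%N)); split.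
  by move=> k; case: ifP.
move=> r; rewrite fE gE big_split_ord /=; congr (_ + _).
  by apply: eq_bigr => k _; rewrite ltn_ord.
rewrite /rscale scaler_sumr; apply: eq_bigr => k _.
by rewrite ltnNge leq_addr /= addKn !scalerA mulrC.
Qed.

Lemma simple_hfun_ind (D : set R) f : measurable D -> simple_hfun f ->
  simple_hfun (fun r => (\1_D r : R)%:C *: f r).
Proof.
move=> mD [N [E [u [mE fE]]]]; exists N, (fun k => E k `&` D), u; split.
  by move=> k; exact: measurableI.
move=> r; rewrite fE scaler_sumr; apply: eq_bigr => k _.
by rewrite scalerA indicI -rmorphM mulrC.
Qed.

Lemma smeas_lin D (al : R) f g : strongly_measurable D f -> strongly_measurable D g ->
  strongly_measurable D (fun r => f r + rscale al (g r)).
Proof.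
move=> [s ss sf] [s' ss' sg].
exists (fun n r => s n r + rscale al (s' n r)) => [n|r Dr].
  exact: simple_hfun_lin.
apply/hcvgP => e e0.
have /hcvgP h1 := sf r Dr; have /hcvgP h2 := sg r Dr.
have a1 : 0 < `|al| + 1 by rewrite ltr_wpDl.
have [N HN] := h1 _ (divr_gt0 e0 (ltr0n R 2)).
have [N' HN'] := h2 _ (divr_gt0 e0 (mulr_gt0 (ltr0n R 2) a1)).
exists (maxn N N') => n; rewrite geq_max => /andP[n1 n2].
have b1 := HN n n1; have := HN' n n2; rewrite ltr_pdivlMr ?mulr_gt0 // => b2.
rewrite (_ : _ - _ = (s n r - f r) + rscale al (s' n r - g r)); last first.
  by apply: rip_inj => w; rewrite !ripE; ring.
apply: le_lt_trans (hnorm_add _ _) _; rewrite hnorm_scale.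
have := hnorm_ge0 (s' n r - g r); nra.
Qed.

Lemma smeasW D D' f : D' `<=` D -> strongly_measurable D f -> strongly_measurable D' f.
Proof. by move=> DD [s ss sf]; exists s => // r /DD; exact: sf. Qed.

Lemma smeas_ind D E f : measurable E -> strongly_measurable (D `&` E) f ->
  strongly_measurable D (fun r => (\1_E r : R)%:C *: f r).
Proof.
move=> mE [s ss sf]; exists (fun n r => (\1_E r : R)%:C *: s n r) => [n|r Dr].
  exact: simple_hfun_ind.
apply/hcvgP => e e0; rewrite indicE; case: (boolP (r \in E)) => rE.
  have /hcvgP/(_ e e0)[N HN] := sf r (conj Dr (set_mem rE)).
  by exists N => n Nn; rewrite !scale1r; exact: HN.
by exists 0%N => n _; rewrite !scale0r subrr hnorm0.
Qed.

Lemma measurable_simple_rip D f g : measurable D -> simple_hfun f -> simple_hfun g ->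
  measurable_fun D (fun r => rip (f r) (g r)).
Proof.
move=> mD [N [E [u [mE fE]]]] [N' [E' [u' [mE' gE]]]].
apply: (eq_measurable_fun (fun r => \sum_(k < N) \sum_(j < N')
   (\1_(E k) r : R) * (\1_(E' j) r : R) * rip (u k) (u' j))).
  move=> r _; rewrite fE gE.
  have sl I (l : seq I) (F : I -> H) w : rip (\sum_(i <- l) F i) w = \sum_(i <- l) rip (F i) w.
    by apply: (big_morph (fun x => rip x w)) => [x y|]; rewrite ?ripDl ?rip0l.
  have sr I (l : seq I) (F : I -> H) w : rip w (\sum_(i <- l) F i) = \sum_(i <- l) rip w (F i).
    by apply: (big_morph (rip w)) => [x y|]; rewrite ?ripDr ?rip0r.
  rewrite sl; apply: eq_bigr => k _; rewrite sr; apply: eq_bigr => j _.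
  by rewrite -!/(rscale _ _) ripZl ripZr; ring.
apply: measurable_sum => k; apply: measurable_sum => j.
apply: measurable_funM => //; apply: measurable_funM; exact: measurable_indic.
Qed.

Lemma rip_cvg (u v : nat -> H) x y : hlim u x -> hlim v y ->
  (fun n => rip (u n) (v n)) @ \oo --> rip x y.
Proof.
move=> ux vy; apply/cvgrPdist_lt => e e0.
have Z0 : 0 < hnorm x + hnorm y + 2 by rewrite ltr_wpDl // addr_ge0.
have d0 : 0 < Num.min 1 (e / (hnorm x + hnorm y + 2)) by rewrite lt_min ltr01 divr_gt0.
have [N HN] := ux _ d0; have [N' HN'] := vy _ d0.
exists (maxn N N') => // n /=; rewrite geq_max => /andP[n1 n2].
have := HN n n1; have := HN' n n2; rewrite !lt_min !ltr_pdivlMr // => /andP[a1 a2] /andP[b1 b2].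
rewrite distrC (_ : _ - _ = rip (u n - x) (v n - y) + (rip (u n - x) y + rip x (v n - y))); last first.
  by rewrite !ripE; ring.
have c1 := rip_le (u n - x) (v n - y); have c2 := rip_le (u n - x) y; have c3 := rip_le x (v n - y).
have c4 := hnorm_ge0 (u n - x); have c5 := hnorm_ge0 (v n - y); have c6 := hnorm_ge0 x; have c7 := hnorm_ge0 y.
apply: le_lt_trans (ler_normD _ _) _.
have := ler_normD (rip (u n - x) y) (rip x (v n - y)).
have c8 : hnorm (u n - x) * hnorm (v n - y) <= hnorm (u n - x) by rewrite ler_piMr // ltW.
have [AB|BA] := leP (hnorm (u n - x)) (hnorm (v n - y)).
  have : hnorm (u n - x) * hnorm y <= hnorm (v n - y) * hnorm y by rewrite ler_wpM2r.
  lra.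
have : hnorm x * hnorm (v n - y) <= hnorm x * hnorm (u n - x) by rewrite ler_wpM2l // ltW.
lra.
Qed.

Lemma measurable_rip D f g : measurable D -> strongly_measurable D f ->
  strongly_measurable D g -> measurable_fun D (fun r => rip (f r) (g r)).
Proof.
move=> mD [s ss sf] [s' ss' sg].
apply: (@measurable_fun_cvg _ _ R D (fun n r => rip (s n r) (s' n r))) => //.
  by move=> n; exact: measurable_simple_rip.
by move=> r Dr; apply: rip_cvg; apply/hcvgP; [exact: sf|exact: sg].
Qed.

Definition nsq a b g : R := rI a b (fun r => rip (g r) (g r)).
Definition nL2 a b g : R := Num.sqrt (nsq a b g).

Lemma L2sqE a b g : L2sq a b g = (\int[leb]_(r in `[a, b]) (rip (g r) (g r))%:E)%E.
Proof. by apply: eq_integral => r _; rewrite hnorm_sqr. Qed.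

Lemma is_L2P a b g : is_L2 a b g <->
  strongly_measurable `[a, b] g /\ intg a b (fun r => rip (g r) (g r)).
Proof.
split=> -[mg hg]; split => //.
  apply/integrableP; split.
    by apply/measurable_EFinP; exact: measurable_rip.
  apply: le_lt_trans hg; rewrite L2sqE le_eqVlt; apply/orP; left; apply/eqP.
  by apply: eq_integral => r _ /=; rewrite ger0_norm.
case/integrableP: hg => _; apply: le_lt_trans; rewrite L2sqE.
rewrite le_eqVlt; apply/orP; left; apply/eqP.
by apply: eq_integral => r _ /=; rewrite ger0_norm.
Qed.

Lemma L2sq_nsq a b g : is_L2 a b g -> L2sq a b g = (nsq a b g)%:E.
Proof.
by move=> /is_L2P[_ ig]; rewrite L2sqE rI_EFin.
Qed.

Lemma L2_intg a b f g : is_L2 a b f -> is_L2 a b g -> intg a b (fun r => rip (f r) (g r)).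
Proof.
move=> /is_L2P[mf hf] /is_L2P[mg hg].
have hh := intgD hf hg; apply: le_integrable hh => //.
  by apply/measurable_EFinP; exact: measurable_rip.
move=> r _ /=; rewrite lee_fin [leRHS]ger0_norm ?addr_ge0 //.
apply: le_trans (rip_le _ _) _; rewrite -!hnorm_sqr.
have := sqr_ge0 (hnorm (f r) - hnorm (g r)); have := hnorm_ge0 (f r); have := hnorm_ge0 (g r); nra.
Qed.

Lemma L2_lin a b (al : R) f g : is_L2 a b f -> is_L2 a b g ->
  is_L2 a b (fun r => f r + rscale al (g r)).
Proof.
move=> hf hg; have [mf _] := hf; have [mg _] := hg.
apply/is_L2P; split; first exact: smeas_lin.
apply: (@eq_intg _ _ _ (fun r => rip (f r) (f r) + ((2 * al) * rip (f r) (g r) + (al ^+ 2) * rip (g r) (g r)))).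
  by move=> r _; rewrite !ripE (ripC (g r)); ring.
by apply: intgD; [exact: L2_intg|apply: intgD; apply: intgZ; exact: L2_intg].
Qed.

Lemma L2W a b c d f : c <= a -> b <= d -> is_L2 c d f -> is_L2 a b f.
Proof.
move=> ca bd /is_L2P[mf hf]; apply/is_L2P; split.
  by apply: smeasW mf; exact: sub_itv.
exact: intgW hf.
Qed.

Lemma eq_L2 a b f g : (forall r, a <= r <= b -> f r = g r) -> is_L2 a b f -> is_L2 a b g.
Proof.
move=> h /is_L2P[[s ss sf] hf]; apply/is_L2P; split.
  exists s => // r rab; rewrite -h; first exact: sf.
  by move: rab; rewrite /= in_itv.
by apply: eq_intg hf => r rab; rewrite h.
Qed.

Lemma L2N a b f : is_L2 a b f -> is_L2 a b (fun r => - f r).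
Proof.
(* Here [- f] is written as [f + (-2) f], so that [L2_lin] covers it. *)
move=> hf; apply: eq_L2 (L2_lin (-2) hf hf) => r _.
by apply: rip_inj => w; rewrite !ripE; ring.
Qed.

Lemma L2D a b f g : is_L2 a b f -> is_L2 a b g -> is_L2 a b (fun r => f r + g r).
Proof.
move=> hf hg; apply: eq_L2 (L2_lin 1 hf hg) => r _.
by apply: rip_inj => w; rewrite !ripE; ring.
Qed.

Lemma L2B a b f g : is_L2 a b f -> is_L2 a b g -> is_L2 a b (fun r => f r - g r).
Proof. by move=> hf /L2N; exact: L2D. Qed.

Definition tcut s t g := fun r => (\1_(`[s, t]%classic) r : R)%:C *: g r.

Lemma tcut_in s t g r : s <= r <= t -> tcut s t g r = g r.
Proof. by move=> h; rewrite /tcut indicE mem_set ?scale1r //= in_itv. Qed.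

Lemma tcut_out s t g r : ~~ (s <= r <= t) -> tcut s t g r = 0.
Proof. by move=> h; rewrite /tcut indicE memNset ?scale0r //= in_itv /=; apply/negP. Qed.

Lemma rI_cut a b s t f g : a <= s -> t <= b ->
  rI a b (fun r => rip (tcut s t f r) (g r)) = rI s t (fun r => rip (f r) (g r)).
Proof.
move=> h1 h2; rewrite /rI -[in RHS](setIidr (sub_itv h1 h2)) Rintegral_mkcondr.
apply: eq_Rintegral => r _; rewrite patchE /tcut indicE.
by case: (r \in _); rewrite ?scale1r // scale0r rip0l.
Qed.

Lemma L2_cut a b s t f : a <= s -> t <= b -> is_L2 s t f -> is_L2 a b (tcut s t f).
Proof.
move=> h1 h2 /is_L2P[mf hf].
have mc : strongly_measurable `[a, b] (tcut s t f).
  by apply: smeas_ind => //; rewrite setIidr //; exact: sub_itv.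
split => //; apply: le_lt_trans (_ : L2sq s t f < +oo)%E; last first.
  by have [] : is_L2 s t f by apply/is_L2P.
rewrite !L2sqE le_eqVlt; apply/orP; left; apply/eqP.
rewrite -[in RHS](setIidr (sub_itv h1 h2)) integral_mkcondr.
apply: eq_integral => r _; rewrite patchE /tcut indicE.
by case: (r \in _); rewrite ?scale1r // scale0r rip0l.
Qed.

Lemma nsq_ge0 a b g : 0 <= nsq a b g.
Proof. by apply: rI_ge0. Qed.

Lemma nL2_ge0 a b g : 0 <= nL2 a b g.
Proof. exact: sqrtr_ge0. Qed.

Lemma nL2_sqr a b g : nL2 a b g ^+ 2 = nsq a b g.
Proof. by rewrite sqr_sqrtr // nsq_ge0. Qed.

Lemma L2_CS a b f g : is_L2 a b f -> is_L2 a b g ->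
  `|rI a b (fun r => rip (f r) (g r))| <= nL2 a b f * nL2 a b g.
Proof.
move=> hf hg; rewrite -(@ler_pXn2r _ 2) ?nnegrE ?mulr_ge0 ?nL2_ge0 //.
rewrite real_normK ?num_real // exprMn !nL2_sqr.
apply: discriminant_le => l.
suff -> : nsq a b f + 2 * l * rI a b (fun r => rip (f r) (g r)) + l ^+ 2 * nsq a b g =
    nsq a b (fun r => f r + rscale l (g r)) by exact: nsq_ge0.
rewrite /nsq -!rIZ -?rID; try by repeat (apply: intgD || apply: intgZ || apply: L2_intg).
by apply: eq_rI => r _; rewrite !ripE (ripC (g r)); ring.
Qed.

Lemma nsqW a b c d f : c <= a -> a <= b -> b <= d -> is_L2 c d f -> nsq a b f <= nsq c d f.
Proof.
move=> ca ab bd hf; have /is_L2P[_ i1] := hf.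
have i2 := intgW (lexx c) bd i1.
rewrite /nsq (@rI_split _ b c d) // ?(le_trans ca ab) //.
rewrite (@rI_split _ a c b) ?ca ?ab //.
have := @rI_ge0 _ c a _ (fun r _ => rip_ge0 (f r)).
have := @rI_ge0 _ b d _ (fun r _ => rip_ge0 (f r)).
rewrite /=; lra.
Qed.

Lemma nL2W a b c d f : c <= a -> a <= b -> b <= d -> is_L2 c d f -> nL2 a b f <= nL2 c d f.
Proof. by move=> *; rewrite ler_wsqrtr // nsqW. Qed.

Lemma nL2_cut a b s t f : a <= s -> t <= b -> nL2 a b (tcut s t f) = nL2 s t f.
Proof.
move=> h1 h2; rewrite /nL2 /nsq rI_cut //; congr Num.sqrt; apply: eq_rI => r rst.
by rewrite tcut_in.
Qed.

Lemma eq_nL2 a b f g : (forall r, a <= r <= b -> f r = g r) -> nL2 a b f = nL2 a b g.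
Proof. by move=> h; congr Num.sqrt; apply: eq_rI => r rab; rewrite h. Qed.

Lemma nsq_ub a b f M : a <= b -> is_L2 a b f -> 0 <= M ->
  (forall r, a <= r <= b -> hnorm (f r) <= M) -> nsq a b f <= M ^+ 2 * (b - a).
Proof.
move=> ab /is_L2P[_ hf] M0 hM; apply: rI_ub => // r /hM h.
by rewrite -hnorm_sqr ler_pXn2r // nnegrE.
Qed.

Lemma hcont_smeas a b f : hcont a b f -> strongly_measurable `[a, b] f.
Proof.
move=> fc; have [ab|ba] := ltP a b; last first.
  exists (fun _ => cst (f a)) => [n|r].
    exists 1%N, (fun=> setT), (fun=> f a); split => // r.
    by rewrite big_ord_recl big_ord0 addr0 indicT scale1r.
  rewrite /= in_itv /= => /andP[r1 r2]; have -> : r = a.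
    by apply/le_anti; rewrite r1 (le_trans r2 ba).
  by apply/hcvgP => e e0; exists 0%N => n _; rewrite subrr hnorm0.
pose dl n : R := (b - a) / n.+1%:R.
have dl0 n : 0 < dl n by rewrite divr_gt0 ?subr_gt0 ?ltr0n.
pose E n k := `[a + k%:R * dl n, a + k.+1%:R * dl n[%classic.
pose u n k := f (Num.min b (a + k%:R * dl n)).
(* The cells are half open and of length [(b - a) / n.+1%:R]; the point [b] itself falls into cell
   number [n.+1], hence [n.+2] cells. *)
exists (fun n r => \sum_(k < n.+2) (\1_(E n k) r : R)%:C *: u n k) => [n|r].
  by exists n.+2, (E n), (u n); split => // k; exact: measurable_itv.
rewrite /= in_itv /= => rab; apply/hcvgP => e e0.
have [d d0 hd] := fc r rab e e0.
exists (Num.truncn ((b - a) / d)) => n Nn.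
have dld : dl n < d.
  rewrite /dl ltr_pdivrMr ?ltr0n // mulrC -ltr_pdivrMr //.
  by apply: lt_le_trans (truncnS_gt _) _; rewrite ler_nat ltnS.
pose k0 := Num.truncn ((r - a) / dl n).
have q0 : 0 <= (r - a) / dl n by rewrite divr_ge0 ?(ltW (dl0 n)) // subr_ge0; case/andP: rab.
have /andP[k1 k2] := truncn_itv q0.
rewrite ler_pdivlMr // in k1; rewrite ltr_pdivrMr // in k2.
have k0n : (k0 < n.+2)%N.
  have : (r - a) / dl n <= n.+1%:R.
    rewrite ler_pdivrMr // /dl mulrCA divff ?mulr1 ?pnatr_eq0 //.
    by case/andP: rab => _; rewrite lerD2r.
  move=> h; rewrite ltnS -(ler_nat R); apply: le_trans h.
  by rewrite ler_pdivlMr.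
have -> : \sum_(k < n.+2) (\1_(E n k) r : R)%:C *: u n k = u n k0.
  rewrite (bigD1 (Ordinal k0n)) //= big1 ?addr0.
    rewrite indicE mem_set ?scale1r //= /E /= in_itv /=; lra.
  move=> j jk; rewrite indicE memNset ?scale0r // /E /= in_itv /= => /andP[j1 j2].
  move/eqP: jk; apply; apply/val_inj => /=.
  have l1 : ((j : nat)%:R : R) * dl n < k0.+1%:R * dl n by lra.
  have l2 : (k0%:R : R) * dl n < (j : nat).+1%:R * dl n by lra.
  rewrite !ltr_pM2r // !ltr_nat !ltnS in l1 l2.
  by apply/eqP; rewrite eqn_leq l1 l2.
have k3 : (k0.+1%:R : R) = k0%:R + 1 by rewrite -addn1 natrD.
rewrite k3 in k2; case/andP: rab => ra rb.
have m1 : Num.min b (a + k0%:R * dl n) = a + k0%:R * dl n.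
  by apply/min_idPr; rewrite /k0; lra.
rewrite /u m1; apply: hd.
  have : 0 <= (k0%:R : R) * dl n by rewrite mulr_ge0 // ltW.
  rewrite /k0; lra.
rewrite ltr_norml /k0; lra.
Qed.

Lemma hcont_L2 a b f : hcont a b f -> is_L2 a b f.
Proof.
move=> fc; apply/is_L2P; split; first exact: hcont_smeas.
by apply: rcont_intg; exact: hcont_rip.
Qed.

(** This takes the place of a pointwise bound: a control in L^2 has a small norm over every short
    interval near [r], with no rate. *)
Lemma nL2_small a b g : is_L2 a b g -> forall r, a <= r <= b -> forall e : R, 0 < e ->
  exists2 d : R, 0 < d & forall s t, a <= s <= b -> a <= t <= b ->
    s <= t -> `|s - r| < d -> `|t - r| < d -> nL2 s t g < e.
Proof.
move=> /is_L2P[_ ig] r rab e e0.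
have [d d0 hd] := rI_abscont ig rab (exprn_gt0 2 e0).
exists d => // s t sab tab st sr tr.
rewrite -(@ltr_pXn2r _ 2) ?nnegrE ?nL2_ge0 ?ltW // nL2_sqr.
exact: le_lt_trans (ler_norm _) (hd s t sab tab st sr tr).
Qed.

End SquareIntegrable.
End VectorFunctions.

#[local] Opaque rI.

Lemma rI_reflect (R : realType) (T : R) (f : R -> R) : 0 <= T -> rcont 0 T f ->
  rI 0 T (fun t => f (T - t)) = rI 0 T f.
Proof.
move=> T0 fc; pose F r := rI 0 r f.
have Fd t : 0 <= t <= T -> rder 0 T F t (f t) by exact: rI_rder.
have inv (h : R -> R) : rcont 0 T h -> rcont 0 T (fun t => h (T - t)).
  move=> hc s sab e e0; have [|d d0 hd] := hc (T - s) _ e e0; first by lra.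
  exists d => // t tab ts; apply: hd; first by lra.
  by rewrite (_ : _ - _ = - (t - s)) ?normrN //; ring.
rewrite (@FTC_rder R 0 T (fun t => f (T - t)) (fun t => - F (T - t))) //.
- by rewrite subrr subr0 /F rI_aa; ring.
- exact: inv.
- by apply/rcontN/inv; exact: rder_rcont Fd.
move=> t tab e e0; have [|d d0 hd] := Fd (T - t) _ e e0; first by lra.
exists d => // s sab st; have E : T - s - (T - t) = - (s - t) by ring.
have := hd (T - s); rewrite E normrN => /(_ _ st) h.
apply: le_trans (h _); last by lra.
rewrite -normrN le_eqVlt; apply/orP; left; apply/eqP; congr `|_|; ring.
Qed.

(** * Elementary inequalities and a product rule *)

Lemma small_sum_aux (R : realType) (a k e c n x : R) : a * (4 * (k + 1)) < e ->
  0 <= a -> 0 <= k -> 0 <= c -> 0 <= n -> x <= k * a -> n * (2 * (c + 1)) < e ->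
  x + c * n < e.
Proof. by move=> *; nra. Qed.

Lemma sq_sum_aux (R : realType) (x N c k n h : R) : 0 <= x -> 0 <= N -> 0 <= c -> 0 <= n ->
  0 <= h -> x <= N * c + k * n -> x ^+ 2 <= 2 * (N ^+ 2 + k ^+ 2 + 1) * (h + n ^+ 2 + c ^+ 2).
Proof.
move=> x0 N0 c0 n0 h0 le.
have k1 : x ^+ 2 <= (N * c + k * n) ^+ 2 by rewrite ler_pXn2r ?nnegrE // (le_trans x0).
have k2 : 0 <= (N * c - k * n) ^+ 2 by exact: sqr_ge0.
have k3 : 0 <= N ^+ 2 * n ^+ 2 by rewrite mulr_ge0 ?sqr_ge0.
have k4 : 0 <= k ^+ 2 * c ^+ 2 by rewrite mulr_ge0 ?sqr_ge0.
have k5 := sqr_ge0 c; have k6 := sqr_ge0 n.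
have k7 : 0 <= (N ^+ 2 + k ^+ 2 + 1) * h by rewrite mulr_ge0 // !addr_ge0 ?sqr_ge0.
lra.
Qed.

Lemma pow2_le0 (R : realType) (c x : R) : (forall n, x <= c / 2 ^+ n) -> x <= 0.
Proof.
move=> h; apply/ler_addgt0Pr => e e0; rewrite add0r.
pose n := Num.truncn (c / e).
have hn : c / e < n.+1%:R by exact: truncnS_gt.
have h2n : (n.+1%:R : R) <= 2 ^+ n by rewrite -natrX ler_nat ltn_expl.
apply: le_trans (h n) _.
rewrite ler_pdivrMr ?exprn_gt0 // mulrC -ler_pdivrMr //.
by apply: le_trans (ltW hn) h2n.
Qed.

Lemma third_le (R : realType) (k e a b x : R) : 0 <= k -> x <= a + b ->
  a * (6 * (k + 1)) < e -> b * (6 * (k + 1)) < e -> 0 <= x -> k * x <= e / 3.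
Proof.
move=> k0 xab ha hb x0; have k1 : 0 <= 6 * (k + 1) by rewrite mulr_ge0 // addr_ge0.
by have := ler_wpM2r k1 xab; rewrite mulrDl; lra.
Qed.

Lemma between_dist (R : realType) (p q r t d : R) : p <= r -> r <= q ->
  `|p - t| < d -> `|q - t| < d -> `|r - t| < d.
Proof. by move=> pr rq; rewrite !ltr_norml; lra. Qed.

Ltac atomize :=
  repeat match goal with |- context [rI ?a ?b ?f] =>
    let X := fresh in generalize (rI a b f); intro X end;
  repeat match goal with |- context [rip ?a ?b] =>
    let X := fresh in generalize (rip a b); intro X end;
  repeat match goal with |- context [hnorm ?a] =>
    let X := fresh in generalize (hnorm a); intro X end.

Definition hder (R : realType) (Y : hilbert R) (u : R -> Y) (t : R) (u1 : Y) :=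
  forall e : R, 0 < e -> exists2 d : R, 0 < d &
    forall s, `|s - t| < d -> hnorm (u s - u t - rscale (s - t) u1) <= e * `|s - t|.

(** [F] is only strongly continuous and is differentiated only between the fixed vectors [u t] and
    [v t]. Its strong continuity at [u1] and [u t] and the uniform bound [M] handle the terms in
    which [u] or [v] moves. The rule serves to pass between a Riccati operator and its pull-back by
    the group. *)
Lemma prod_rder (R : realType) (Y : hilbert R) (a b t : R) (F : R -> Y -> Y)
    (u v : R -> Y) (u1 v1 : Y) (L M : R) :
  (forall s, a <= s <= b -> bounded_op (F s)) -> 0 <= M ->
  (forall s x, a <= s <= b -> hnorm (F s x) <= M * hnorm x) ->
  (forall x e, 0 < e -> exists2 d : R, 0 < d & forall s, a <= s <= b ->
     `|s - t| < d -> hnorm (F s x - F t x) < e) ->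
  a <= t <= b -> hder u t u1 -> hder v t v1 ->
  rder a b (fun s => rip (F s (u t)) (v t)) t L ->
  rder a b (fun s => rip (F s (u s)) (v s)) t
    (L + rip (F t u1) (v t) + rip (F t (u t)) v1).
Proof.
move=> Fb M0 FM Fc tab ud vd Ld e e0.
pose nv := hnorm (v t); pose nu := hnorm (u t); pose nu1 := hnorm u1; pose nv1 := hnorm v1.
have nv10 : 0 <= nv1 by exact: hnorm_ge0.
(* [Z] adds up the coefficients of [h * |D|] in the bounds of the five terms into which the
   remainder is split below. *)
pose Z := 1 + M * (nv + 1) + (nv + 1) + M * nu1 + M * nu + nv1.
have Z0 : 0 < Z.
  by rewrite /Z -!addrA ltr_wpDr // !addr_ge0 ?mulr_ge0 ?addr_ge0 // hnorm_ge0.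
pose h := Num.min 1 (e / Z).
have h0 : 0 < h by rewrite lt_min ltr01 divr_gt0.
have hZ : h * Z <= e by rewrite -ler_pdivlMr // ge_min lexx orbT.
have h1 : h <= 1 by rewrite ge_min lexx.
have [d1 d10 hd1] := ud h h0; have [d2 d20 hd2] := vd h h0.
have [d3 d30 hd3] := Fc u1 h h0; have [d4 d40 hd4] := Fc (u t) h h0.
have [d5 d50 hd5] := Ld h h0.
pose d6 := h / (h + nv1).
have d60 : 0 < d6 by rewrite divr_gt0 // ltr_wpDr.
exists (Num.min d1 (Num.min d2 (Num.min d3 (Num.min d4 (Num.min d5 d6))))).
  by rewrite !lt_min d10 d20 d30 d40 d50.
move=> s sab; rewrite !lt_min => /andP[s1 /andP[s2 /andP[s3 /andP[s4 /andP[s5 s6]]]]].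
have {hd1} b1 := hd1 s s1; have {hd2} b2 := hd2 s s2; have {hd3} b3 := hd3 s sab s3.
have {hd4} b4 := hd4 s sab s4; have {hd5} b5 := hd5 s sab s5.
have vv : hnorm (v s - v t) <= h.
  rewrite (_ : v s - v t = (v s - v t - rscale (s - t) v1) + rscale (s - t) v1); last by rewrite subrK.
  apply: le_trans (hnorm_add _ _) _; rewrite hnorm_scale.
  move: s6; rewrite /d6 ltr_pdivlMr ?ltr_wpDr // -/nv1; lra.
pose D := s - t.
have E : rip (F s (u s)) (v s) - rip (F t (u t)) (v t) - (L + rip (F t u1) (v t) + rip (F t (u t)) v1) * D
  = (rip (F s (u t)) (v t) - rip (F t (u t)) (v t) - L * D)
  + rip (F s (u s - u t - rscale D u1)) (v s)
  + D * (rip (F s u1 - F t u1) (v s) + rip (F t u1) (v s - v t))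
  + rip (F s (u t)) (v s - v t - rscale D v1) + D * rip (F s (u t) - F t (u t)) v1.
  rewrite !(bopB (Fb s sab)) (bopZr (Fb s sab)) !ripE; by clear; atomize; ring.
rewrite E.
have nvs : hnorm (v s) <= nv + 1.
  have := hnorm_dist (v s) (v t); rewrite ler_norml -/nv; lra.
have c2 : `|rip (F s (u s - u t - rscale D u1)) (v s)| <= h * (M * (nv + 1)) * `|D|.
  apply: le_trans (rip_le _ _) _.
  rewrite (_ : h * (M * (nv + 1)) * `|D| = (M * (h * `|D|)) * (nv + 1)); last by ring.
  apply: ler_pM => //; apply: le_trans (FM _ _ sab) _; exact: ler_wpM2l.
have c3 : `|D * (rip (F s u1 - F t u1) (v s) + rip (F t u1) (v s - v t))| <= h * ((nv + 1) + M * nu1) * `|D|.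
  rewrite normrM mulrC ler_wpM2r // mulrDr; apply: le_trans (ler_normD _ _) _; apply: lerD.
    by apply: le_trans (rip_le _ _) _; apply: ler_pM => //; exact: ltW.
  apply: le_trans (rip_le _ _) _; rewrite [leRHS]mulrC; apply: ler_pM => //; exact: FM.
have c4 : `|rip (F s (u t)) (v s - v t - rscale D v1)| <= h * (M * nu) * `|D|.
  apply: le_trans (rip_le _ _) _.
  rewrite (_ : h * (M * nu) * `|D| = (M * nu) * (h * `|D|)); last by ring.
  by apply: ler_pM => //; exact: FM.
have c5 : `|D * rip (F s (u t) - F t (u t)) v1| <= h * nv1 * `|D|.
  rewrite normrM mulrC ler_wpM2r //; apply: le_trans (rip_le _ _) _.
  by apply: ler_pM => //; exact: ltW.
apply: (@le_trans _ _ (h * Z * `|D|)); last by rewrite ler_wpM2r.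
rewrite /Z; move: b5 c2 c3 c4 c5; rewrite -/D.
move: (rip _ _ - _ - _) (rip (F s (u s - _ - _)) _) (D * (_ + _)) (rip (F s (u t)) (v s - _ - _)) (D * rip _ _) => x1 x2 x3 x4 x5.
move: `|D| => q k1 k2 k3 k4 k5.
have := ler_normD (x1 + x2 + x3 + x4) x5; have := ler_normD (x1 + x2 + x3) x4.
have := ler_normD (x1 + x2) x3; have := ler_normD x1 x2.
lra.
Qed.

(** * The group and the control operator *)

Section Group.
Variables (R : realType) (Y : hilbert R) (A : Y -> Y -> Prop) (S : R -> Y -> Y).
Hypotheses (A_skew : skew_adjoint A) (Sg : unitary_C0_group S) (S_gen : is_generator S A).
Implicit Types (a b r s t e : R) (x y z w : Y).

Lemma S_ip t x y : ip (S t x) (S t y) = ip x y. Proof. by case: Sg. Qed.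

Lemma S_rip t x y : rip (S t x) (S t y) = rip x y. Proof. by rewrite /rip S_ip. Qed.

Lemma S0 x : S 0 x = x. Proof. by case: Sg. Qed.

Lemma S_add s t x : S (s + t) x = S s (S t x). Proof. by case: Sg. Qed.

Lemma S_norm t x : hnorm (S t x) = hnorm x.
Proof. by rewrite /hnorm /dot_norm -!/(ip _ _) S_ip. Qed.

Lemma S_bop t : bounded_op (S t).
Proof. by split; [case: Sg|exists 1 => x; rewrite mul1r S_norm]. Qed.

Lemma SNK t x : S (- t) (S t x) = x.
Proof. by rewrite -S_add addNr S0. Qed.

Lemma SKN t x : S t (S (- t) x) = x.
Proof. by rewrite -S_add subrr S0. Qed.

Lemma S_radj t x y : rip (S t x) y = rip x (S (- t) y).
Proof. by rewrite -{1}(SKN t y) S_rip. Qed.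

Lemma SN_radj t x y : rip (S (- t) x) y = rip x (S t y).
Proof. by rewrite S_radj opprK. Qed.

Lemma hadj_S t y : hadj (S t) y = S (- t) y.
Proof. by apply: hadj_eq; [exact: S_bop|move=> x; exact: S_radj]. Qed.

Lemma S_cont x s e : 0 < e -> exists2 d : R, 0 < d &
  forall t, `|t - s| < d -> hnorm (S t x - S s x) < e.
Proof.
move=> e0; have [_ _ _ _ Sc] := Sg.
have := Sc x s I => /cvgrPdist_lt/(_ e e0); rewrite near_withinE => /nbhs_ballP [d /= d0 hd].
exists d => // t ts; have := hd t; rewrite /ball /= distrC => /(_ ts I).
by rewrite sub0r normrN ger0_norm.
Qed.

Lemma hcont_S a b (f : R -> Y) : hcont a b f -> hcont a b (fun t => S t (f t)).
Proof.
apply: (@hcont_family _ _ _ _ _ S f 1) => [s _|s x _|x s _ e e0].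
- exact: S_bop.
- by rewrite mul1r S_norm.
by have [d d0 hd] := S_cont x s e0; exists d => // t _; exact: hd.
Qed.

Lemma hcont_SN a b (f : R -> Y) : hcont a b f -> hcont a b (fun t => S (- t) (f t)).
Proof.
apply: (@hcont_family _ _ _ _ _ (fun t => S (- t)) f 1) => [s _|s x _|x s _ e e0].
- exact: S_bop.
- by rewrite mul1r S_norm.
have [d d0 hd] := S_cont x (- s) e0; exists d => // t _ ts; apply: hd.
by rewrite -opprD normrN.
Qed.

Lemma hcont_Sx a b x : hcont a b (fun t => S t x).
Proof. exact/hcont_S/hcont_cst. Qed.

Lemma hcont_SNx a b x : hcont a b (fun t => S (- t) x).
Proof. exact/hcont_SN/hcont_cst. Qed.

Lemma domA_dense : hdense (dom A). Proof. by case: A_skew. Qed.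

Lemma gadjA z w : gadj A z w <-> A z (- w). Proof. by case: A_skew. Qed.

Lemma A_sym x x' y y' : A x x' -> A y y' -> ip x' y = - ip x y'.
Proof. move=> xx yy; rewrite -ipNr.
have h : gadj A y (- y') by apply/gadjA; rewrite opprK.
exact: h.
Qed.

Lemma A_rsym x x' y y' : A x x' -> A y y' -> rip x' y = - rip x y'.
Proof. by move=> xx yy; rewrite /rip (A_sym xx yy) raddfN. Qed.

Lemma A_char z w : (forall x y, A x y -> ip y z = - ip x w) -> A z w.
Proof. by move=> h; rewrite -[w]opprK; apply/gadjA => x y /h ->; rewrite ipNr. Qed.

(** The imaginary part of the condition is the real part at ['i%C *: x], because the domain is a
    complex subspace. *)
Lemma A_rchar z w : (forall x y, A x y -> rip y z = - rip x w) -> A z w.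
Proof.
move=> h; apply: A_char => x y xy; rewrite !ipE (h _ _ xy).
have Ai : A ('i%C *: x) ('i%C *: y).
  by apply: A_char => u v uv; rewrite !ipZr (A_sym uv xy) mulrN.
have := h _ _ Ai; rewrite !rip_il => E.
by apply/eqP; rewrite eq_complex /= eqxx /=; apply/eqP; lra.
Qed.

Lemma A_fun x y y' : A x y -> A x y' -> y = y'.
Proof.
move=> h h'; apply: (dense_rip_inj domA_dense) => v [w vw].
have := A_rsym vw h; have := A_rsym vw h'; rewrite !(ripC v); lra.
Qed.

Lemma A_lin (al : R[i]) x x' y y' : A x x' -> A y y' -> A (al *: x + y) (al *: x' + y').
Proof.
move=> xx yy; apply: A_char => u v uv.
by rewrite !ipDr !ipZr (A_sym uv xx) (A_sym uv yy) mulrN opprD.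
Qed.

Lemma A0 : A 0 0. Proof. by apply: A_char => u v uv; rewrite !ip0r oppr0. Qed.

Lemma A_D x x' y y' : A x x' -> A y y' -> A (x + y) (x' + y').
Proof. by move=> xx yy; have := A_lin 1 xx yy; rewrite !scale1r. Qed.

Lemma A_Z (al : R[i]) x x' : A x x' -> A (al *: x) (al *: x').
Proof. by move=> xx; have := A_lin al xx A0; rewrite !addr0. Qed.

Lemma domA_sub : rsubspace (dom A).
Proof.
split; first by exists 0; exact: A0.
  by move=> x y [x' xx] [y' yy]; exists (x' + y'); exact: A_D.
by move=> al x [x' xx]; exists (rscale al x'); exact: A_Z.
Qed.

Lemma dom_gadj z : dom (gadj A) z <-> dom A z.
Proof.
split; first by case=> w /gadjA h; exists (- w).
by case=> w h; exists (- w); apply/gadjA; rewrite opprK.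
Qed.

Lemma opstarE z z' : A z z' -> opstar A z = - z'.
Proof.
move=> h; have /gadjA h2 : gadj A z (opstar A z).
  by apply: (@xgetPex _ 0 [set w | gadj A z w]); exists (- z'); apply/gadjA; rewrite opprK.
by rewrite (A_fun h h2) opprK.
Qed.

Lemma A_diffquot x y : A x y -> forall e, 0 < e -> exists2 d : R, 0 < d &
  forall t, `|t| < d -> hnorm (S t x - x - rscale t y) <= e * `|t|.
Proof.
move=> /S_gen/cvgrPdist_lt h e e0; have := h e e0.
move=> /nbhs_ballP [d /= d0 hd]; exists d => // t td.
have [->|t0] := eqVneq t 0.
  rewrite S0 subrr sub0r normr0 mulr0 (_ : rscale 0 y = 0) ?oppr0 ?hnorm0 //.
  by rewrite /rscale scale0r.
have := hd t; rewrite /ball /= sub0r normrN => /(_ td t0).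
rewrite sub0r normrN ger0_norm // => /ltW h1.
have -> : S t x - x - rscale t y = rscale t ((t^-1)%:C *: (S t x - x) - y).
  apply: rip_inj => w; rewrite -/(rscale t^-1 _) !ripE; field; exact: t0.
by rewrite hnorm_scale mulrC ler_wpM2r.
Qed.

Lemma A_S t x y : A x y -> A (S t x) (S t y).
Proof.
move=> xy; apply/S_gen/cvgrPdist_lt => e e0.
have [d d0 hd] := A_diffquot xy (divr_gt0 e0 (ltr0n R 2)).
apply/nbhs_ballP; exists d => //= h; rewrite /ball /= sub0r normrN => hd' h0.
rewrite sub0r normrN ger0_norm //.
have -> : (h^-1)%:C *: (S h (S t x) - S t x) - S t y = rscale h^-1 (S t (S h x - x - rscale h y)).
  rewrite !(bopB (S_bop t)) (bopZr (S_bop t)) -!S_add (addrC t).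
  apply: rip_inj => w; rewrite -/(rscale h^-1 _) !ripE; field; exact: h0.
rewrite hnorm_scale S_norm normfV; have := hd h hd'.
have h1 : 0 < `|h| by rewrite normr_gt0.
move=> h2; apply: (@le_lt_trans _ _ (e / 2)); last by lra.
by rewrite mulrC ler_pdivrMr.
Qed.

Lemma S_der x y t : A x y -> forall e, 0 < e -> exists2 d : R, 0 < d &
  forall s, `|s - t| < d -> hnorm (S s x - S t x - rscale (s - t) (S t y)) <= e * `|s - t|.
Proof.
move=> xy e e0; have [d d0 hd] := A_diffquot (A_S t xy) e0.
exists d => // s st; have := hd _ st; by rewrite -S_add subrK.
Qed.

Lemma SN_der x y t : A x y -> forall e, 0 < e -> exists2 d : R, 0 < d &
  forall s, `|s - t| < d -> hnorm (S (- s) x - S (- t) x + rscale (s - t) (S (- t) y)) <= e * `|s - t|.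
Proof.
move=> xy e e0; have [d d0 hd] := S_der (- t) xy e0.
exists d => // s st; have E : - s - - t = - (s - t) by ring.
have := hd (- s); rewrite E normrN => /(_ st) h; apply: le_trans h.
rewrite le_eqVlt; apply/orP; left; apply/eqP; congr hnorm.
by apply: rip_inj => w; rewrite !ripE; ring.
Qed.

Lemma S_hder x y t : A x y -> hder (fun s => S s x) t (S t y).
Proof. exact: S_der. Qed.

Lemma SN_hder x y t : A x y -> hder (fun s => S (- s) x) t (- S (- t) y).
Proof.
move=> xy e e0; have [d d0 hd] := SN_der t xy e0; exists d => // s st.
have := hd s st; rewrite (_ : _ + rscale _ _ = S (- s) x - S (- t) x - rscale (s - t) (- S (- t) y)) //.
by apply: rip_inj => w; rewrite !ripE; ring.
Qed.

Lemma SN_rder a b x y w t : A x y ->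
  rder a b (fun t => rip (S (- t) x) w) t (- rip (S (- t) y) w).
Proof.
move=> xy e e0; have w1 : 0 < hnorm w + 1 by rewrite ltr_wpDl.
have [d d0 hd] := SN_der t xy (divr_gt0 e0 w1); exists d => // s _ st.
rewrite (_ : _ - _ = rip (S (- s) x - S (- t) x + rscale (s - t) (S (- t) y)) w); last first.
  by rewrite !ripE; ring.
apply: le_trans (rip_le _ _) _; have := hd s st.
rewrite -mulrAC ler_pdivlMr // => h; apply: le_trans h.
by rewrite ler_wpM2l // lerDl.
Qed.

(** * The control operator and the input-to-state map *)

Variables (T : R) (U : hilbert R) (Gr : U -> Y).
Hypotheses (T0 : 0 < T) (Gb : bounded_op Gr) (adm : admissible A S Gr T).
Implicit Types (g h : R -> U).

(** Since [A] is skew-adjoint, I - A^* is I + A on D(A). There B^* is thus a bounded operator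
    applied to [z + z'], which makes [Phi z] below continuous. *)
Lemma Bstar_hadj z z' : A z z' -> Bstar A Gr z = hadj Gr (z + z').
Proof.
move=> zz; have E (v : U) : (forall g : U, ip v g = ip (z - opstar A z) (Gr g)) <-> v = hadj Gr (z + z').
  rewrite (opstarE zz) opprK; split => [h|-> g].
    by apply: ip_inj => g; rewrite -hadjE // ipC h -ipC.
  by rewrite ipC -hadjE // -ipC.
apply/E; apply: (@xgetPex _ 0 [set u | forall g : U, ip u g = ip (z - opstar A z) (Gr g)]).
by exists (hadj Gr (z + z')); apply/E.
Qed.

Lemma BpairE (g : U) z z' : A z z' -> Bpair A Gr g z = ip g (Bstar A Gr z).
Proof.
by move=> zz; rewrite /Bpair (opstarE zz) opprK (Bstar_hadj zz) -hadjE.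
Qed.

Definition Phi z t : U := Bstar A Gr (S t z).

Lemma PhiE z z' t : A z z' -> Phi z t = hadj Gr (S t (z + z')).
Proof.
by move=> zz; rewrite /Phi (Bstar_hadj (A_S t zz)) (bopD (S_bop t)).
Qed.

Lemma hcont_Phi a b z : dom A z -> hcont a b (Phi z).
Proof.
case=> z' zz; apply: eq_hcont (hcont_op (hadj_bounded Gb) (@hcont_Sx a b (z + z'))).
by move=> t _; rewrite (PhiE _ zz).
Qed.

Lemma Phi_L2 a b z : dom A z -> is_L2 a b (Phi z).
Proof. by move=> zD; exact/hcont_L2/hcont_Phi. Qed.

Lemma PhiD z w t : dom A z -> dom A w -> Phi (z + w) t = Phi z t + Phi w t.
Proof.
move=> [z' zz] [w' ww]; rewrite (PhiE _ (A_D zz ww)) (PhiE _ zz) (PhiE _ ww).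
by rewrite -(bopD (hadj_bounded Gb)) -(bopD (S_bop t)) addrACA.
Qed.

Lemma PhiZ (al : R[i]) z t : dom A z -> Phi (al *: z) t = al *: Phi z t.
Proof.
move=> [z' zz]; rewrite (PhiE _ (A_Z al zz)) (PhiE _ zz) -scalerDr.
by rewrite (bopZ (S_bop t)) (bopZ (hadj_bounded Gb)).
Qed.

(** [admissible] speaks of the adjoint group, which is the group in reversed time. Applied to
    [S T z], after reflection of [[0, T]], it bounds B^* along the group itself. *)
Lemma Phi_bound : exists2 c : R, 0 <= c & forall z, dom A z -> nL2 0 T (Phi z) <= c * hnorm z.
Proof.
case: adm => c hc; exists (Num.sqrt `|c|) => [|z zD]; first exact: sqrtr_ge0.
rewrite -(@ler_pXn2r _ 2) ?nnegrE ?mulr_ge0 ?nL2_ge0 ?sqrtr_ge0 //.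
rewrite nL2_sqr exprMn sqr_sqrtr //.
have fc : rcont 0 T (fun t => rip (Phi z t) (Phi z t)).
  by apply: hcont_rip; exact: hcont_Phi.
rewrite /nsq -rI_reflect ?(ltW T0) //.
have zTD : dom A (S T z) by case: zD => z' zz; exists (S T z'); exact: A_S.
have E t : Bstar A Gr (hadj (S t) (S T z)) = Phi z (T - t).
  by rewrite hadj_S // -S_add addrC.
have := hc (S T z) ((dom_gadj _).2 zTD); rewrite S_norm.
have ZL : is_L2 0 T (fun t => Phi z (T - t)).
  apply: hcont_L2 => s sab e e0; have [|d d0 hd] := @hcont_Phi 0 T z zD (T - s) _ e e0; first by lra.
  exists d => // t tab ts; apply: hd; first by lra.
  by rewrite (_ : _ - _ = - (t - s)) ?normrN //; ring.
have -> : (fun t => Bstar A Gr (hadj (S t) (S T z))) = (fun t => Phi z (T - t)).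
  by apply: funext => t; rewrite E.
rewrite (L2sq_nsq ZL) lee_fin => h; apply: le_trans h _.
by rewrite ler_wpM2r ?sqr_ge0 // ler_norm.
Qed.

(** Fixed once by choice, so that the constants built from it can be definitions. *)
Definition cB : R := xget 0 [set c | 0 <= c /\ forall z, dom A z -> nL2 0 T (Phi z) <= c * hnorm z].

Lemma cBP : 0 <= cB /\ forall z, dom A z -> nL2 0 T (Phi z) <= cB * hnorm z.
Proof.
have [c c0 hc] := Phi_bound.
by apply: (@xgetPex _ 0 [set c | 0 <= c /\ forall z, dom A z -> nL2 0 T (Phi z) <= c * hnorm z]); exists c.
Qed.

Lemma cB_ge0 : 0 <= cB. Proof. by case: cBP. Qed.

Lemma Phi_le t r z : 0 <= t <= r -> r <= T -> dom A z -> nL2 t r (Phi z) <= cB * hnorm z.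
Proof.
move=> /andP[t0 tr] rT zD; case: cBP => _ h; apply: le_trans (h z zD).
by apply: nL2W => //; exact: Phi_L2.
Qed.

(* The weak integral over [t, r] of s |-> e^{-sA} B g(s). *)
Definition Lam t r g : Y :=
  xget 0 [set v | forall z, dom A z -> rip v z = rI t r (fun s => rip (g s) (Phi z s))].

Lemma LamE t r g z : 0 <= t <= r -> r <= T -> is_L2 t r g -> dom A z ->
  rip (Lam t r g) z = rI t r (fun s => rip (g s) (Phi z s)).
Proof.
move=> tr rT gL; move: z.
apply: (@xgetPex _ 0 [set v | forall z, dom A z -> rip v z = rI t r (fun s => rip (g s) (Phi z s))]).
apply: (@riesz_on _ _ (dom A) _ (nL2 t r g * cB)).
- exact: domA_sub.
- split => [x y xD yD|al x xD].
    rewrite -rID; try by apply: L2_intg => //; exact: Phi_L2.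
    by apply: eq_rI => s _; rewrite PhiD // ripDr.
  rewrite -rIZ; last by apply: L2_intg => //; exact: Phi_L2.
  by apply: eq_rI => s _; rewrite PhiZ // ripZr.
- move=> x xD; apply: le_trans (L2_CS gL (Phi_L2 _ _ xD)) _.
  by rewrite -mulrA ler_wpM2l ?nL2_ge0 // Phi_le.
Qed.

(** Admissibility in dual form: testing on the dense domain shows that the input-to-state map is
    bounded from L^2(t, r; U) to [Y]. *)
Lemma Lam_norm t r g : 0 <= t <= r -> r <= T -> is_L2 t r g ->
  hnorm (Lam t r g) <= cB * nL2 t r g.
Proof.
move=> tr rT gL; apply: (dense_rip_le domA_dense).
  by rewrite mulr_ge0 ?nL2_ge0 // cB_ge0.
move=> v vD; rewrite LamE //; apply: le_trans (ler_norm _) _.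
apply: le_trans (L2_CS gL (Phi_L2 _ _ vD)) _.
by rewrite (mulrC cB) -mulrA ler_wpM2l ?nL2_ge0 // Phi_le.
Qed.

Lemma Lam_lin t r (al : R) g h : 0 <= t <= r -> r <= T -> is_L2 t r g -> is_L2 t r h ->
  Lam t r (fun s => g s + rscale al (h s)) = Lam t r g + rscale al (Lam t r h).
Proof.
move=> tr rT gL hL; apply: (dense_rip_inj domA_dense) => v vD.
rewrite ripDl ripZl !LamE //; last exact: L2_lin.
have i1 := L2_intg gL (Phi_L2 t r vD); have i2 := L2_intg hL (Phi_L2 t r vD).
rewrite -rIZ // -rID //; last exact: intgZ.
by apply: eq_rI => s _; rewrite ripDl ripZl.
Qed.

Lemma eq_Lam t r g h : (forall s, t <= s <= r -> g s = h s) -> Lam t r g = Lam t r h.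
Proof.
move=> gh; rewrite /Lam; congr xget; apply: funext => v; apply/propext; split => H z zD;
  by rewrite H //; apply: eq_rI => s sr; rewrite gh.
Qed.

Lemma Lam_split s t r g : 0 <= t <= s -> s <= r <= T -> is_L2 t r g ->
  Lam t r g = Lam t s g + Lam s r g.
Proof.
move=> /andP[t0 ts] /andP[sr rT] gL; apply: (dense_rip_inj domA_dense) => v vD.
rewrite ripDl !LamE ?t0 ?ts ?(le_trans t0 ts) ?(le_trans ts sr) ?(le_trans sr rT) //.
- apply: rI_split; first by rewrite ts.
  by apply: L2_intg => //; exact: Phi_L2.
- exact: L2W gL.
- exact: L2W gL.
Qed.

Lemma Lam_aa t g : 0 <= t <= T -> Lam t t g = 0.
Proof.
move=> /andP[t0 tT]; apply: (dense_rip_inj domA_dense) => v vD.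
(* [g] is arbitrary here: over a degenerate interval the zero vector has the defining property of
   [Lam], so the choice is made in a nonempty set. *)
suff H : [set v | forall z, dom A z -> rip v z = rI t t (fun s => rip (g s) (Phi z s))] (Lam t t g).
  by rewrite H // rI_aa rip0l.
by apply: xgetPex; exists 0 => z _; rewrite rI_aa rip0l.
Qed.

Lemma Lam_cont t g : 0 <= t <= T -> is_L2 t T g -> hcont t T (fun r => Lam t r g).
Proof.
move=> /andP[t0 tT] gL s /andP[ts sT] e e0.
have c1 : 0 < cB + 1 by rewrite ltr_wpDl // cB_ge0.
have [d d0 hd] := nL2_small gL (introT andP (conj ts sT)) (divr_gt0 e0 c1).
exists d => // r /andP[tr rT] rs.
have key p q : t <= p -> p <= q -> q <= T -> `|p - s| < d -> `|q - s| < d ->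
    hnorm (Lam t q g - Lam t p g) < e.
  move=> tp pq qT pd qd; rewrite (@Lam_split p t q) ?t0 ?tp ?pq ?qT //; last exact: L2W gL.
  rewrite [Lam t p g + _]addrC addrK.
  apply: le_lt_trans (Lam_norm _ _ _) _; rewrite ?pq ?(le_trans t0 tp) //.
    by apply: L2W gL.
  have := hd p q; rewrite tp qT pq pd qd (le_trans pq qT) (le_trans tp pq) => /(_ isT isT isT isT isT).
  rewrite ltr_pdivlMr //; have := nL2_ge0 p q g; lra.
have ss : `|s - s| < d by rewrite subrr normr0.
have [sr|/ltW rs'] := leP s r; first exact: key.
by rewrite hnorm_sym; exact: key.
Qed.

(** The cut keeps the value at the end point [a]; on [[t, a]] it agrees with the cut to the
    degenerate interval [[a, a]], a null set. *)
Lemma nL2_cut_lo t a b g : t <= a -> a <= b -> nL2 t a (tcut a b g) = 0.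
Proof.
move=> ta ab; rewrite (_ : nL2 t a _ = nL2 t a (tcut a a g)).
  by rewrite nL2_cut // /nL2 /nsq rI_aa sqrtr0.
apply: eq_nL2 => r /andP[_ ra]; have [ar|ar] := eqVneq r a.
  by rewrite !tcut_in // ar lexx.
have ar' : (a <= r) = false by apply/negP => h; move/eqP: ar; apply; apply/le_anti; rewrite ra.
by rewrite !tcut_out // ar'.
Qed.

Lemma nL2_cut_hi a b r g : a <= b -> b <= r -> nL2 b r (tcut a b g) = 0.
Proof.
move=> ab br; rewrite (_ : nL2 b r _ = nL2 b r (tcut b b g)).
  by rewrite nL2_cut // /nL2 /nsq rI_aa sqrtr0.
apply: eq_nL2 => s /andP[bs _]; have [sb|sb] := eqVneq s b.
  by rewrite sb !tcut_in ?lexx ?ab.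
have sb' : (s <= b) = false by apply/negP => h; move/eqP: sb; apply; apply/le_anti; rewrite h.
by rewrite !tcut_out // sb' andbF.
Qed.

Lemma Lam_small t r g : 0 <= t <= r -> r <= T -> is_L2 t r g -> nL2 t r g = 0 -> Lam t r g = 0.
Proof.
move=> tr rT gL g0; apply/hnorm_eq0/le_anti; rewrite hnorm_ge0 andbT.
by have := Lam_norm tr rT gL; rewrite g0 mulr0.
Qed.

Section Cut.
Variables (t a b : R) (g : R -> U).
Hypotheses (ta : 0 <= t <= a) (ab : a <= b <= T) (gL : is_L2 a b g).

Let t0 : 0 <= t. Proof. by case/andP: ta. Qed.

Let ta' : t <= a. Proof. by case/andP: ta. Qed.

Let ab' : a <= b. Proof. by case/andP: ab. Qed.

Let bT : b <= T. Proof. by case/andP: ab. Qed.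

Let a0 : 0 <= a. Proof. exact: le_trans ta'. Qed.

Let aT : a <= T. Proof. exact: le_trans bT. Qed.

Let tb : t <= b. Proof. exact: le_trans ab'. Qed.

Let cL : is_L2 t T (tcut a b g). Proof. exact: L2_cut. Qed.

Lemma Lam_cut_lo r : t <= r <= a -> Lam t r (tcut a b g) = 0.
Proof.
move=> /andP[tr ra]; have rT := le_trans ra aT.
apply: Lam_small; rewrite ?t0 ?tr //; first exact: L2W cL.
apply/le_anti; rewrite nL2_ge0 andbT -(nL2_cut_lo g ta' ab').
by apply: nL2W => //; exact: L2W cL.
Qed.

Lemma Lam_cut_mid r : a <= r <= b -> Lam t r (tcut a b g) = Lam a r g.
Proof.
move=> /andP[ar rb]; have rT := le_trans rb bT.
rewrite (@Lam_split a) ?ta ?ar ?rT //; last exact: L2W cL.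
rewrite Lam_cut_lo ?lexx ?ta' // add0r; apply: eq_Lam => s /andP[s1 s2].
by rewrite tcut_in // s1 (le_trans s2 rb).
Qed.

Lemma Lam_cut_hi r : b <= r <= T -> Lam t r (tcut a b g) = Lam a b g.
Proof.
move=> /andP[br rT].
rewrite (@Lam_split b) ?t0 ?tb ?br ?rT //; last exact: L2W cL.
rewrite Lam_cut_mid ?ab' ?lexx //.
rewrite [Lam b r _]Lam_small ?addr0 ?(le_trans a0 ab') //; first exact: L2W cL.
exact: nL2_cut_hi.
Qed.
End Cut.

(** Moving the test vector [z] to [S (- r) z] removes [r] from the integrand of the convolution and
    leaves the integral defining [Lam]. In particular every control in L^2 has a state, unique on
    [[t, T]]. *)
Lemma is_stateP t x g (y : R -> Y) : 0 <= t <= T -> is_L2 t T g ->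
  is_state A S Gr T t x g y <-> forall r, t <= r <= T -> y r = S r (S (- t) x + Lam t r g).
Proof.
move=> /andP[t0 tT] gL.
have key r z : t <= r <= T -> dom A z ->
    cintegral (@lebesgue_measure R) `[t, r] (fun tau => Bpair A Gr (g tau) (hadj (S (r - tau)) z))
    = ip (S r (Lam t r g)) z.
  move=> /andP[tr rT] [z' zz].
  have zD : dom A (S (- r) z) by exists (S (- r) z'); exact: A_S.
  have zDi : dom A ('i%C *: S (- r) z).
    by exists ('i%C *: S (- r) z'); apply: A_Z; exact: A_S.
  have E tau : Bpair A Gr (g tau) (hadj (S (r - tau)) z) = ip (g tau) (Phi (S (- r) z) tau).
    rewrite hadj_S opprB (BpairE _ (A_S (tau - r) zz)) /Phi -S_add.
  by [].
  rewrite ipE.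
  have -> : rip (S r (Lam t r g)) ('i%C *: z) = rip (Lam t r g) ('i%C *: S (- r) z).
    by rewrite S_radj (bopZ (S_bop (- r))).
  rewrite S_radj !LamE ?t0 ?tr //; try exact: L2W gL.
  congr (_ +i* _); apply: eq_rI => tau _; rewrite E //.
  rewrite Im_ip PhiZ //.
split => [h r rr|h r rr z /dom_gadj zD].
  have /andP[tr rT] := rr.
  apply: (dense_rip_inj domA_dense) => z zD.
  have := h r rr z ((dom_gadj _).2 zD); rewrite key // => E.
  by rewrite /rip E raddfD (bopD (S_bop r)) -S_add ipDl raddfD.
by rewrite key // h // (bopD (S_bop r)) ipDl -S_add.
Qed.

(** * Optimal trajectories *)

Variables (C G : Y -> Y).
Hypotheses (Cb : bounded_op C) (Gi : isomorphism G).

Let Gbo : bounded_op G. Proof. by case: Gi. Qed.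

(* From here on states, adjoint states and operators are pulled back by the group:
   yt is e^{-rA} y(r), where x is e^{-tA} y(t), and F(r) becomes e^{-rA} F(r) e^{rA}. *)
Definition yt t x g r : Y := x + Lam t r g.

Lemma hcont_yt t x g : 0 <= t <= T -> is_L2 t T g -> hcont t T (yt t x g).
Proof. by move=> tT gL; apply: hcontD; [exact: hcont_cst|exact: Lam_cont]. Qed.

Lemma yt_lin t x1 x2 g1 g2 (l : R) r : 0 <= t <= r -> r <= T ->
  is_L2 t r g1 -> is_L2 t r g2 ->
  yt t (x1 + rscale l x2) (fun s => g1 s + rscale l (g2 s)) r =
  yt t x1 g1 r + rscale l (yt t x2 g2 r).
Proof.
move=> tr rT L1 L2; rewrite /yt Lam_lin //.
by apply: rip_inj => w; rewrite !ripE; ring.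
Qed.

Lemma yt_restart t x g s r : 0 <= t <= s -> s <= r <= T -> is_L2 t r g ->
  yt s (yt t x g s) g r = yt t x g r.
Proof. by move=> ts sr gL; rewrite /yt -addrA -Lam_split. Qed.

Lemma yt_start t x g : 0 <= t <= T -> yt t x g t = x.
Proof. by move=> tT; rewrite /yt Lam_aa // addr0. Qed.

Definition CS r x : Y := C (S r x).
Definition GS x : Y := G (S T x).

Lemma CS_bop r : bounded_op (CS r). Proof. exact: comp_bounded (S_bop r) Cb. Qed.

Lemma GS_bop : bounded_op GS. Proof. exact: comp_bounded (S_bop T) Gbo. Qed.

Lemma hcont_CS a b (f : R -> Y) : hcont a b f -> hcont a b (fun r => CS r (f r)).
Proof. by move=> fc; apply: hcont_op => //; exact: hcont_S. Qed.

(** The cost polarised into a symmetric bilinear form of the pairs (initial state, control), in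
    pulled back variables. *)
Definition J t x1 g1 x2 g2 : R :=
  rI t T (fun r => rip (CS r (yt t x1 g1 r)) (CS r (yt t x2 g2 r)))
  + rI t T (fun r => rip (g1 r) (g2 r))
  + rip (GS (yt t x1 g1 T)) (GS (yt t x2 g2 T)).

Lemma CSyt_intg t x1 g1 x2 g2 : 0 <= t <= T -> is_L2 t T g1 -> is_L2 t T g2 ->
  intg t T (fun r => rip (CS r (yt t x1 g1 r)) (CS r (yt t x2 g2 r))).
Proof.
by move=> tT L1 L2; apply/rcont_intg/hcont_rip; apply/hcont_CS; exact: hcont_yt.
Qed.

Lemma J_expand t x1 g1 x2 g2 (l : R) : 0 <= t <= T -> is_L2 t T g1 -> is_L2 t T g2 ->
  let x := x1 + rscale l x2 in let g := (fun s => g1 s + rscale l (g2 s)) in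
  J t x g x g = J t x1 g1 x1 g1 + 2 * l * J t x1 g1 x2 g2 + l ^+ 2 * J t x2 g2 x2 g2.
Proof.
move=> tT L1 L2 x g.
have ytE r : t <= r <= T -> yt t x g r = yt t x1 g1 r + rscale l (yt t x2 g2 r).
  move=> rr; apply: yt_lin; [lra|lra| |].
    by apply: L2W L1; [|lra].
  by apply: L2W L2; [|lra].
rewrite /J ytE; last lra.
have E1 : rI t T (fun r => rip (CS r (yt t x g r)) (CS r (yt t x g r))) =
  rI t T (fun r => rip (CS r (yt t x1 g1 r)) (CS r (yt t x1 g1 r))) +
  ((2 * l) * rI t T (fun r => rip (CS r (yt t x1 g1 r)) (CS r (yt t x2 g2 r))) +
   l ^+ 2 * rI t T (fun r => rip (CS r (yt t x2 g2 r)) (CS r (yt t x2 g2 r)))).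
  rewrite -!rIZ -?rID; try by repeat (apply: intgD || apply: intgZ || apply: CSyt_intg).
  apply: eq_rI => r rr; rewrite ytE // (bopD (CS_bop r)) (bopZr (CS_bop r)) !ripE.
  by rewrite (ripC (CS r (yt t x2 g2 r)) (CS r (yt t x1 g1 r))); ring.
have E2 : rI t T (fun r => rip (g r) (g r)) =
  rI t T (fun r => rip (g1 r) (g1 r)) + ((2 * l) * rI t T (fun r => rip (g1 r) (g2 r)) +
   l ^+ 2 * rI t T (fun r => rip (g2 r) (g2 r))).
  rewrite -!rIZ -?rID; try by repeat (apply: intgD || apply: intgZ || apply: L2_intg).
  by apply: eq_rI => r _; rewrite /g !ripE (ripC (g2 r)); ring.
rewrite E1 E2 (bopD GS_bop) (bopZr GS_bop) !ripE (ripC (GS (yt t x2 g2 T)) (GS (yt t x1 g1 T))).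
by clear; atomize; ring.
Qed.

Lemma costE t x g (y : R -> Y) : 0 <= t <= T -> is_L2 t T g ->
  is_state A S Gr T t x g y ->
  cost T C G t g y = (J t (S (- t) x) g (S (- t) x) g)%:E.
Proof.
move=> tT gL /(is_stateP _ _ tT gL) yE; rewrite /cost /J.
have -> : (\int[@lebesgue_measure R]_(r in `[t, T]) (hnorm (C (y r)) ^+ 2 + hnorm (g r) ^+ 2)%:E)%E =
  (rI t T (fun r => rip (CS r (yt t (S (- t) x) g r)) (CS r (yt t (S (- t) x) g r)))
  + rI t T (fun r => rip (g r) (g r)))%:E.
  have i1 := CSyt_intg (S (- t) x) (S (- t) x) tT gL gL; have i2 := L2_intg gL gL.
  rewrite -rID // -rI_EFin; last exact: intgD.
  apply: eq_integral => r; rewrite inE /= in_itv /= => rr.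
  by rewrite yE // !hnorm_sqr.
rewrite -EFinD hnorm_sqr yE //; last lra.
Qed.

(** * The optimal cost operator and first order conditions *)

Variable P : R -> Y -> Y.
Hypothesis PP : optimal_cost_operator A S Gr T C G P.

Definition Pt t x : Y := S (- t) (P t (S t x)).

Lemma P_sa t : 0 <= t <= T -> self_adjoint_op (P t).
Proof. by move=> /PP[]. Qed.

Lemma conj_bop (F : Y -> Y) t : bounded_op F -> bounded_op (fun x => S (- t) (F (S t x))).
Proof. by move=> Fb; exact: comp_bounded (comp_bounded (S_bop t) Fb) (S_bop (- t)). Qed.

Lemma Pt_sym t x y : 0 <= t <= T -> rip (Pt t x) y = rip x (Pt t y).
Proof. by move=> /P_sa[_ h]; rewrite /Pt SN_radj -S_radj /rip h. Qed.

Lemma Pt_bop t : 0 <= t <= T -> bounded_op (Pt t).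
Proof. by move=> /P_sa[h _]; exact: conj_bop. Qed.

(** Optimality is recorded through the value attained, which [opt_min] shows to be the least one. *)
Definition opt t x g := is_L2 t T g /\ J t x g x g = rip (Pt t x) x.

Lemma state_of t x g : 0 <= t <= T -> is_L2 t T g ->
  is_state A S Gr T t x g (fun r => S r (yt t (S (- t) x) g r)).
Proof. by move=> tT gL; apply/is_stateP. Qed.

Lemma opt_ex t x : 0 <= t <= T -> exists g, opt t x g.
Proof.
move=> tT; have [_ /(_ (S t x)) [g [y [[gL st _] cE]]]] := PP tT.
exists g; split => //; move: cE; rewrite (costE tT gL st) SNK => -[->].
by rewrite /Pt SN_radj.
Qed.

Lemma opt_min t x g : 0 <= t <= T -> is_L2 t T g -> rip (Pt t x) x <= J t x g x g.
Proof.
move=> tT gL; have [_ /(_ (S t x)) [g0 [y0 [[_ _ mn] cE]]]] := PP tT.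
have := mn _ _ gL (state_of (S t x) tT gL).
rewrite cE (costE tT gL (state_of (S t x) tT gL)) SNK lee_fin => h.
by rewrite /Pt SN_radj.
Qed.

Lemma opt_of_pair t x g (y : R -> Y) : 0 <= t <= T -> optimal_pair A S Gr T C G t x g y ->
  opt t (S (- t) x) g /\ forall r, t <= r <= T -> y r = S r (yt t (S (- t) x) g r).
Proof.
move=> tT [gL st mn]; split; last by move/is_stateP: st; apply.
split => //; apply/le_anti; rewrite opt_min // andbT.
have [_ /(_ x) [g0 [y0 [[g0L st0 _] cE]]]] := PP tT.
have := mn _ _ g0L st0; rewrite cE (costE tT gL st) lee_fin.
by rewrite /Pt SN_radj SKN.
Qed.

(* Minimality at x1 + l x2 for all l of both signs determines the mixed term. *)
Lemma opt_key t x1 g1 x2 g2 : 0 <= t <= T -> opt t x1 g1 -> is_L2 t T g2 ->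
  J t x1 g1 x2 g2 = rip (Pt t x1) x2.
Proof.
move=> tT [L1 E1] L2; apply/eqP; rewrite -subr_eq0 -sqrf_eq0; apply/eqP/le_anti.
rewrite sqr_ge0 andbT -(mul0r (J t x2 g2 x2 g2 - rip (Pt t x2) x2)).
apply: discriminant_le => l.
have := opt_min (x1 + rscale l x2) tT (L2_lin l L1 L2).
have := J_expand x1 x2 l tT L1 L2 => /= ->.
rewrite E1; have -> : rip (Pt t (x1 + rscale l x2)) (x1 + rscale l x2) =
  rip (Pt t x1) x1 + 2 * l * rip (Pt t x1) x2 + l ^+ 2 * rip (Pt t x2) x2.
  rewrite (bopD (Pt_bop tT)) (bopZr (Pt_bop tT)) !ripE (Pt_sym x2 x1 tT) (ripC x2).
  by ring.
lra.
Qed.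

Definition Mt r x : Y := S (- r) (hadj C (C (S r x))).
Definition Nt x : Y := S (- T) (hadj G (G (S T x))).

Lemma Mt_bop r : bounded_op (Mt r).
Proof. exact: conj_bop (comp_bounded Cb (hadj_bounded Cb)). Qed.

Lemma Mt_rip r x w : rip (Mt r x) w = rip (CS r x) (CS r w).
Proof. by rewrite /Mt SN_radj ripC -hadjEr // ripC. Qed.

Lemma Nt_rip x w : rip (Nt x) w = rip (GS x) (GS w).
Proof. by rewrite /Nt SN_radj ripC -hadjEr // ripC. Qed.

Lemma hcont_Mt a b (f : R -> Y) : hcont a b f -> hcont a b (fun r => Mt r (f r)).
Proof.
move=> fc; apply: hcont_SN; apply: (hcont_op (hadj_bounded Cb)).
by apply: hcont_op => //; exact: hcont_S.
Qed.

Definition cM : R := xget 0 [set c : R | 0 <= c /\ forall r x, hnorm (Mt r x) <= c * hnorm x].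

Lemma cMP : 0 <= cM /\ forall r x, hnorm (Mt r x) <= cM * hnorm x.
Proof.
apply: (@xgetPex _ 0 [set c : R | 0 <= c /\ forall r x, hnorm (Mt r x) <= c * hnorm x]).
have [M M0 hM] := bop_bound (comp_bounded Cb (hadj_bounded Cb)).
by exists M; split => // r x; rewrite /Mt S_norm; apply: le_trans (hM _) _; rewrite S_norm.
Qed.

Lemma cM_ge0 : 0 <= cM. Proof. by case: cMP. Qed.

Lemma Mt_norm r x : hnorm (Mt r x) <= cM * hnorm x. Proof. by case: cMP. Qed.

Definition pt t x g s : Y := vint s T (fun r => Mt r (yt t x g r)) + Nt (yt t x g T).

Lemma hcont_Myt t x g s : 0 <= t <= s -> s <= T -> is_L2 t T g ->
  hcont s T (fun r => Mt r (yt t x g r)).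
Proof.
by move=> ts sT gL; apply: hcont_Mt; apply: hcontW (hcont_yt x _ gL); lra.
Qed.

Lemma pt_char t x g s v : 0 <= t <= s -> s <= T -> is_L2 t T g ->
  rip (pt t x g s) v =
  rI s T (fun r => rip (CS r (yt t x g r)) (CS r v)) + rip (GS (yt t x g T)) (GS v).
Proof.
move=> ts sT gL; rewrite /pt ripDl vintE //; last exact: hcont_Myt.
by rewrite Nt_rip; congr (_ + _); apply: eq_rI => r _; rewrite Mt_rip.
Qed.

Lemma pt_T t x g : pt t x g T = Nt (yt t x g T).
Proof.
rewrite /pt (_ : vint _ _ _ = 0) ?add0r //.
apply: rip_inj => w; rewrite rip0l -(rI_aa T (fun s => rip (Mt s (yt t x g s)) w)).
(* Nothing is assumed on the integrand: over a degenerate interval the zero vector has the defining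
   property of [vint]. *)
have h : forall w, rip (vint T T (fun r => Mt r (yt t x g r))) w = rI T T (fun s => rip (Mt s (yt t x g s)) w).
  apply: (@xgetPex _ 0 [set v | forall w, rip v w = rI T T (fun s => rip (Mt s (yt t x g s)) w)]).
  by exists 0 => u; rewrite rI_aa rip0l.
exact: h.
Qed.

Lemma pt_split t x g s r : 0 <= t <= s -> s <= r <= T -> is_L2 t T g ->
  pt t x g s = vint s r (fun r => Mt r (yt t x g r)) + pt t x g r.
Proof.
move=> ts sr gL; rewrite /pt addrA -vint_split //.
by apply: hcont_Myt gL; lra.
Qed.

(* The first variation of the cost along a control supported in [a, b]. *)
Lemma opt_EL t x g a b gam : 0 <= t <= a -> a <= b <= T -> opt t x g -> is_L2 a b gam ->
  rI a b (fun r => rip (g r) (gam r))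
  + rI a b (fun r => rip (Mt r (yt t x g r)) (Lam a r gam))
  + rip (pt t x g b) (Lam a b gam) = 0.
Proof.
move=> ta ab og gamL; have gL : is_L2 t T g by case: og.
have tT : 0 <= t <= T by lra.
have tbT : 0 <= t <= b by lra.
have bT : b <= T by lra.
have cL : is_L2 t T (tcut a b gam) by apply: L2_cut => //; lra.
have := opt_key 0 tT og cL; rewrite rip0r => <-.
pose F r := rip (CS r (yt t x g r)) (CS r (yt t 0 (tcut a b gam) r)).
have Fi : intg t T F by exact: CSyt_intg.
(* The response to the cut control vanishes before [a], equals [Lam a r gam] on [[a, b]] and is
   frozen at [Lam a b gam] afterwards; the part beyond [b], with the final cost, is what [pt] at [b]
   represents. *)
rewrite /J -/F (@rI_split _ a t T) //; last lra.
rewrite (@rI_split _ b a T); [|lra|by apply: intgW Fi; lra].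
have -> : rI t a F = 0.
  rewrite (@eq_rI _ _ _ _ (cst 0)) ?rI_cst ?mul0r //; first lra.
  move=> r ra; rewrite /F /yt (@Lam_cut_lo t a b) // add0r.
  by rewrite (bop0 (CS_bop r)) rip0r.
have -> : rI a b F = rI a b (fun r => rip (Mt r (yt t x g r)) (Lam a r gam)).
  by apply: eq_rI => r rab; rewrite /F /yt (@Lam_cut_mid t a b) // add0r Mt_rip.
have -> : rI b T F = rI b T (fun r => rip (CS r (yt t x g r)) (CS r (Lam a b gam))).
  by apply: eq_rI => r rab; rewrite /F /yt (@Lam_cut_hi t a b) // add0r.
have -> : rI t T (fun r => rip (g r) (tcut a b gam r)) = rI a b (fun r => rip (g r) (gam r)).
  rewrite (@eq_rI _ t T _ (fun r => rip (tcut a b gam r) (g r))) => [|r _]; last exact: ripC.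
  rewrite rI_cut //; [|lra]; by apply: eq_rI => r _; exact: ripC.
rewrite (_ : yt t 0 (tcut a b gam) T = Lam a b gam); last first.
  by rewrite /yt add0r (@Lam_cut_hi t a b) // bT lexx.
rewrite pt_char //; atomize; lra.
Qed.

(** By symmetry the pairing with [xi] is the mixed cost between the optimal control [g3] issued from
    [xi] and the restarted trajectory. There the contribution of [g3] cancels by the Euler-Lagrange
    identity on [[s, T]], and what is left is [pt_char]. Only [g3] has to be optimal from time [s];
    no principle of optimality for the tail of [g] is invoked. *)
Lemma opt_pt t x g s : 0 <= t <= s -> s <= T -> opt t x g -> Pt s (yt t x g s) = pt t x g s.
Proof.
move=> ts sT og; have gL : is_L2 t T g by case: og.
have s0T : 0 <= s <= T by lra.
have gsL : is_L2 s T g by apply: L2W gL; lra.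
apply: rip_inj => xi; have [g3 o3] := opt_ex xi s0T; have g3L : is_L2 s T g3 by case: o3.
rewrite Pt_sym // ripC -(opt_key (yt t x g s) s0T o3 gsL) /J.
have E r : s <= r <= T -> yt s (yt t x g s) g r = yt t x g r.
  by move=> rr; apply: yt_restart => //; apply: L2W gL; lra.
have := @opt_EL t x g s T g3 ts ltac:(lra) og g3L.
rewrite pt_T pt_char // E; last lra.
have -> : rI s T (fun r => rip (CS r (yt s xi g3 r)) (CS r (yt s (yt t x g s) g r))) =
  rI s T (fun r => rip (CS r (yt t x g r)) (CS r xi)) +
  rI s T (fun r => rip (Mt r (yt t x g r)) (Lam s r g3)).
  rewrite -rID.
  - apply: eq_rI => r rr; rewrite E // Mt_rip -ripDr -(bopD (CS_bop r)); exact: ripC.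
  - apply/rcont_intg/hcont_rip; apply/hcont_CS; last exact: hcont_cst.
    by apply: hcontW (hcont_yt x _ gL); lra.
  - apply/rcont_intg/hcont_rip; first exact: hcont_Myt.
    exact: Lam_cont.
rewrite (@eq_rI _ s T (fun r => rip (g3 r) (g r)) (fun r => rip (g r) (g3 r))); last by move=> r _; exact: ripC.
rewrite Nt_rip [yt s xi g3 T]/yt (bopD GS_bop) ripDl (ripC (GS xi)) (ripC (GS (Lam _ _ _))).
by clear; atomize; lra.
Qed.

(** The initial state is recovered from the cost: it is the pulled back final state, bounded through
    the inverse of [G], minus the input, bounded by the norm of the control. *)
Lemma Pt_coercive : exists2 c : R, 0 < c &
  forall t x, 0 <= t <= T -> c * hnorm x ^+ 2 <= rip (Pt t x) x.
Proof.
have [_ [F' F'b [KF _]]] := Gi; have [N N0 hN] := bop_bound F'b.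
(* The square of [N * p + cB * q] is at most [2 * (N ^+ 2 + cB ^+ 2) * (p ^+ 2 + q ^+ 2)]; the added
   1 keeps the factor positive. *)
pose c := (2 * (N ^+ 2 + cB ^+ 2 + 1))^-1.
have Z0 : 0 < 2 * (N ^+ 2 + cB ^+ 2 + 1).
  by rewrite mulr_gt0 // ltr_wpDl // addr_ge0 ?sqr_ge0.
exists c => [|t x tT]; first by rewrite invr_gt0.
have [g [gL <-]] := opt_ex x tT.
rewrite /c mulrC ler_pdivrMr // mulrC.
have h1 : hnorm x <= N * hnorm (GS (yt t x g T)) + cB * nL2 t T g.
  have -> : x = yt t x g T - Lam t T g by rewrite /yt addrK.
  apply: le_trans (hnorm_add _ _) _; rewrite hnorm_opp {2}/yt subrK; apply: lerD.
    rewrite -[leLHS](S_norm T) -[leLHS]/(hnorm (S T (yt t x g T))) -{1}(KF (S T _)).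
    exact: hN.
  by apply: Lam_norm => //; lra.
have h2 : 0 <= rI t T (fun r => rip (CS r (yt t x g r)) (CS r (yt t x g r))) by apply: rI_ge0.
rewrite /J -/(nsq t T g) -nL2_sqr -(hnorm_sqr (GS _)).
by apply: sq_sum_aux => //; exact: nL2_ge0.
Qed.

(** * The dual Riccati equation *)

Definition Qop t : Y -> Y := opinv (P t).
Definition Qt t x : Y := S (- t) (Qop t (S t x)).

Lemma Qop_props : exists2 c : R, 0 <= c & forall t, 0 <= t <= T ->
  [/\ forall y, P t (Qop t y) = y, forall x, Qop t (P t x) = x,
      self_adjoint_op (Qop t) & forall x, hnorm (Qop t x) <= c * hnorm x].
Proof.
have [c c0 hc] := Pt_coercive; exists c^-1 => [|t tT]; first by rewrite invr_ge0 ltW.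
apply: coercive_iso (P_sa tT) c0 _ => x.
have := hc t (S (- t) x) tT; rewrite S_norm /Pt SKN SN_radj SKN.
by [].
Qed.

Definition cQ : R := xget 0 [set c : R | 0 <= c /\ forall t, 0 <= t <= T ->
  forall x, hnorm (Qop t x) <= c * hnorm x].
Lemma cQP : 0 <= cQ /\ forall t, 0 <= t <= T -> forall x, hnorm (Qop t x) <= cQ * hnorm x.
Proof.
apply: (@xgetPex _ 0 [set c : R | 0 <= c /\ forall t, 0 <= t <= T ->
  forall x, hnorm (Qop t x) <= c * hnorm x]).
by have [c c0 h] := Qop_props; exists c; split => // t /h[].
Qed.

Lemma cQ_ge0 : 0 <= cQ. Proof. by case: cQP. Qed.

Lemma PQ t y : 0 <= t <= T -> P t (Qop t y) = y.
Proof. by have [c _ h] := Qop_props; move=> /h[]. Qed.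

Lemma QP t y : 0 <= t <= T -> Qop t (P t y) = y.
Proof. by have [c _ h] := Qop_props; move=> /h[]. Qed.

Lemma Q_sa t : 0 <= t <= T -> self_adjoint_op (Qop t).
Proof. by have [c _ h] := Qop_props; move=> /h[]. Qed.

Lemma PQt t y : 0 <= t <= T -> Pt t (Qt t y) = y.
Proof. by move=> tT; rewrite /Pt /Qt SKN PQ // SNK. Qed.

Lemma QPt t y : 0 <= t <= T -> Qt t (Pt t y) = y.
Proof. by move=> tT; rewrite /Pt /Qt SKN QP // SNK. Qed.

Lemma Qt_bop t : 0 <= t <= T -> bounded_op (Qt t).
Proof. by move=> /Q_sa[h _]; exact: conj_bop. Qed.

Lemma Qt_sym t x y : 0 <= t <= T -> rip (Qt t x) y = rip x (Qt t y).
Proof. by move=> /Q_sa[_ h]; rewrite /Qt SN_radj -S_radj /rip h. Qed.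

Lemma Qt_norm t x : 0 <= t <= T -> hnorm (Qt t x) <= cQ * hnorm x.
Proof. by case: cQP => _ h /h H; rewrite /Qt S_norm; apply: le_trans (H _) _; rewrite S_norm. Qed.

Lemma opt_yQ t x g r : 0 <= t <= r -> r <= T -> opt t x g -> yt t x g r = Qt r (pt t x g r).
Proof. by move=> tr rT og; rewrite -opt_pt // QPt //; lra. Qed.

(** The optimal cost issued from [Qt t z] is [rip z (Qt t z)], hence at most [cQ * hnorm z ^+ 2]:
    the control has norm at most [cG * hnorm z], and [cY] adds its effect to the initial state. *)
Definition cG : R := Num.sqrt cQ.
Definition cY : R := cQ + cB * cG.
Lemma cG_ge0 : 0 <= cG. Proof. exact: sqrtr_ge0. Qed.

Lemma cY_ge0 : 0 <= cY. Proof. by rewrite addr_ge0 ?cQ_ge0 // mulr_ge0 ?cG_ge0 ?cB_ge0. Qed.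

Lemma traj_p_start t z g : 0 <= t <= T -> opt t (Qt t z) g -> pt t (Qt t z) g t = z.
Proof.
move=> tT og; have gL : is_L2 t T g by case: og.
have h1 : 0 <= t <= t by lra.
have h2 : t <= T by lra.
by rewrite -opt_pt // yt_start // PQt.
Qed.

Lemma traj_g_norm t z g : 0 <= t <= T -> opt t (Qt t z) g ->
  nL2 t T g <= cG * hnorm z.
Proof.
move=> tT og; have gL : is_L2 t T g by case: og.
rewrite -(@ler_pXn2r _ 2) ?nnegrE ?nL2_ge0 ?mulr_ge0 ?cG_ge0 //.
rewrite nL2_sqr exprMn /cG sqr_sqrtr ?cQ_ge0 //.
have [_ E] := og; rewrite PQt // /J in E.
have h1 : 0 <= rI t T (fun r => rip (CS r (yt t (Qt t z) g r)) (CS r (yt t (Qt t z) g r))).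
  by apply: rI_ge0.
have h2 := rip_ge0 (GS (yt t (Qt t z) g T)).
apply: (@le_trans _ _ (rip z (Qt t z))).
  by rewrite -E /nsq addrAC lerDr addr_ge0.
apply: le_trans (rip_leW _ _) _; rewrite expr2 mulrCA.
by rewrite ler_wpM2l // Qt_norm.
Qed.

Lemma traj_y_norm t z g r : 0 <= t <= T -> opt t (Qt t z) g ->
  t <= r <= T -> hnorm (yt t (Qt t z) g r) <= cY * hnorm z.
Proof.
move=> tT og rr; have gL : is_L2 t T g by case: og.
apply: le_trans (hnorm_add _ _) _; rewrite /cY mulrDl; apply: lerD.
  exact: Qt_norm.
have h1 : 0 <= t <= r by lra.
have h2 : r <= T by lra.
have h3 : is_L2 t r g by apply: L2W gL; lra.
apply: le_trans (Lam_norm h1 h2 h3) _.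
rewrite -mulrA ler_wpM2l ?cB_ge0 //; apply: le_trans (traj_g_norm tT og).
by apply: nL2W gL; lra.
Qed.

Lemma traj_M_norm t z g r : 0 <= t <= T -> opt t (Qt t z) g ->
  t <= r <= T -> hnorm (Mt r (yt t (Qt t z) g r)) <= cM * cY * hnorm z.
Proof.
move=> tT og rr; apply: le_trans (Mt_norm _ _) _.
by rewrite -mulrA ler_wpM2l ?cM_ge0 // (traj_y_norm tT og).
Qed.

Lemma hcont_traj_M t z g s : 0 <= t <= T -> opt t (Qt t z) g ->
  t <= s <= T -> hcont t s (fun r => Mt r (yt t (Qt t z) g r)).
Proof.
move=> tT og ts; have gL : is_L2 t T g by case: og.
have h1 : 0 <= t <= t by lra.
have h2 : t <= T by lra.
have h3 : s <= T by lra.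
exact: hcontW (lexx t) h3 (hcont_Myt (Qt t z) h1 h2 gL).
Qed.

Lemma traj_p t z g s : 0 <= t <= T -> opt t (Qt t z) g ->
  t <= s <= T -> (pt t (Qt t z) g) s = z - vint t s (fun r => Mt r (yt t (Qt t z) g r)).
Proof.
move=> tT og ts; have gL : is_L2 t T g by case: og.
have h1 : 0 <= t <= t by lra.
have E := traj_p_start tT og; rewrite (pt_split _ h1 ts gL) in E.
by rewrite -[X in _ = X - _]E addrAC subrr add0r.
Qed.

Lemma traj_p_dist t z g s : 0 <= t <= T -> opt t (Qt t z) g ->
  t <= s <= T -> hnorm (z - (pt t (Qt t z) g) s) <= cM * cY * hnorm z * (s - t).
Proof.
move=> tT og ts; rewrite (traj_p tT og) // opprB addrCA subrr addr0.
apply: vint_norm; first by lra.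
- exact: (hcont_traj_M tT og).
- by rewrite !mulr_ge0 ?cM_ge0 ?cY_ge0.
- by move=> r rr; apply: (traj_M_norm tT og); lra.
Qed.

(** The Euler-Lagrange identity on [[t, s]] is tested with the deviation [gam = g + Phi z] itself.
    The pairing of [z] with [Lam t s gam] accounts for [Phi z], so that only [z - p s], of order
    [s - t], and an integral over [[t, s]] remain. Both are at most a multiple of [s - t] times the
    norm of [gam], and one factor cancels. *)
Lemma traj_g_Phi t z g s : 0 <= t <= T -> opt t (Qt t z) g ->
  t <= s <= T -> dom A z ->
  nL2 t s (fun r => g r + Phi z r) <= 2 * cM * cY * cB * hnorm z * (s - t).
Proof.
move=> tT og; have gL : is_L2 t T g by case: og.
pose y := yt t (Qt t z) g; pose p := pt t (Qt t z) g.
move=> ts zD; pose gam r := g r + Phi z r; have st0 : 0 <= s - t by lra.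
have gsL : is_L2 t s g by apply: L2W gL; lra.
have gamL : is_L2 t s gam by apply: L2D => //; exact: Phi_L2.
pose m := cM * cY * hnorm z; have m0 : 0 <= m by rewrite !mulr_ge0 ?cM_ge0 ?cY_ge0.
have nLam r : t <= r <= s -> hnorm (Lam t r gam) <= cB * nL2 t s gam.
  move=> rr; have h1 : 0 <= t <= r by lra.
  have h2 : r <= T by lra.
  have h3 : is_L2 t r gam by apply: L2W gamL; lra.
  apply: le_trans (Lam_norm h1 h2 h3) _.
  by rewrite ler_wpM2l ?cB_ge0 //; apply: nL2W gamL; lra.
have EL := @opt_EL t _ g t s gam ltac:(lra) ts og gamL.
have LE : rip (Lam t s gam) z = rI t s (fun r => rip (gam r) (Phi z r)).
  by apply: LamE => //; lra.
have E : nsq t s gam = rip (z - p s) (Lam t s gam) - rI t s (fun r => rip (Mt r (y r)) (Lam t r gam)).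
  rewrite ripDl ripNl (ripC z) LE /nsq.
  have -> : rI t s (fun r => rip (gam r) (gam r)) =
     rI t s (fun r => rip (g r) (gam r)) + rI t s (fun r => rip (gam r) (Phi z r)).
    rewrite -rID; try by apply: L2_intg => //; exact: Phi_L2.
    by apply: eq_rI => r _; rewrite [in LHS]/gam ripDl (ripC (Phi z r)).
  rewrite -/y -/p in EL; move: EL; clear; atomize; lra.
have h1 : rip (z - p s) (Lam t s gam) <= m * (s - t) * (cB * nL2 t s gam).
  apply: le_trans (rip_leW _ _) _; apply: ler_pM => //; first exact: (traj_p_dist tT og).
  by apply: nLam; lra.
have h2 : `|rI t s (fun r => rip (Mt r (y r)) (Lam t r gam))| <= m * (cB * nL2 t s gam) * (s - t).
  apply: abs_rI_ub; first lra.
    apply/rcont_intg/hcont_rip; first exact: (hcont_traj_M tT og).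
    have cL : is_L2 t T (tcut t s gam) by apply: L2_cut => //; lra.
    have sT' : s <= T by lra.
    apply: eq_hcont (hcontW (lexx t) sT' (Lam_cont tT cL)).
    by move=> r rr; apply: eq_Lam => q qr; apply: tcut_in; lra.
  move=> r rr; apply: le_trans (rip_le _ _) _; apply: ler_pM => //.
    by apply: (traj_M_norm tT og); lra.
  exact: nLam.
have h3 : nL2 t s gam ^+ 2 <= (2 * m * cB * (s - t)) * nL2 t s gam.
  have := ler_norm (- rI t s (fun r => rip (Mt r (y r)) (Lam t r gam))); rewrite normrN.
  rewrite nL2_sqr E; move: h1 h2; clear; move: cB (nL2 _ _ _); atomize => *; lra.
rewrite -/gam (_ : _ * (s - t) = 2 * m * cB * (s - t)); last by rewrite /m; ring.
have := nL2_ge0 t s gam; have : 0 <= 2 * m * cB * (s - t).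
  by apply: mulr_ge0 => //; apply: mulr_ge0; [exact: mulr_ge0|exact: cB_ge0].
move: h3; move: (nL2 t s gam) (2 * m * cB * (s - t)); clear => n k h3 k0 n0.
have [->|nn] := eqVneq n 0; first exact: k0.
have np : 0 < n by rewrite lt_def nn.
by rewrite -(ler_pM2r np) -expr2.
Qed.

(** Along the trajectory [y s = Qt s (p s)], with [p s] equal to [z] minus an integral, while
    [Qt t z] is [y s] minus the input. The increment is thus expressed by [Qt] at the later time
    only, and no regularity of [Qt] in time is presupposed. *)
Lemma traj_Q t z g s w : 0 <= t <= T -> opt t (Qt t z) g ->
  t <= s <= T -> dom A w ->
  rip (Qt s z) w - rip (Qt t z) w =
  rI t s (fun r => rip (Mt r (yt t (Qt t z) g r)) (Qt s w)) + rI t s (fun r => rip (g r) (Phi w r)).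
Proof.
move=> tT og; have gL : is_L2 t T g by case: og.
pose y := yt t (Qt t z) g; move=> ts wD; have sT : 0 <= s <= T by lra.
have gsL : is_L2 t s g by apply: L2W gL; lra.
have E1 : Qt t z = y s - Lam t s g by rewrite /y /yt addrK.
have E2 : y s = Qt s z - Qt s (vint t s (fun r => Mt r (y r))).
  have h1 : 0 <= t <= s by lra.
  have h2 : s <= T by lra.
  have Ey : y s = Qt s (pt t (Qt t z) g s) := opt_yQ h1 h2 og.
  by rewrite Ey (traj_p tT og ts) (bopB (Qt_bop sT)).
have h1 : 0 <= t <= s by lra.
have h2 : s <= T by lra.
have h3 : t <= s by lra.
have -> : rip (Qt t z) w = rip (Qt s z) w - rI t s (fun r => rip (Mt r (y r)) (Qt s w))
    - rI t s (fun r => rip (g r) (Phi w r)).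
  rewrite E1 E2 !ripDl !ripNl (LamE h1 h2 gsL wD).
  by rewrite [rip (Qt s (vint _ _ _)) w]Qt_sym // vintE //; exact: hcont_traj_M.
by rewrite /y; clear; atomize; ring.
Qed.

(** [traj_Q] asks only [w] to lie in D(A); testing against every [z] in [Y] bounds the norm. *)
Lemma Qt_modulus t s w : 0 <= t <= s -> s <= T -> dom A w ->
  hnorm (Qt s w - Qt t w) <= cM * cY * cQ * hnorm w * (s - t) + cG * nL2 t s (Phi w).
Proof.
move=> ts sT wD; have tT : 0 <= t <= T by lra.
have s0T : 0 <= s <= T by lra.
have tsT : t <= s <= T by lra.
have st0 : 0 <= s - t by lra.
have ts' : t <= s by lra.
apply: hnorm_dual.
  apply: addr_ge0; apply: mulr_ge0 => //.
  - by apply: mulr_ge0 => //; apply: mulr_ge0; [apply: mulr_ge0; [exact: cM_ge0|exact: cY_ge0]|exact: cQ_ge0].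
  - exact: cG_ge0.
  - exact: nL2_ge0.
move=> z; have [g og] := opt_ex (Qt t z) tT; have gL : is_L2 t T g by case: og.
have gsL : is_L2 t s g by apply: L2W gL; lra.
have -> : rip (Qt s w - Qt t w) z = rip (Qt s z) w - rip (Qt t z) w.
  by rewrite ripDl ripNl (Qt_sym w z s0T) (Qt_sym w z tT) (ripC w) (ripC w).
rewrite (traj_Q tT og tsT wD) mulrDl; apply: lerD.
  apply: le_trans (ler_norm _) _.
  rewrite (_ : _ * hnorm z = (cM * cY * hnorm z) * (cQ * hnorm w) * (s - t)); last by ring.
  apply: abs_rI_ub => //.
    by apply/hcont_intg; exact: hcont_traj_M.
  move=> r rr; apply: le_trans (rip_le _ _) _; apply: ler_pM => //.
    by apply: traj_M_norm => //; lra.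
  exact: Qt_norm.
apply: le_trans (ler_norm _) _; apply: le_trans (L2_CS gsL (Phi_L2 _ _ wD)) _.
rewrite mulrAC; apply: ler_pM => //; try exact: nL2_ge0.
by apply: le_trans (traj_g_norm tT og); apply: nL2W gL; lra.
Qed.

Lemma Qt_hcont x : hcont 0 T (fun s => Qt s x).
Proof.
suff domcase w : dom A w -> hcont 0 T (fun s => Qt s w).
  move=> s sT e e0; have q1 : 0 < 3 * (cQ + 1) by rewrite mulr_gt0 // ltr_wpDl // cQ_ge0.
  have [w wD wx] := dense_near x domA_dense (divr_gt0 e0 q1).
  have [d d0 hd] := domcase w wD s sT (e / 3) ltac:(by rewrite divr_gt0).
  exists d => // t tT ts; have h1 := hd t tT ts.
  have key r : 0 <= r <= T -> hnorm (Qt r x - Qt r w) <= e / 3.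
    move=> rT; rewrite -(bopB (Qt_bop rT)); apply: le_trans (Qt_norm _ rT) _.
    rewrite hnorm_sym; apply: le_trans (ler_wpM2l cQ_ge0 (ltW wx)) _.
    rewrite mulrA ler_pdivrMr //; lra.
  have h2 := key t tT; have h3 := key s sT; rewrite hnorm_sym in h3.
  apply: le_lt_trans (hnorm_tri (Qt t w) _ _) _.
  have h4 := hnorm_tri (Qt s w) (Qt t w) (Qt s x).
  by lra.
move=> wD s sT e e0.
pose K := cM * cY * cQ * hnorm w.
have K0 : 0 <= K.
  by rewrite !mulr_ge0 ?cM_ge0 ?cY_ge0 ?cQ_ge0.
have c1 : 0 < cG + 1 by rewrite ltr_wpDl // cG_ge0.
have K1 : 0 < 4 * (K + 1) by rewrite mulr_gt0 // ltr_wpDl.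
have [d d0 hd] := nL2_small (Phi_L2 0 T wD) sT (divr_gt0 e0 (mulr_gt0 (ltr0n R 2) c1)).
exists (Num.min d (e / (4 * (K + 1)))); first by rewrite lt_min d0 divr_gt0.
move=> t tT; rewrite lt_min => /andP[t1]; rewrite ltr_pdivlMr // => t2.
have ss : `|s - s| < d by rewrite subrr normr0.
have key p q : 0 <= p <= T -> 0 <= q <= T -> p <= q -> `|p - s| < d -> `|q - s| < d ->
   q - p <= `|t - s| -> hnorm (Qt q w - Qt p w) < e.
  move=> pT qT pq pd qd qp; have h0p : 0 <= p <= q by lra.
  have hq : q <= T by lra.
  apply: le_lt_trans (Qt_modulus h0p hq wD) _; rewrite -/K.
  have := hd p q pT qT pq pd qd; rewrite ltr_pdivlMr ?mulr_gt0 //.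
  have : K * (q - p) <= K * `|t - s| by rewrite ler_wpM2l.
  have := nL2_ge0 p q (Phi w); have := cG_ge0.
  by move=> c0 n0 le1 lt1; apply: small_sum_aux t2 _ _ _ _ le1 lt1.
have [ts|st] := leP t s.
  rewrite hnorm_sym; apply: key => //; rewrite ler0_norm; lra.
by apply: key => //; [exact: ltW|rewrite gtr0_norm; lra].
Qed.

(** Both ends of the increment are free because trajectories run forward in time: an increment to
    the left of [t] starts from a point before [t]. *)
Lemma rder_of_increment a b (phi psi : R -> R) t : rcont a b psi -> a <= t <= b ->
  (forall e : R, 0 < e -> exists2 d : R, 0 < d & forall p q, a <= p -> p <= q -> q <= b ->
     `|p - t| < d -> `|q - t| < d -> `|phi q - phi p - rI p q psi| <= e * (q - p)) ->
  rder a b phi t (psi t).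
Proof.
move=> pc tab h e e0; have e2 : 0 < e / 2 by rewrite divr_gt0.
have [d d0 hd] := h _ e2; have [d' d0' hd'] := rI_rder pc tab e2.
exists (Num.min d d'); first by rewrite lt_min d0.
move=> s sab; rewrite lt_min => /andP[s1 s2].
have tt : `|t - t| < d by rewrite subrr normr0.
have h2 := hd' s sab s2.
have [ts|/ltW st] := leP t s.
  have h1 := hd t s ltac:(lra) ts ltac:(lra) tt s1.
  rewrite (@rI_split _ t a s) in h2; [|lra|by apply: rcont_intg; apply: rcontW pc; lra].
  rewrite (_ : _ - _ - _ = (phi s - phi t - rI t s psi) + (rI a t psi + rI t s psi - rI a t psi - psi t * (s - t))); last by ring.
  rewrite (_ : `|s - t| = s - t) in h2 *; last by rewrite ger0_norm ?subr_ge0.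
  by apply: le_trans (ler_normD _ _) _; lra.
have h1 := hd s t ltac:(lra) st ltac:(lra) s1 tt.
rewrite (@rI_split _ s a t) in h2; [|lra|by apply: rcont_intg; apply: rcontW pc; lra].
rewrite (_ : _ - _ - _ = - (phi t - phi s - rI s t psi) + (rI a s psi - (rI a s psi + rI s t psi) - psi t * (s - t))); last by ring.
rewrite (_ : `|s - t| = t - s) in h2 *; last by rewrite ler0_norm ?opprB // subr_le0.
by apply: le_trans (ler_normD _ _) _; rewrite normrN; lra.
Qed.

Lemma Qt_rder z w t : dom A z -> dom A w -> 0 <= t <= T ->
  rder 0 T (fun s => rip (Qt s z) w) t
    (rip (Mt t (Qt t z)) (Qt t w) - rip (Phi z t) (Phi w t)).
Proof.
move=> zD wD tT.
pose psi r := rip (Mt r (Qt r z)) (Qt r w) - rip (Phi z r) (Phi w r).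
have ph1 : rcont 0 T (fun r => rip (Mt r (Qt r z)) (Qt r w)).
  by apply: hcont_rip; [apply: hcont_Mt|]; exact: Qt_hcont.
have ph2 : rcont 0 T (fun r => rip (Phi z r) (Phi w r)).
  by apply: hcont_rip; exact: hcont_Phi.
have pc : rcont 0 T psi by apply: rcontD => //; exact: rcontN.
rewrite -/(psi t); apply: rder_of_increment => // e e0.
(* [K1] measures the drift of the adjoint state away from [z], [K2] multiplies the oscillation of
   [Qt] at [w], and [K3] is the constant of [traj_g_Phi]. Each of the three errors receives a third
   of [e]. *)
pose K1 := cM * (cQ * (cM * cY * hnorm z)) * (cQ * hnorm w).
pose K2 := cM * (cQ * hnorm z); pose K3 := 2 * cM * cY * cB * hnorm z.
have K10 : 0 <= K1 by rewrite !mulr_ge0 ?cM_ge0 ?cY_ge0 ?cQ_ge0.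
have K20 : 0 <= K2 by rewrite !mulr_ge0 ?cM_ge0 ?cQ_ge0.
have K30 : 0 <= K3 by rewrite !mulr_ge0 ?cM_ge0 ?cY_ge0 ?cB_ge0.
have k1 : 0 < 6 * (K1 + 1) by rewrite mulr_gt0 // ltr_wpDl.
have k2 : 0 < 6 * (K2 + 1) by rewrite mulr_gt0 // ltr_wpDl.
have k3 : 0 < 3 * (K3 + 1) by rewrite mulr_gt0 // ltr_wpDl.
have [d1 d10 hd1] := Qt_hcont w tT (divr_gt0 e0 k2).
have [d2 d20 hd2] := nL2_small (Phi_L2 0 T wD) tT (divr_gt0 e0 k3).
exists (Num.min (e / (6 * (K1 + 1))) (Num.min d1 d2)).
  by rewrite !lt_min divr_gt0 // d10.
move=> p q p0 pq qT; rewrite !lt_min !ltr_pdivlMr // => /andP[p1 /andP[p2 p3]] /andP[q1 /andP[q2 q3]].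
have pT : 0 <= p <= T by lra.
have qT' : 0 <= q <= T by lra.
have pqT : p <= q <= T by lra.
have [g og] := opt_ex (Qt p z) pT; have gL : is_L2 p T g by case: og.
have gpL : is_L2 p q g := L2W (lexx p) qT gL.
pose y := yt p (Qt p z) g.
have yc : hcont p q (fun r => Mt r (y r)) by exact: hcont_traj_M.
have i1 : intg p q (fun r => rip (Mt r (y r)) (Qt q w)) by exact: hcont_intg.
have i2 : intg p q (fun r => rip (Mt r (Qt r z)) (Qt r w)).
  exact/rcont_intg/(rcontW p0 qT ph1).
have i3 : intg p q (fun r => rip (Phi z r) (Phi w r)).
  exact/rcont_intg/(rcontW p0 qT ph2).
have i4 : intg p q (fun r => rip (g r) (Phi w r)) by apply: L2_intg => //; exact: Phi_L2.
(* The first integrand is small because [y r = Qt r (p r)] with [p r] close to [z]. In the second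
   integral [g + Phi z] has norm of order [q - p], and the norm of [Phi w] over a short interval
   supplies the remaining smallness. *)
have E : rip (Qt q z) w - rip (Qt p z) w - rI p q psi =
  rI p q (fun r => rip (Mt r (y r)) (Qt q w) - rip (Mt r (Qt r z)) (Qt r w)) +
  rI p q (fun r => rip (g r + Phi z r) (Phi w r)).
  rewrite (traj_Q pT og pqT wD) -/y /psi rIB // rIB //.
  have -> : rI p q (fun r => rip (g r + Phi z r) (Phi w r)) =
    rI p q (fun r => rip (g r) (Phi w r)) + rI p q (fun r => rip (Phi z r) (Phi w r)).
    by rewrite -rID //; apply: eq_rI => r _; rewrite ripDl.
  by clear; atomize; ring.
rewrite E; apply: le_trans (ler_normD _ _) _.
have B2 : `|rI p q (fun r => rip (g r + Phi z r) (Phi w r))| <= e / 3 * (q - p).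
  apply: le_trans (L2_CS _ (Phi_L2 _ _ wD)) _; first by apply: L2D => //; exact: Phi_L2.
  have n1 := traj_g_Phi pT og pqT zD; rewrite -/K3 in n1.
  have n2 := hd2 p q pT qT' pq p3 q3; rewrite ltr_pdivlMr // in n2.
  apply: le_trans (_ : K3 * (q - p) * nL2 p q (Phi w) <= _).
    by rewrite ler_wpM2r // nL2_ge0.
  rewrite mulrAC ler_wpM2r ?subr_ge0 //.
  by have := nL2_ge0 p q (Phi w); lra.
have B1 : `|rI p q (fun r => rip (Mt r (y r)) (Qt q w) - rip (Mt r (Qt r z)) (Qt r w))| <= 2 * e / 3 * (q - p).
  apply: abs_rI_ub => //; first exact: intgB.
  move=> r rr; have /andP[pr rq] := rr; have rT' := le_trans rq qT.
  have rT : 0 <= r <= T by rewrite (le_trans p0 pr).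
  have prT : p <= r <= T by rewrite pr.
  have p0r : 0 <= p <= r by rewrite p0.
  have yQ : y r = Qt r (pt p (Qt p z) g r) by exact: opt_yQ p0r rT' og.
  rewrite (_ : _ - _ = rip (Mt r (y r - Qt r z)) (Qt q w) + rip (Mt r (Qt r z)) (Qt q w - Qt r w)); last first.
    by rewrite (bopB (Mt_bop r)) !ripE; clear; atomize; ring.
  have a1 : `|rip (Mt r (y r - Qt r z)) (Qt q w)| <= K1 * (q - p).
    apply: le_trans (rip_le _ _) _.
    rewrite (_ : K1 * (q - p) = (cM * (cQ * (cM * cY * hnorm z * (q - p)))) * (cQ * hnorm w)); last by rewrite /K1; ring.
    apply: ler_pM => //; last exact: Qt_norm.
    apply: le_trans (Mt_norm _ _) _; rewrite ler_wpM2l ?cM_ge0 //.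
    rewrite yQ -(bopB (Qt_bop rT)); apply: le_trans (Qt_norm _ rT) _.
    rewrite ler_wpM2l ?cQ_ge0 // hnorm_sym; apply: le_trans (traj_p_dist pT og prT) _.
    by rewrite ler_wpM2l ?mulr_ge0 ?cM_ge0 ?cY_ge0 // lerD2r.
  have a2 : `|rip (Mt r (Qt r z)) (Qt q w - Qt r w)| <= K2 * hnorm (Qt q w - Qt r w).
    apply: le_trans (rip_le _ _) _; rewrite ler_wpM2r //.
    apply: le_trans (Mt_norm _ _) _; rewrite ler_wpM2l ?cM_ge0 //; exact: Qt_norm.
  have rt := between_dist pr rq p2 q2.
  have a3 := hd1 q qT' q2; have a4 := hd1 r rT rt; rewrite ltr_pdivlMr // in a3.
  rewrite ltr_pdivlMr // in a4.
  have a5 := hnorm_tri (Qt t w) (Qt q w) (Qt r w); rewrite (hnorm_sym (Qt t w)) in a5.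
  have l3 : q - p <= `|q - t| + `|p - t|.
    rewrite (_ : q - p = (q - t) - (p - t)); last by ring.
    exact: le_trans (ler_norm _) (ler_normB _ _).
  have a6 := third_le K10 l3 q1 p1.
  have a7 := third_le K20 a5 a3 a4.
  apply: le_trans (ler_normD _ _) _.
  rewrite (_ : 2 * e / 3 = e / 3 + e / 3); last by ring.
  apply: lerD; first by apply: le_trans a1 (a6 _); rewrite subr_ge0.
  exact: le_trans a2 (a7 (hnorm_ge0 _)).
rewrite (_ : e * (q - p) = 2 * e / 3 * (q - p) + e / 3 * (q - p)); last by field.
exact: lerD B1 B2.
Qed.

Lemma cdiffquotE (u v l : R[i]) (k : R) : (u - v) / k%:C - l =
  ((complex.Re u - complex.Re v) / k - complex.Re l) +i*
  ((complex.Im u - complex.Im v) / k - complex.Im l).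
Proof.
rewrite -fmorphV; case: u => a b; case: v => c d; case: l => e f; simpc.
by congr (_ +i* _); ring.
Qed.

(** [cderiv_within] excludes the final time, so the interval is shortened to some [b < T]. *)
Lemma cderiv_Re (phi : R -> R[i]) t l b : 0 <= t <= b -> b < T ->
  cderiv_within `[0, T[ phi t l -> rder 0 b (fun s => complex.Re (phi s)) t (complex.Re l).
Proof.
move=> tb bT h e e0; have /cvgrPdist_lt/(_ e e0) := h.
rewrite near_withinE => /nbhs_ballP [d /= d0 hd]; exists d => // s sb st.
have [->|st0] := eqVneq s t; first by rewrite !subrr mulr0 subrr normr0 mulr0.
have := hd s; rewrite /ball /= distrC => /(_ st st0).
rewrite in_itv /= => /(_ ltac:(lra)); rewrite sub0r normrN cdiffquotE => h1.
have p : 0 < `|s - t| by rewrite normr_gt0 subr_eq0.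
rewrite (_ : _ - _ - _ = ((complex.Re (phi s) - complex.Re (phi t)) / (s - t) - complex.Re l) * (s - t)); last first.
  by field; rewrite subr_eq0.
rewrite normrM ler_wpM2r //; apply: le_trans (ltW h1).
apply: le_trans (ler_norm _); set z := _ +i* _.
by have := normc_ge_Re z; rewrite lecE => /andP[_].
Qed.

Lemma cderiv_of_rder (phi : R -> R[i]) t l : 0 <= t < T ->
  rder 0 T (fun s => complex.Re (phi s)) t (complex.Re l) ->
  rder 0 T (fun s => complex.Im (phi s)) t (complex.Im l) ->
  cderiv_within `[0, T[ phi t l.
Proof.
move=> tT hr hi; apply/cvgrPdist_lt => e e0; have e3 : 0 < e / 3 by rewrite divr_gt0.
have [d d0 hd] := hr _ e3; have [d' d0' hd'] := hi _ e3.
rewrite near_withinE; apply/nbhs_ballP; exists (Num.min d d') => /=; first by rewrite lt_min d0.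
move=> s; rewrite /ball /= distrC lt_min => /andP[s1 s2] st0; rewrite in_itv /= => sT.
rewrite sub0r normrN cdiffquotE /= ger0_norm ?sqrtr_ge0 //.
have p : 0 < `|s - t| by rewrite normr_gt0 subr_eq0.
have key (f : R -> R) (m : R) : `|f s - f t - m * (s - t)| <= e / 3 * `|s - t| ->
    `|(f s - f t) / (s - t) - m| <= e / 3.
  move=> h; rewrite -(ler_pM2r p) -normrM; apply: le_trans h.
  rewrite le_eqVlt; apply/orP; left; apply/eqP; congr `|_|.
  by field; rewrite subr_eq0.
have sT' : 0 <= s <= T by lra.
have k1 := key (fun r => complex.Re (phi r)) _ (hd s sT' s1).
have k2 := key (fun r => complex.Im (phi r)) _ (hd' s sT' s2).
rewrite -(@ltr_pXn2r _ 2) ?nnegrE ?sqrtr_ge0 ?ltW // sqr_sqrtr ?addr_ge0 ?sqr_ge0 //.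
move: k1 k2; set a := _ - complex.Re l; set b := _ - complex.Im l => k1 k2.
have k3 : a ^+ 2 <= (e / 3) ^+ 2 by rewrite -real_normK ?num_real // ler_pXn2r ?nnegrE // ltW.
have k4 : b ^+ 2 <= (e / 3) ^+ 2 by rewrite -real_normK ?num_real // ler_pXn2r ?nnegrE // ltW.
have : 0 < e ^+ 2 by rewrite exprn_gt0.
lra.
Qed.

Lemma Qop_Qt t x : Qop t x = S t (Qt t (S (- t) x)).
Proof. by rewrite /Qt SKN SKN. Qed.

Lemma Qop_hcont x : hcont 0 T (fun t => Qop t x).
Proof.
have h : hcont 0 T (fun t => Qt t (S (- t) x)).
  apply: (@hcont_family _ _ _ 0 T Qt (fun t => S (- t) x) cQ).
  - exact: Qt_bop.
  - by move=> s z sT; exact: Qt_norm.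
  - by move=> z; exact: Qt_hcont.
  - exact: hcont_SNx.
by apply: eq_hcont (hcont_S h) => t _; rewrite Qop_Qt.
Qed.

Lemma P_T x : P T x = hadj G (G x).
Proof.
have TT : 0 <= T <= T by rewrite (ltW T0) lexx.
have [g og] := opt_ex (S (- T) x) TT; have T1 : T <= T by lra.
have := opt_pt TT T1 og; rewrite yt_start // pt_T yt_start // /Pt /Nt SKN => E.
by rewrite -[LHS](SKN T) E SKN.
Qed.

Lemma Q_sym t x y : 0 <= t <= T -> rip (Qop t x) y = rip x (Qop t y).
Proof. by move=> /Q_sa[_ h]; rewrite /rip h. Qed.

(** The product rule with the moving vectors [S (- s) x] and [S (- s) y] restores the terms in [A]
    that the pull-back had removed. *)
Lemma Qop_rder x x' y y' t : A x x' -> A y y' -> 0 <= t <= T ->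
  rder 0 T (fun s => rip (Qop s x) y) t
   (- rip (Qop t x) y' - rip x' (Qop t y) - rip (Bstar A Gr x) (Bstar A Gr y)
    + rip (C (Qop t x)) (C (Qop t y))).
Proof.
move=> xx yy tT.
have xD : dom A (S (- t) x) by exists (S (- t) x'); exact: A_S.
have yD : dom A (S (- t) y) by exists (S (- t) y'); exact: A_S.
have h := @prod_rder R Y 0 T t Qt (fun s => S (- s) x) (fun s => S (- s) y)
  (- S (- t) x') (- S (- t) y') _ cQ Qt_bop cQ_ge0 (fun s z sT => Qt_norm z sT)
  (fun z => Qt_hcont z tT) tT (SN_hder t xx) (SN_hder t yy) (Qt_rder xD yD tT).
have E s u v : rip (Qt s (S (- s) u)) (S (- s) v) = rip (Qop s u) v.
  by rewrite Qop_Qt S_radj.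
have fE : (fun s => rip (Qt s (S (- s) x)) (S (- s) y)) = (fun s => rip (Qop s x) y) by apply: funext => s.
rewrite fE in h.
rewrite (_ : _ - _ - _ + _ = rip (Mt t (Qt t (S (- t) x))) (Qt t (S (- t) y)) -
     rip (Phi (S (- t) x) t) (Phi (S (- t) y) t) + rip (Qt t (- S (- t) x')) (S (- t) y) +
   rip (Qt t (S (- t) x)) (- S (- t) y')) //.
rewrite Mt_rip /CS -!Qop_Qt /Phi !SKN (bopN (Qt_bop tT)) !ripNl !ripNr.
by rewrite !E (Q_sym x' y tT); clear; atomize; ring.
Qed.

Lemma Bstar_i x x' : A x x' -> Bstar A Gr ('i%C *: x) = 'i%C *: Bstar A Gr x.
Proof.
move=> xx; rewrite (Bstar_hadj xx) (Bstar_hadj (A_Z _ xx)) -scalerDr.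
exact: (bopZ (hadj_bounded Gb)).
Qed.

Lemma Q_riccati : dual_riccati_solution A Gr T C G Qop.
Proof.
split.
- by move=> t tT; exact: Q_sa.
- by move=> x; apply/hcontP; exact: Qop_hcont.
- by move=> x; rewrite /Qop; congr (opinv _ x); apply: funext => v; exact: P_T.
move=> x x' y y' /gadjA xx /gadjA yy t tT; have tT' : 0 <= t <= T by lra.
have h1 := Qop_rder xx yy tT'.
(* The imaginary part of the pairing with [y] is the real part of the pairing with ['i%C *: y],
   again in D(A). *)
have h2 := Qop_rder xx (A_Z 'i%C yy) tT'.
apply: cderiv_of_rder => //.
  rewrite !(raddfD, raddfN) /= -!/(rip _ _).
  by rewrite (_ : _ + _ = - rip (Qop t x) (- y') - rip (- x') (Qop t y) - rip (Bstar A Gr x) (Bstar A Gr y)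
    + rip (C (Qop t x)) (C (Qop t y))) // ripNr ripNl !opprK.
have fE : (fun s => complex.Im (ip (Qop s x) y)) = (fun s => rip (Qop s x) ('i%C *: y)).
  by apply: funext => s; rewrite Im_ip.
rewrite fE !(raddfD, raddfN) /= !Im_ip.
have Qb := (Q_sa tT').1.
rewrite -(Bstar_i yy) -(bopZ Cb) -(bopZ Qb).
by rewrite (_ : _ + _ = - rip (Qop t x) ('i%C *: - y') - rip (- x') (Qop t ('i%C *: y)) -
    rip (Bstar A Gr x) (Bstar A Gr ('i%C *: y))
    + rip (C (Qop t x)) (C (Qop t ('i%C *: y)))) // scalerN ripNr ripNl !opprK.
Qed.

(** * Uniqueness for the dual Riccati equation *)

Section Uniqueness.
Variable Q' : R -> Y -> Y.
Hypothesis Q'R : dual_riccati_solution A Gr T C G Q'.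

Definition Q't t x : Y := S (- t) (Q' t (S t x)).

Lemma Q'_sa t : 0 <= t <= T -> self_adjoint_op (Q' t).
Proof. by case: Q'R => h _ _ _; exact: h. Qed.

Lemma Q'_sym t x y : 0 <= t <= T -> rip (Q' t x) y = rip x (Q' t y).
Proof. by move=> /Q'_sa[_ h]; rewrite /rip h. Qed.

Lemma Q't_sym t x y : 0 <= t <= T -> rip (Q't t x) y = rip x (Q't t y).
Proof. by move=> tT; rewrite /Q't SN_radj -S_radj Q'_sym. Qed.

Lemma Q'_bound : exists2 M : R, 0 <= M & forall t x, 0 <= t <= T -> hnorm (Q' t x) <= M * hnorm x.
Proof.
have [M M0 hM] := @uniform_bound R Y Y {t : R | 0 <= t <= T} (fun i => Q' (sval i))
  (fun i => (Q'_sa (svalP i)).1) ltac:(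
   move=> x; have [_ /(_ x)/hcontP/hcont_bounded[M _ h] _ _] := Q'R;
   by exists M => -[t tT]; exact: h).
by exists M => // t x tT; exact: (hM (exist _ t tT)).
Qed.

Lemma Q't_hcont x : hcont 0 T (fun s => Q't s x).
Proof.
have [M M0 hM] := Q'_bound.
apply: hcont_SN; apply: (@hcont_family _ _ _ 0 T Q' (fun t => S t x) M) => //.
- by move=> s /Q'_sa[].
- by move=> z; have [_ /(_ z)/hcontP h _ _] := Q'R.
- exact: hcont_Sx.
Qed.

Lemma Q't_rder x y t b : dom A x -> dom A y -> 0 <= t <= b -> b < T ->
  rder 0 b (fun s => rip (Q't s x) y) t
    (rip (Mt t (Q't t x)) (Q't t y) - rip (Phi x t) (Phi y t)).
Proof.
move=> [x' xx] [y' yy] tb bT; have tT : 0 <= t <= T by lra.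
have bT' : b <= T by lra.
have [M M0 hM] := Q'_bound.
have sb s : 0 <= s <= b -> 0 <= s <= T by lra.
have [_ Qc _ Qd] := Q'R.
have g1 : gadj A (S t x) (- S t x') by apply/gadjA; rewrite opprK; exact: A_S.
have g2 : gadj A (S t y) (- S t y') by apply/gadjA; rewrite opprK; exact: A_S.
have d0 := Qd _ _ _ _ g1 g2 t ltac:(lra).
have {}d0 := cderiv_Re tb bT d0.
have fE : (fun s => rip (Q' s (S s x)) (S s y)) = (fun s => rip (Q't s x) y).
  by apply: funext => s; rewrite /Q't SN_radj.
have h := @prod_rder R Y 0 b t Q' (fun s => S s x) (fun s => S s y)
  (S t x') (S t y') _ M (fun s sB => (Q'_sa (sb s sB)).1) M0 (fun s z sB => hM s z (sb s sB)) _ tb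
  (S_hder t xx) (S_hder t yy) d0.
rewrite fE in h.
have Qcb z : hcont 0 b (fun s => Q' s z).
  by apply: hcontW (_ : hcont 0 T _) => //; apply/hcontP.
have {}h := h (fun z => Qcb z t tb).
rewrite (_ : _ - _ = complex.Re (ip (Q' t (S t x)) (- S t y') + ip (- S t x') (Q' t (S t y)) -
        ip (Bstar A Gr (S t x)) (Bstar A Gr (S t y)) +
        ip (C (Q' t (S t x))) (C (Q' t (S t y)))) + rip (Q' t (S t x')) (S t y) +
   rip (Q' t (S t x)) (S t y')) //.
rewrite !(raddfD, raddfN) /= -!/(rip _ _) Mt_rip /CS /Q't !SKN /Phi ripNl ripNr (Q'_sym (S t x') _ tT).
by clear; atomize; ring.
Qed.

(** Density is used in one argument at a time; the symmetry of the difference exchanges the two. *)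
Lemma diff_dense t K : 0 <= t <= T -> 0 <= K ->
  (forall x y, dom A x -> dom A y -> `|rip (Qt t x - Q't t x) y| <= K * hnorm x * hnorm y) ->
  forall x y, `|rip (Qt t x - Q't t x) y| <= K * hnorm x * hnorm y.
Proof.
move=> tT K0 le.
have sym x y : rip (Qt t x - Q't t x) y = rip (Qt t y - Q't t y) x.
  by rewrite !ripDl !ripNl Qt_sym // Q't_sym // (ripC x) (ripC x).
have le1 y : dom A y -> hnorm (Qt t y - Q't t y) <= K * hnorm y.
  move=> yD; apply: (dense_rip_le domA_dense); first by rewrite mulr_ge0.
  by move=> x xD; apply: le_trans (ler_norm _) _; exact: le.
have le2 x : hnorm (Qt t x - Q't t x) <= K * hnorm x.
  apply: (dense_rip_le domA_dense); first by rewrite mulr_ge0.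
  move=> y yD; rewrite sym; apply: le_trans (rip_leW _ _) _.
  by rewrite mulrAC ler_wpM2r // le1.
by move=> x y; apply: le_trans (rip_le _ _) _; rewrite ler_wpM2r // le2.
Qed.

(** In the difference of the two equations the terms with B^* cancel, and the quadratic terms split
    into two products of the difference with [Qt] or [Q't]. With [c = B / 2 * hnorm x * hnorm y] the
    derivative of [f] is therefore at most [4 * cM * Z * (c * w s)]. As [c * w] decays at a rate at
    least as large, [f + c * w] and [- f + c * w] are nonincreasing, and [f] vanishes at [T]. *)
Lemma unique_step (Z B : R) : 0 <= Z -> 0 <= B ->
  (forall t x, 0 <= t <= T -> hnorm (Qt t x) <= Z * hnorm x) ->
  (forall t x, 0 <= t <= T -> hnorm (Q't t x) <= Z * hnorm x) ->
  let w t := expR (- (4 * cM * Z + 1) * t) in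
  (forall t x y, 0 <= t <= T -> `|rip (Qt t x - Q't t x) y| <= B * w t * hnorm x * hnorm y) ->
  forall t x y, 0 <= t <= T -> `|rip (Qt t x - Q't t x) y| <= B / 2 * w t * hnorm x * hnorm y.
Proof.
move=> Z0 B0 bQ bQ' w IH t x0 y0 tT.
have w0 s : 0 < w s by exact: expR_gt0.
apply: diff_dense => //; first by rewrite !mulr_ge0 // ltW.
move=> x y xD yD {x0 y0}; pose f s := rip (Qt s x - Q't s x) y.
pose lam := 4 * cM * Z + 1; pose c := B / 2 * hnorm x * hnorm y.
have c0 : 0 <= c by rewrite !mulr_ge0.
have fT : f T = 0.
  rewrite /f (_ : Qt T x = Q't T x) ?subrr ?rip0l //.
  have [_ _ E _] := Q_riccati; have [_ _ E' _] := Q'R.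
  by rewrite /Qt /Q't E E'.
have fc : hcont 0 T (fun s => Qt s x - Q't s x) by apply: hcontB; [exact: Qt_hcont|exact: Q't_hcont].
have frc : rcont 0 T f by exact: hcont_ripr.
have wd a b s : rder a b (fun r => c * w r) s (c * (- lam * w s)) by apply: rderZ; exact: rder_expR.
have wc a b : rcont a b (fun r => c * w r) by apply: rder_rcont => s _; exact: wd.
have fd s b : t <= s <= b -> b < T -> exists2 l : R, `|l| <= lam * (c * w s) & rder t b f s l.
  move=> sb bT; have s0b : 0 <= s <= b by lra.
  have sT : 0 <= s <= T by lra.
  have bT' : b <= T by lra.
  have t0 : 0 <= t by lra.
  have d1 := rderW t0 bT' (Qt_rder xD yD sT).
  have d2 := rderW t0 (lexx b) (Q't_rder xD yD s0b bT).
  have := rderD d1 (rderN d2); set l := (X in rder _ _ _ _ X) => d3; exists l.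
    rewrite (_ : l = rip (Qt s x - Q't s x) (Mt s (Qt s y)) + rip (Qt s y - Q't s y) (Mt s (Q't s x))); last first.
      rewrite /l !ripDl !ripNl ![rip _ (Mt _ _)]ripC !Mt_rip.
      by rewrite !(ripC (CS s (Qt s y))) !(ripC (CS s (Q't s x)) (CS s (Q't s y))); clear; atomize; ring.
    have k1 := IH s x (Mt s (Qt s y)) sT; have k2 := IH s y (Mt s (Q't s x)) sT.
    have m1 : hnorm (Mt s (Qt s y)) <= cM * (Z * hnorm y).
      by apply: le_trans (Mt_norm _ _) _; rewrite ler_wpM2l ?cM_ge0 // bQ.
    have m2 : hnorm (Mt s (Q't s x)) <= cM * (Z * hnorm x).
      by apply: le_trans (Mt_norm _ _) _; rewrite ler_wpM2l ?cM_ge0 // bQ'.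
    have k3 : B * w s * hnorm x * hnorm (Mt s (Qt s y)) <= B * w s * hnorm x * (cM * (Z * hnorm y)).
      by rewrite ler_wpM2l // !mulr_ge0 // ltW.
    have k4 : B * w s * hnorm y * hnorm (Mt s (Q't s x)) <= B * w s * hnorm y * (cM * (Z * hnorm x)).
      by rewrite ler_wpM2l // !mulr_ge0 // ltW.
    apply: le_trans (ler_normD _ _) _.
    apply: le_trans (lerD (le_trans k1 k3) (le_trans k2 k4)) _.
    rewrite (_ : _ + _ = 4 * cM * Z * (c * w s)); last by rewrite /c; field.
    by rewrite /lam ler_wpM2r ?lerDl // mulr_ge0 // ltW.
  have -> : f = fun r => rip (Qt r x) y - rip (Q't r x) y.
    by apply: funext => r; rewrite /f ripDl ripNl.
  exact: d3.
have bd b : t < b -> b < T -> `|f t| <= c * w t + `|f b|.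
  move=> tb bT; have t0 : 0 <= t by lra.
  have bT' : b <= T by lra.
  have h1 : f b + c * w b <= f t + c * w t.
    apply: (@rder_le0 R t b (fun r => f r + c * w r)); first exact: ltW.
      by apply: rcontD => //; exact: rcontW frc.
    move=> s sb; have [|l ll dl] := fd s b _ bT; first lra.
    exists (l + c * (- lam * w s)); last exact: rderD.
    by have := ler_norm l; lra.
  have h2 : - f b + c * w b <= - f t + c * w t.
    apply: (@rder_le0 R t b (fun r => - f r + c * w r)); first exact: ltW.
      by apply: rcontD => //; apply: rcontN; exact: rcontW frc.
    move=> s sb; have [|l ll dl] := fd s b _ bT; first lra.
    exists (- l + c * (- lam * w s)); last by apply: rderD => //; exact: rderN.
    by have := ler_norm (- l); rewrite normrN; lra.
  have h3 : 0 <= c * w b by rewrite mulr_ge0 // ltW.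
  have := ler_norm (f b); have := ler_norm (- f b); rewrite normrN ler_norml; lra.
rewrite -/(f t) (_ : B / 2 * w t * _ * _ = c * w t); last by rewrite /c; ring.
have [tlt|tge] := ltP t T; last first.
  have -> : t = T by lra.
  by rewrite fT normr0 mulr_ge0 // ltW.
apply/ler_addgt0Pr => e e0.
have TT : 0 <= T <= T by rewrite (ltW T0) lexx.
have [d d0 hd] := frc T TT e e0.
(* The equation holds only before [T], so the comparison stops at some [b < T] and continuity makes
   [f b] small: the first entry keeps [b] above [t], the second within [d] of [T]. *)
pose b := Num.max ((t + T) / 2) (T - d / 2).
have b1 : t < b by rewrite /b lt_max; apply/orP; left; lra.
have b2 : b < T by rewrite /b gt_max; apply/andP; split; lra.
have b3 : T - d / 2 <= b by rewrite /b le_max lexx orbT.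
apply: le_trans (bd b b1 b2) _; rewrite lerD2l.
have := hd b; rewrite fT subr0 => hd'; apply/ltW/hd'; first lra.
by rewrite ltr0_norm; lra.
Qed.

Lemma riccati_unique t x : 0 <= t <= T -> Q' t x = Qop t x.
Proof.
move=> tT; have [M M0 hM] := Q'_bound.
pose Z := M + cQ; have Z0 : 0 <= Z by rewrite addr_ge0 // cQ_ge0.
have bQ s z : 0 <= s <= T -> hnorm (Qt s z) <= Z * hnorm z.
  by move=> sT; apply: le_trans (Qt_norm _ sT) _; rewrite ler_wpM2r // lerDr.
have bQ' s z : 0 <= s <= T -> hnorm (Q't s z) <= Z * hnorm z.
  move=> sT; rewrite /Q't S_norm; apply: le_trans (hM _ _ sT) _; rewrite S_norm.
  by rewrite ler_wpM2r // lerDl cQ_ge0.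
pose w s := expR (- (4 * cM * Z + 1) * s).
have w0 s : 0 < w s by exact: expR_gt0.
(* [w] decreases, so [w T] is its least value on [[0, T]]; with this [B] the trivial bound [2 * Z]
   on the difference starts the induction. *)
pose B := 2 * Z / w T; have B0 : 0 <= B by rewrite divr_ge0 ?mulr_ge0 // ltW.
have key n : forall s z y, 0 <= s <= T ->
    `|rip (Qt s z - Q't s z) y| <= B / 2 ^+ n * w s * hnorm z * hnorm y.
  elim: n => [|n IH] s z y sT.
    apply: le_trans (rip_le _ _) _; rewrite ler_wpM2r //.
    apply: le_trans (hnorm_add _ _) _; rewrite hnorm_opp.
    apply: le_trans (lerD (bQ s z sT) (bQ' s z sT)) _; rewrite -mulrDl ler_wpM2r //.
    rewrite expr0 divr1 /B mulrAC ler_pdivlMr //.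
    have : w T <= w s.
      have := cM_ge0 => cM0; rewrite /w ler_expR ler_nM2l; first by case/andP: sT.
      by rewrite oppr_lt0 ltr_wpDl // !mulr_ge0.
    by move=> h; rewrite -mulr2n -[Z *+ 2]mulr_natl ler_wpM2l // mulr_ge0.
  rewrite exprS invfM mulrCA mulrC -[2^-1 * _]/(2^-1 * _).
  rewrite (_ : hnorm y * _ = B / 2 ^+ n / 2 * w s * hnorm z * hnorm y); last by ring.
  apply: unique_step => //.
  by rewrite divr_ge0 // exprn_ge0.
have E : Qt t (S (- t) x) - Q't t (S (- t) x) = 0.
  set z := S (- t) x; set v := _ - _.
  apply: rip_eq0; apply/le_anti; rewrite rip_ge0 andbT.
  apply: (@pow2_le0 _ (B * w t * hnorm z * hnorm v)) => n.
  apply: le_trans (ler_norm _) _; apply: le_trans (key n t z v tT) _.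
  by rewrite (_ : _ * hnorm v = B * w t * hnorm z * hnorm v / 2 ^+ n) //; ring.
rewrite Qop_Qt; have := congr1 (S t) E.
rewrite (bopB (S_bop t)) (bop0 (S_bop t)) /Q't !SKN => /eqP.
by rewrite subr_eq0 => /eqP ->.
Qed.

End Uniqueness.

(** * Mild trajectories and B^* *)

Lemma mildP (f z : R -> Y) : hcont 0 T f ->
  is_mild S T f z <->
  forall t, 0 <= t <= T -> z t = S t (z 0 + vint 0 t (fun s => S (- s) (f s))).
Proof.
move=> fc; have key t w : 0 <= t <= T ->
    cintegral (@lebesgue_measure R) `[0, t] (fun s => ip (S (t - s) (f s)) w)
    = ip (S t (vint 0 t (fun s => S (- s) (f s)))) w.
  move=> tT; have t0 : 0 <= t by lra.
  have gc : hcont 0 t (fun s => S (- s) (f s)) by apply: hcont_SN; apply: hcontW fc; lra.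
  rewrite ipE !S_radj !vintE // (bopZ (S_bop (- t))).
  rewrite -!(bopZ (S_bop (- t))); congr (_ +i* _); apply: eq_rI => s _; rewrite ?Im_ip.
    by rewrite S_add -S_radj.
  by rewrite S_add -S_radj.
split => [h t tT|h t tT w].
  by apply: rip_inj => w; rewrite /rip (h t tT w) key // (bopD (S_bop t)) ipDl.
by rewrite (h t tT) key // (bopD (S_bop t)) ipDl.
Qed.

(* Averages of s |-> e^{sA} v over [0, 1/(n+1)], which lie in D(A). *)
Definition Jn (n : nat) v : Y := rscale n.+1%:R (vint 0 (n.+1%:R^-1) (fun s => S s v)).
Definition AJn (n : nat) v : Y := rscale n.+1%:R (S (n.+1%:R^-1) v - v).

Let hn0 (n : nat) : 0 <= n.+1%:R^-1 :> R.
Proof. by rewrite invr_ge0. Qed.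

(** Membership in the graph is tested weakly: against [x] in D(A) the average becomes the integral
    of a derivative, leaving the two boundary terms of [AJn]. *)
Lemma Jn_A n v : A (Jn n v) (AJn n v).
Proof.
apply: A_rchar => x y xy; rewrite /Jn /AJn !ripZr -mulrN; congr (_ * _).
set h := _^-1; rewrite ripC vintE ?hn0 //; last exact: hcont_Sx.
rewrite (@eq_rI _ _ _ _ (fun s => rip (S (- s) y) v)); last first.
  by move=> s _; rewrite ripC SN_radj.
have c1 u : rcont 0 h (fun s => rip (S (- s) u) v) by apply: hcont_ripr; exact: hcont_SNx.
rewrite (@FTC_rder R 0 h (fun s => rip (S (- s) y) v) (fun s => - rip (S (- s) x) v)) ?hn0 //.
- by rewrite oppr0 S0 ripDr ripNr SN_radj; ring.
- exact: rcontN.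
- by move=> t _; rewrite -[X in rder _ _ _ _ X]opprK; apply/rderN/SN_rder.
Qed.

Lemma Jn_norm n v : hnorm (Jn n v) <= hnorm v.
Proof.
rewrite hnorm_scale ger0_norm // mulrC -ler_pdivlMr ?ltr0n //.
have := @vint_norm _ _ 0 _ _ (hnorm v) (hn0 n) (@hcont_Sx _ _ v) (hnorm_ge0 v).
by rewrite subr0; apply => s _; rewrite S_norm.
Qed.

Lemma Jn_bop n : bounded_op (Jn n).
Proof.
split; last by exists 1 => v; rewrite mul1r Jn_norm.
move=> a x y; rewrite /Jn /rscale.
rewrite (_ : (fun s => S s (a *: x + y)) = (fun s => a *: S s x + S s y)); last first.
  by apply/funext => s; rewrite (bopD (S_bop s)) (bopZ (S_bop s)).
have xc := @hcont_Sx 0 (n.+1%:R^-1) x; have yc := @hcont_Sx 0 (n.+1%:R^-1) y.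
rewrite vintD //; last exact: (hcont_op (scale_bop Y a)).
by rewrite -(vint_op (hn0 n) (scale_bop Y a) xc) scalerDr !scalerA mulrC.
Qed.

Lemma AJn_bop n : bounded_op (AJn n).
Proof.
split.
  move=> a x y; rewrite /AJn (bopD (S_bop _)) (bopZ (S_bop _)) /rscale.
  rewrite scalerA mulrC -scalerA -scalerDr; congr (_ *: _).
  by rewrite scalerBr opprD addrACA.
exists (n.+1%:R * 2) => v; rewrite /AJn hnorm_scale ger0_norm // -mulrA ler_wpM2l //.
by apply: le_trans (hnorm_add _ _) _; rewrite S_norm hnorm_opp mulr2n mulrDl mul1r.
Qed.

Lemma Jn_S n t v : Jn n (S t v) = S t (Jn n v).
Proof.
rewrite /Jn (bopZr (S_bop t)); congr rscale.
rewrite (vint_op (hn0 n) (S_bop t)); last exact: hcont_Sx.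
by congr vint; apply/funext => s; rewrite -!S_add addrC.
Qed.

Lemma Jn_lim v e : 0 < e -> exists N, forall n, (N <= n)%N -> hnorm (Jn n v - v) < e.
Proof.
move=> e0; have e2 : 0 < e / 2 by rewrite divr_gt0.
have [d d0 hd] := S_cont v 0 e2.
exists (Num.truncn (d^-1)) => n nN.
have hd' : n.+1%:R^-1 < d.
  rewrite invf_plt ?posrE ?ltr0n //.
  by apply: lt_le_trans (truncnS_gt _) _; rewrite ler_nat ltnS.
have -> : Jn n v - v = rscale n.+1%:R (vint 0 (n.+1%:R^-1) (fun s => S s v - v)).
  rewrite vintD //; [|exact: hcont_Sx|exact: hcont_cst].
  rewrite /rscale scalerDr; congr (_ + _).
  apply: rip_inj => w; rewrite ripZl vintE //; last exact: hcont_cst.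
  by rewrite rI_cst // subr0 mulrC mulfVK // pnatr_eq0.
apply: le_lt_trans (_ : e / 2 < e); last by lra.
rewrite hnorm_scale ger0_norm // mulrC -ler_pdivlMr ?ltr0n //.
have fc : hcont 0 (n.+1%:R^-1) (fun s => S s v - v).
  by apply: hcontB; [exact: hcont_Sx|exact: hcont_cst].
have := @vint_norm _ _ 0 _ _ (e / 2) (hn0 n) fc (ltW e2); rewrite subr0; apply.
move=> s /andP[s0 sh]; have := hd s; rewrite S0 => h; apply/ltW/h.
by rewrite subr0 ger0_norm //; apply: le_lt_trans hd'.
Qed.

(* Locally uniform in t by the equicontinuity of the contractions Jn, hence
   uniform on the compact interval. *)
Lemma Jn_unif (f : R -> Y) : hcont 0 T f -> forall e, 0 < e ->
  exists N, forall n t, (N <= n)%N -> 0 <= t <= T -> hnorm (Jn n (f t) - f t) < e.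
Proof.
move=> fc e e0.
have := (compact_near_coveringP _).1 (@segment_compact R 0 T).
move=> /(_ nat \oo (fun n t => 0 <= t <= T -> hnorm (Jn n (f t) - f t) < e)).
case => [t|N _ hN].
  rewrite /= in_itv /= => tT.
  have e3 : 0 < e / 3 by rewrite divr_gt0.
  have [d d0 hd] := fc t tT _ e3.
  have [N hN] := Jn_lim (f t) e3.
  exists (ball t d, [set n | (N <= n)%N]); first by split; [exact: nbhsx_ballx|exists N].
  move=> [s n] [/= sd nN] sT.
  have h1 := hd s sT; rewrite distrC in h1; have {h1} := h1 sd.
  have h2 := hN n nN; rewrite (_ : _ - f s = (Jn n (f s - f t) + (Jn n (f t) - f t)) - (f s - f t)).
    have h3 := Jn_norm n (f s - f t).
    have := hnorm_add (Jn n (f s - f t)) (Jn n (f t) - f t).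
    have := hnorm_add (Jn n (f s - f t) + (Jn n (f t) - f t)) (- (f s - f t)).
    by rewrite hnorm_opp; lra.
  by rewrite (bopB (Jn_bop n)) addrA subrK opprB addrA subrK.
exists N => n t nN tT; apply: (hN n nN) => //; by rewrite /= in_itv.
Qed.

Lemma hcont_Jn a b n (f : R -> Y) : hcont a b f -> hcont a b (fun t => Jn n (f t)).
Proof. exact: hcont_op (Jn_bop n). Qed.

Lemma hcont_AJn a b n (f : R -> Y) : hcont a b f -> hcont a b (fun t => AJn n (f t)).
Proof. exact: hcont_op (AJn_bop n). Qed.

(** [Phi (u s) s] is B^* along the trajectory whose pull-back is [u]; it is continuous as soon as
    [u] and [A u] are. *)
Lemma Phi_A (u u' : R -> Y) : hcont 0 T u -> hcont 0 T u' ->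
  (forall s, 0 <= s <= T -> A (u s) (u' s)) -> hcont 0 T (fun s => Phi (u s) s).
Proof.
move=> uc u'c uA; apply: (@eq_hcont _ _ _ _ (fun s => hadj Gr (S s (u s + u' s)))).
  by move=> t tT; rewrite (PhiE _ (uA t tT)).
by apply: (hcont_op (hadj_bounded Gb)); apply: hcont_S; apply: hcontD.
Qed.

Lemma vint_Lam p q (v : R -> Y) g : 0 <= p -> p <= q -> q <= T -> hcont p q v -> is_L2 0 T g ->
  rI p q (fun s => rip (v s) (Lam 0 s g)) =
  rip (vint p q v) (Lam 0 p g) + rI p q (fun s => rip (v s) (Lam p s g)).
Proof.
move=> p0 pq qT vc gL.
have lc : hcont p q (fun s => Lam p s g).
  by apply: (@hcontW _ _ p q p T) => //; apply: Lam_cont; [lra|apply: L2W gL].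
have i1 := hcont_intg (Lam 0 p g) vc.
have i2 := rcont_intg (hcont_rip vc lc).
rewrite (vintE _ pq vc) -(rID i1 i2); apply: eq_rI => s /andP[ps sq].
have p0' : (0 : R) <= (0 : R) <= p by rewrite p0 andbT.
have psT : p <= s <= T by rewrite ps (le_trans sq).
rewrite (Lam_split p0' psT) ?ripDr //.
by apply: L2W gL => //; apply: le_trans qT.
Qed.

Lemma abs_rI_Lam p q (v : R -> Y) g M : 0 <= p -> p <= q -> q <= T -> hcont p q v ->
  is_L2 0 T g -> (forall s, p <= s <= q -> hnorm (v s) <= M) ->
  `|rI p q (fun s => rip (v s) (Lam p s g))| <= M * cB * nL2 p q g * (q - p).
Proof.
move=> p0 pq qT vc gL hM; have pT : 0 <= p <= T by rewrite p0 (le_trans pq).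
have gpT : is_L2 p T g by apply: L2W gL.
have gpq : is_L2 p q g by apply: L2W gL.
have lc : hcont p q (fun s => Lam p s g).
  by apply: (@hcontW _ _ p q p T) => //; exact: Lam_cont.
apply: (abs_rI_ub pq); first exact: rcont_intg (hcont_rip vc lc).
move=> s spq; have /andP[ps sq] := spq; have gps : is_L2 p s g by apply: L2W gpq.
apply: le_trans (rip_le _ _) _; rewrite -mulrA.
apply: ler_pM; [exact: hnorm_ge0|exact: hnorm_ge0|exact: hM|].
apply: le_trans (Lam_norm _ _ gps) _; [by rewrite p0|exact: le_trans qT|].
by apply: ler_wpM2l; [exact: cB_ge0|apply: nL2W gpq].
Qed.

(** Formally this integrates the derivative of [rip (u s) (Lam 0 s g)], but [g] is only in L^2 and
    [Lam 0 s g] need not be differentiable. Instead the defect [E] of the identity is shown to have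
    increments of smaller order than the length of the interval; its derivative then vanishes
    everywhere. The Lipschitz bounds on [u] and [u'] make [Phi (u s) s] close to [Phi (u q) s]. *)
Lemma Phi_ibp (u u' v : R -> Y) g K : hcont 0 T v -> hcont 0 T u' -> 0 <= K ->
  (forall s, 0 <= s <= T -> u s = u 0 + vint 0 s v) ->
  (forall s, 0 <= s <= T -> A (u s) (u' s)) ->
  (forall r s, 0 <= r <= s -> s <= T -> hnorm (u s - u r) <= K * (s - r)) ->
  (forall r s, 0 <= r <= s -> s <= T -> hnorm (u' s - u' r) <= K * (s - r)) ->
  is_L2 0 T g ->
  rI 0 T (fun s => rip (Phi (u s) s) (g s)) =
  rip (u T) (Lam 0 T g) - rI 0 T (fun s => rip (v s) (Lam 0 s g)).
Proof.
move=> vc u'c K0 uE uA uK u'K gL.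
have TT : 0 <= T <= T by rewrite (ltW T0) lexx.
have uc : hcont 0 T u.
  have K1 : 0 < K + 1 by rewrite ltr_wpDl.
  move=> s sT e e0; exists (e / (K + 1)); first by rewrite divr_gt0.
  move=> r rT; rewrite ltr_pdivlMr // mulrDr mulr1 => h.
  have := normr_ge0 (r - s) => n0.
  have [rs|sr] := leP r s; [rewrite hnorm_sym; have := @uK r s|have := @uK s r].
    by rewrite distrC (ger0_norm (x := s - r)) ?subr_ge0 // in h n0 => {}H; have := H ltac:(lra) ltac:(lra); lra.
  by rewrite (ger0_norm (x := r - s)) ?subr_ge0 ?ltW // in h n0 => {}H; have := H ltac:(lra) ltac:(lra); lra.
have pc := Phi_A uc u'c uA.
have zT : (0 : R) <= (0 : R) <= T by rewrite (ltW T0) andbT.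
have lc := Lam_cont zT gL.
have pg : intg 0 T (fun s => rip (Phi (u s) s) (g s)) by apply: L2_intg => //; exact: hcont_L2.
have vl : intg 0 T (fun s => rip (v s) (Lam 0 s g)) by apply: rcont_intg; exact: hcont_rip.
pose E r := rI 0 r (fun s => rip (Phi (u s) s) (g s)) - rip (u r) (Lam 0 r g)
   + rI 0 r (fun s => rip (v s) (Lam 0 s g)).
suff : E T = E 0.
  rewrite /E !rI_aa Lam_aa ?lexx ?ltW // rip0r; atomize; lra.
have [M M0 hM] := hcont_bounded vc.
have [L L0 hL] := bop_bound (hadj_bounded Gb).
pose D q s := Phi (u s) s - Phi (u q) s.
have DL p q : 0 <= p -> q <= T -> 0 <= q -> is_L2 p q (D q).
  move=> p0 qT q0; apply: L2B; first by apply: hcont_L2; apply: hcontW pc.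
  by apply: Phi_L2; exists (u' q); apply: uA; rewrite q0.
have Dn p q s : 0 <= p -> q <= T -> p <= s <= q -> hnorm (D q s) <= 2 * L * K * (q - p).
  move=> p0 qT /andP[ps sq].
  have As := uA s ltac:(lra); have Aq := uA q ltac:(lra).
  rewrite /D (PhiE _ As) (PhiE _ Aq) -(bopB (hadj_bounded Gb)) -(bopB (S_bop s)).
  apply: le_trans (hL _) _; rewrite S_norm hnorm_sym opprD addrACA.
  have := uK s q ltac:(lra) qT; have := u'K s q ltac:(lra) qT.
  have := hnorm_add (u q - u s) (u' q - u' s) => h1 h2 h3.
  have h4 : hnorm (u q - u s + (u' q - u' s)) <= 2 * K * (q - p).
    apply: le_trans h1 _; apply: le_trans (lerD h3 h2) _.
    have hk : K * (q - s) <= K * (q - p) by apply: ler_wpM2l => //; lra.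
    by rewrite -mulrA; lra.
  by rewrite (_ : 2 * L * K * (q - p) = L * (2 * K * (q - p))) ?ler_wpM2l //; ring.
(* With [u] frozen at the right end [q], [LamE] absorbs the pairing of [g] with [Phi (u q)], and
   only the error [D q] of freezing remains. *)
have inc p q : 0 <= p -> p <= q -> q <= T -> E q - E p =
    rI p q (fun s => rip (D q s) (g s)) + rI p q (fun s => rip (v s) (Lam p s g)).
  move=> p0 pq qT.
  have gpq : is_L2 p q g by apply: L2W gL.
  have q0 : 0 <= q by lra.
  have g0q : is_L2 0 q g by apply: L2W gL.
  have Aq : dom A (u q) by exists (u' q); apply: uA; lra.
  have vc' : hcont p q v by apply: hcontW vc.
  have uq : u q = u p + vint p q v.
    have v0 : hcont 0 q v by apply: hcontW vc.
    have E1 : vint 0 q v = vint 0 p v + vint p q v by apply: vint_split; rewrite ?p0.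
    have qT' : 0 <= q <= T by rewrite q0.
    have pT' : 0 <= p <= T by rewrite p0 (le_trans pq).
    by rewrite (uE q qT') E1 addrA -(uE p pT').
  have pq0 : (0 : R) <= p <= q by rewrite p0.
  have e1 := @rI_split _ p 0 q _ pq0 (intgW (lexx 0) qT pg).
  have e2 := @rI_split _ p 0 q _ pq0 (intgW (lexx 0) qT vl).
  have p0' : (0 : R) <= (0 : R) <= p by rewrite p0 andbT.
  have pqT : p <= q <= T by rewrite pq.
  have e3 := Lam_split p0' pqT g0q.
  rewrite /E e1 e2 e3.
  rewrite (vint_Lam p0 pq qT vc' gL).
  rewrite ripDr [rip (u q) (Lam p q g)]ripC (LamE _ _ gpq Aq); [|lra|lra].
  rewrite [rip (u q) (Lam 0 p g)](_ : _ = rip (u p) (Lam 0 p g) + rip (vint p q v) (Lam 0 p g)); last by rewrite uq ripDl.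
  rewrite [rI p q (fun s => rip (D q s) (g s))](_ : _ = rI p q (fun s => rip (Phi (u s) s) (g s)) - rI p q (fun s => rip (g s) (Phi (u q) s))).
    by clear; atomize; ring.
  rewrite -rIB; [|by apply: intgW pg|by apply: L2_intg => //; exact: Phi_L2].
  by apply: eq_rI => s _; rewrite /D ripDl ripNl [rip (Phi (u q) s) _]ripC.
(* The factor [T + 1] bounds the square root of [q - p] that arises when the uniform bound on [D q]
   is turned into an L^2 bound. *)
pose c := 2 * L * K * (T + 1) + M * cB.
have T1 : 0 <= T + 1 by rewrite addr_ge0 // ltW.
have k0 : 0 <= 2 * L * K by apply: mulr_ge0 => //; exact: mulr_ge0.
have c0 : 0 <= c by rewrite /c addr_ge0 ?mulr_ge0 ?cB_ge0.
have E' t : 0 <= t <= T -> rder 0 T E t 0.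
  move=> tT; apply: (@rder_of_increment 0 T E (cst 0)) => //.
    by move=> s _ e e0; exists 1 => // r _ _; rewrite subrr normr0.
  move=> e e0; have c1 : 0 < c + 1 by rewrite ltr_wpDl.
  have [d d0 hd] := nL2_small gL tT (divr_gt0 e0 c1).
  exists d => // p q p0 pq qT pt qt.
  have gpq : is_L2 p q g by apply: L2W gL.
  have := hd p q ltac:(lra) ltac:(lra) pq pt qt; rewrite ltr_pdivlMr // mulrDr mulr1.
  set n := nL2 p q g => hn; have n0 : 0 <= n by exact: nL2_ge0.
  rewrite rI_cst // mul0r subr0 inc //.
  have q0 : 0 <= q by lra.
  have DpqL := DL p q p0 qT q0.
  have h1 := L2_CS DpqL gpq.
  have h2 : nL2 p q (D q) <= 2 * L * K * (T + 1) * (q - p).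
    have kk : 0 <= 2 * L * K * (q - p) by rewrite mulr_ge0 // subr_ge0.
    rewrite -(@ler_pXn2r _ 2) ?nnegrE ?nL2_ge0 ?mulr_ge0 ?subr_ge0 // nL2_sqr.
    have hn' := @nsq_ub _ _ p q (D q) (2 * L * K * (q - p)) pq DpqL kk (fun s => @Dn p q s p0 qT).
    apply: le_trans hn' _.
    rewrite (_ : (_ * (T + 1) * _) ^+ 2 = (2 * L * K * (q - p)) ^+ 2 * (T + 1) ^+ 2); last by ring.
    apply: ler_wpM2l; first exact: sqr_ge0.
    have := ltW T0 => T0'; nra.
  have h3 : `|rI p q (fun s => rip (v s) (Lam p s g))| <= M * cB * n * (q - p).
    apply: abs_rI_Lam => //; first by apply: hcontW vc.
    by move=> s /andP[s1 s2]; apply: hM; rewrite (le_trans p0 s1) (le_trans s2).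
  apply: le_trans (ler_normD _ _) _; apply: le_trans (lerD h1 h3) _.
  apply: le_trans (_ : (n * c) * (q - p) <= _); last by rewrite ler_wpM2r ?subr_ge0 //; lra.
  rewrite [leRHS](_ : _ = 2 * L * K * (T + 1) * (q - p) * n + M * cB * n * (q - p)).
    by rewrite lerD2r; apply: ler_wpM2r.
  by rewrite /c; clear; move: (q - p) => ?; ring.
apply: rder_eq0 => //; first exact: ltW.
  by apply: (@rder_rcont _ _ _ _ (cst 0)).
by move=> t /andP[t1 t2]; apply: E'; rewrite !ltW.
Qed.

Lemma vint_lip (f : R -> Y) : hcont 0 T f -> exists2 M : R, 0 <= M &
  forall r s, 0 <= r <= s -> s <= T -> hnorm (vint 0 s f - vint 0 r f) <= M * (s - r).
Proof.
move=> fc; have [M M0 hM] := hcont_bounded fc; exists M => // r s /andP[r0 rs] sT.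
have fs : hcont 0 s f by apply: hcontW fc.
have rs0 : 0 <= r <= s by rewrite r0.
rewrite (vint_split rs0 fs) addrAC subrr add0r.
apply: vint_norm => //; first by apply: hcontW fc.
by move=> t /andP[t1 t2]; apply: hM; rewrite (le_trans r0 t1) (le_trans t2).
Qed.

Lemma vint_hcont (f : R -> Y) z : hcont 0 T f -> hcont 0 T (fun t => z + vint 0 t f).
Proof.
move=> fc; have [K K0 hK] := vint_lip fc.
have K1 : 0 < K + 1 by rewrite ltr_wpDl.
move=> s /andP[s0 sT] e e0; exists (e / (K + 1)); first by rewrite divr_gt0.
move=> r /andP[r0 rT]; rewrite ltr_pdivlMr // mulrDr mulr1 => h.
rewrite opprD addrACA subrr add0r.
have n0 := normr_ge0 (r - s).
have [rs|/ltW sr] := leP r s.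
  have := hK r s; rewrite r0 hnorm_sym => /(_ rs sT).
  rewrite distrC (ger0_norm (x := s - r)) ?subr_ge0 // in h n0; lra.
have := hK s r; rewrite s0 => /(_ sr rT).
rewrite (ger0_norm (x := r - s)) ?subr_ge0 // in h n0; lra.
Qed.

Lemma L2sq_cvg0 (q : nat -> R -> U) : (forall n, is_L2 0 T (q n)) ->
  (forall e : R, 0 < e -> exists N, forall n, (N <= n)%N -> nL2 0 T (q n) < e) ->
  (fun n => L2sq 0 T (q n)) @ \oo --> (0 : \bar R)%E.
Proof.
move=> qL qk; rewrite (_ : (fun n => _) = (fun n => (nsq 0 T (q n))%:E)); last first.
  by apply/funext => n; rewrite L2sq_nsq.
apply: cvg_EFin; first exact: nearW.
apply/cvgrPdist_lt => e e0; have se : 0 < Num.sqrt e by rewrite sqrtr_gt0.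
have [N hN] := qk _ se; exists N => // n /= nN.
rewrite sub0r normrN ger0_norm ?nsq_ge0 // -nL2_sqr.
rewrite -[ltRHS]sqr_sqrtr ?ltW // ltr_pXn2r ?nnegrE ?nL2_ge0 ?sqrtr_ge0 //.
exact: hN.
Qed.

(* The identity satisfied by h determines the limit of B^* along the
   regularised trajectories e^{tA} Jn(e^{-tA} zeta), by duality. *)
Lemma Bstar_along_of (f zeta : R -> Y) h : hcont 0 T f -> is_mild S T f zeta ->
  is_L2 0 T h ->
  (forall g, is_L2 0 T g -> rI 0 T (fun s => rip (h s) (g s)) =
     rip (S (- T) (zeta T)) (Lam 0 T g)
     - rI 0 T (fun s => rip (S (- s) (f s)) (Lam 0 s g))) ->
  is_Bstar_along A S Gr T zeta h.
Proof.
move=> fc /(mildP _ fc) zE hL hE; split => //.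
exists f; split; [by apply/hcontP|by apply/(mildP _ fc)|].
pose ft s := S (- s) (f s); have ftc : hcont 0 T ft by exact: hcont_SN.
pose zt t := zeta 0 + vint 0 t ft.
have ztc : hcont 0 T zt by exact: vint_hcont.
have TT : 0 <= T <= T by rewrite (ltW T0) lexx.
have zT : S (- T) (zeta T) = zt T by rewrite zE // SNK.
have zt0 : zt 0 = zeta 0.
  by rewrite /zt vint_aa ?addr0 //; apply: hcontW ftc => //; exact: ltW.
have ztE n t : 0 <= t <= T -> Jn n (zt t) = Jn n (zeta 0) + vint 0 t (fun s => Jn n (ft s)).
  move=> /andP[t0 tT]; rewrite /zt (bopD (Jn_bop n)) (vint_op t0 (Jn_bop n)) //.
  by apply: hcontW ftc.
pose zn n t := S t (Jn n (zt t)).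
exists (fun n t => Jn n (f t)), (fun n t => AJn n (f t)), zn.
have zn0 n : zn n 0 = Jn n (zeta 0) by rewrite /zn S0 zt0.
split.
- move=> n; split.
  + by rewrite zn0; exists (AJn n (zeta 0)); exact: Jn_A.
  + apply/(mildP _ (hcont_Jn n fc)) => t tT; rewrite zn0 /zn (ztE _ _ tT); congr (S t (_ + _)).
    by congr vint; apply/funext => s; rewrite Jn_S.
  + by apply/hcontP; exact: hcont_Jn.
  + by apply/hcontP; exact: hcont_AJn.
  + by move=> t _; exact: Jn_A.
- apply/hcvgP => e e0; have [N hN] := Jn_lim (zeta 0) e0; exists N => n nN.
  by rewrite zn0; exact: hN.
- by move=> e e0; have [N hN] := Jn_unif fc e0; exists N.
pose q n t := Bstar A Gr (zn n t) - h t.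
have qE n t : q n t = Phi (Jn n (zt t)) t - h t by [].
have PL n : hcont 0 T (fun t => Phi (Jn n (zt t)) t).
  by apply: (Phi_A (hcont_Jn n ztc) (hcont_AJn n ztc)) => t _; exact: Jn_A.
have qL n : is_L2 0 T (q n).
  by apply: (@L2B _ _ 0 T (fun t => Phi (Jn n (zt t)) t) h) => //; exact: (hcont_L2 (PL n)).
apply: (L2sq_cvg0 qL) => e e0.
have [M M0 hM] := vint_lip ftc.
have ztl r s : 0 <= r <= s -> s <= T -> hnorm (zt s - zt r) <= M * (s - r).
  by move=> rs sT; rewrite /zt opprD addrACA subrr add0r; exact: hM.
have T1 : 0 <= 1 + T by rewrite addr_ge0 // ltW.
pose c := cB * (1 + T); have c0 : 0 <= c by rewrite mulr_ge0 ?cB_ge0.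
have c1 : 0 < c + 1 by rewrite ltr_wpDl.
pose e' := e / (c + 1); have e'0 : 0 < e' by rewrite divr_gt0.
have [N1 hN1] := Jn_lim (zt T) e'0; have [N2 hN2] := Jn_unif ftc e'0.
exists (maxn N1 N2) => n; rewrite geq_max => /andP[n1 n2].
apply: (@le_lt_trans _ _ (e' * c)); last first.
  by rewrite /e' mulrAC ltr_pdivrMr // mulrDr mulr1 ltrDl.
(* [K] depends on [n] through the norm of [AJn n]; this is harmless, since it only serves the
   hypotheses of [Phi_ibp] and does not enter the final bound. *)
have [K K0 hK] : exists2 K : R, 0 <= K & forall r s, 0 <= r <= s -> s <= T ->
    hnorm (Jn n (zt s) - Jn n (zt r)) <= K * (s - r) /\
    hnorm (AJn n (zt s) - AJn n (zt r)) <= K * (s - r).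
  have [L L0 hL'] := bop_bound (AJn_bop n).
  exists ((L + 1) * M); first by rewrite mulr_ge0 // addr_ge0.
  move=> r s rs sT; have h1 := ztl r s rs sT.
  have n0 := hnorm_ge0 (zt s - zt r).
  have h2 := ler_wpM2l L0 h1.
  rewrite -(bopB (Jn_bop n)) -(bopB (AJn_bop n)).
  have h3 := Jn_norm n (zt s - zt r); have h4 := hL' (zt s - zt r).
  by split; nra.
have ibp : rI 0 T (fun s => rip (Phi (Jn n (zt s)) s) (q n s)) =
    rip (Jn n (zt T)) (Lam 0 T (q n)) - rI 0 T (fun s => rip (Jn n (ft s)) (Lam 0 s (q n))).
  apply: (@Phi_ibp (fun s => Jn n (zt s)) (fun s => AJn n (zt s)) (fun s => Jn n (ft s)) (q n) K) => //.
  - exact: hcont_Jn.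
  - exact: hcont_AJn.
  - by move=> s sT; rewrite ztE // zt0.
  - by move=> s _; exact: Jn_A.
  - by move=> r s rs sT; case: (hK r s rs sT).
  - by move=> r s rs sT; case: (hK r s rs sT).
set N := nL2 0 T (q n); have N0 : 0 <= N by exact: nL2_ge0.
have Lb s : 0 <= s <= T -> hnorm (Lam 0 s (q n)) <= cB * N.
  move=> /andP[s0 sT]; have L0s : is_L2 0 s (q n) by apply: L2W (qL n).
  have s0' : (0 : R) <= (0 : R) <= s by rewrite s0 andbT.
  apply: le_trans (Lam_norm s0' sT L0s) _.
  by apply: ler_wpM2l; [exact: cB_ge0|apply: nL2W (qL n)].
have zT0 : (0 : R) <= (0 : R) <= T by rewrite (ltW T0) andbT.
have lc := Lam_cont zT0 (qL n).
have fJ := hcont_Jn n ftc.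
have i1 := rcont_intg (hcont_rip fJ lc).
have i2 := rcont_intg (hcont_rip ftc lc).
have i3 := L2_intg (hcont_L2 (PL n)) (qL n).
have i4 := L2_intg hL (qL n).
(* The integration by parts and the identity for [h] are both tested with the error [q n] itself, so
   that each remaining term contains the norm [N] once and one power of it cancels. *)
have E : N ^+ 2 = rip (Jn n (zt T) - zt T) (Lam 0 T (q n)) -
    rI 0 T (fun s => rip (Jn n (ft s) - ft s) (Lam 0 s (q n))).
  rewrite nL2_sqr /nsq.
  have -> : rI 0 T (fun r => rip (q n r) (q n r)) =
     rI 0 T (fun s => rip (Phi (Jn n (zt s)) s) (q n s)) - rI 0 T (fun s => rip (h s) (q n s)).
    by rewrite -(rIB i3 i4); apply: eq_rI => s _; rewrite {1}qE ripDl ripNl.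
  have -> : rI 0 T (fun s => rip (Jn n (ft s) - ft s) (Lam 0 s (q n))) =
     rI 0 T (fun s => rip (Jn n (ft s)) (Lam 0 s (q n))) - rI 0 T (fun s => rip (ft s) (Lam 0 s (q n))).
    by rewrite -(rIB i1 i2); apply: eq_rI => s _; rewrite ripDl ripNl.
  rewrite ibp (hE _ (qL n)) zT ripDl ripNl /ft; clear; atomize; ring.
have h1 : rip (Jn n (zt T) - zt T) (Lam 0 T (q n)) <= e' * (cB * N).
  apply: le_trans (rip_leW _ _) _; apply: ler_pM; [exact: hnorm_ge0|exact: hnorm_ge0|exact/ltW/hN1|exact: Lb].
have h2 : `|rI 0 T (fun s => rip (Jn n (ft s) - ft s) (Lam 0 s (q n)))| <= e' * (cB * N) * (T - 0).
  apply: abs_rI_ub; [exact: ltW|by apply: rcont_intg; apply: hcont_rip => //; exact: hcontB|].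
  move=> s sT; apply: le_trans (rip_le _ _) _.
  by apply: ler_pM; [exact: hnorm_ge0|exact: hnorm_ge0|exact/ltW/hN2|exact: Lb].
have h3 : N ^+ 2 <= e' * c * N.
  rewrite E; move: h2; rewrite ler_norml subr0 => /andP[h2 _].
  rewrite (_ : e' * c * N = e' * (cB * N) + e' * (cB * N) * T); first by lra.
  by rewrite /c; ring.
have [->|Nn] := eqVneq N 0; first by rewrite mulr_ge0 // ltW.
by rewrite -(ler_pM2r (x := N)) ?lt_def ?Nn // -expr2.
Qed.

Lemma gronwall0 (d k : R -> Y) (L : R) : 0 <= L -> hcont 0 T d -> hcont 0 T k ->
  (forall t, 0 <= t <= T -> d t = vint 0 t k) ->
  (forall t, 0 <= t <= T -> hnorm (k t) <= L * hnorm (d t)) ->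
  forall t, 0 <= t <= T -> d t = 0.
Proof.
move=> L0 dc kc dE kL; have [B B0 hB] := hcont_bounded dc.
(* Since [L / l <= 1 / 2], each pass through the integral equation halves the constant in front of
   the weight [expR (l * t)]. *)
pose l := 2 * L + 1; have l0 : 0 < l by rewrite ltr_wpDl // mulr_ge0.
have e1 t : 0 <= t -> 1 <= expR (l * t).
  by move=> t0; rewrite -expR0 ler_expR mulr_ge0 // ltW.
have key n : forall t, 0 <= t <= T -> hnorm (d t) <= B / 2 ^+ n * expR (l * t).
  elim: n => [|n IH] t tT; have /andP[t0 tT'] := tT.
    rewrite expr0 divr1; apply: le_trans (hB t tT) _.
    by rewrite ler_peMr // e1.
  have b0 : 0 <= B / 2 ^+ n by rewrite divr_ge0 // exprn_ge0.
  have kt : hcont 0 t k by apply: hcontW kc.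
  rewrite dE //; apply: hnorm_dual; first by rewrite mulr_ge0 ?expR_ge0 // divr_ge0 // exprn_ge0.
  move=> w; have w0 := hnorm_ge0 w; rewrite (vintE _ t0 kt).
  pose m := B / 2 ^+ n / 2 * hnorm w.
  have m0 : 0 <= m by rewrite mulr_ge0 // divr_ge0.
  have ec : rcont 0 t (fun s => l * expR (l * s)).
    apply: (@rder_rcont _ _ _ _ (fun s => l * (l * expR (l * s)))) => s _.
    by apply: rderZ; exact: rder_expR.
  apply: (@le_trans _ _ (rI 0 t (fun s => m * (l * expR (l * s))))).
    apply: le_rI; [exact: hcont_intg|by apply: intgZ; exact: rcont_intg|].
    move=> s st; have sT : 0 <= s <= T by lra.
    apply: le_trans (rip_leW _ _) _.
    rewrite (_ : m * _ = (B / 2 ^+ n * expR (l * s)) * (l / 2) * hnorm w); last first.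
      by rewrite /m; ring.
    apply: ler_wpM2r => //; apply: le_trans (kL s sT) _.
    have := IH s sT; have := hnorm_ge0 (d s) => h1 h2.
    apply: (@le_trans _ _ (L * (B / 2 ^+ n * expR (l * s)))); first exact: ler_wpM2l.
    by rewrite mulrC; apply: ler_wpM2l; [exact: le_trans h2|rewrite /l; lra].
  rewrite rIZ; last exact: rcont_intg.
  rewrite rI_expR // mulr0 expR0 exprS invfM.
  rewrite (_ : B * _ * _ * _ = m * expR (l * t)); last by rewrite /m; ring.
  by apply: ler_wpM2l => //; lra.
move=> t tT; apply: hnorm_eq0; apply/le_anti; rewrite hnorm_ge0 andbT.
apply: (@pow2_le0 _ (B * expR (l * t))) => n.
by apply: le_trans (key n t tT) _; rewrite mulrAC.
Qed.

(** [zeta] and [f] are prescribed on [[0, T]] only, so that the result applies alike to P y, to any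
    solution [z] of the system in (b) and to the free orbits in (c). *)
Lemma opt_Bstar x g (zeta f : R -> Y) : opt 0 x g ->
  (forall t, 0 <= t <= T -> zeta t = S t (pt 0 x g t)) ->
  (forall t, 0 <= t <= T -> f t = - hadj C (C (S t (yt 0 x g t)))) ->
  [/\ hcont 0 T f, is_mild S T f zeta & is_Bstar_along A S Gr T zeta (fun t => - g t)].
Proof.
move=> og zE fE; have gL : is_L2 0 T g by case: og.
have zT0 : (0 : R) <= (0 : R) <= T by rewrite (ltW T0) andbT.
have TT : 0 <= T <= T by rewrite (ltW T0) lexx.
have yc : hcont 0 T (fun t => S t (yt 0 x g t)) by apply: hcont_S; exact: hcont_yt.
have fc : hcont 0 T f.
  apply: (@eq_hcont _ _ _ _ (fun t => - hadj C (C (S t (yt 0 x g t))))).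
    by move=> t tT; rewrite fE.
  by apply: hcontN; apply: (hcont_op (hadj_bounded Cb)); exact: hcont_op.
have fM s : 0 <= s <= T -> S (- s) (f s) = - Mt s (yt 0 x g s).
  by move=> sT; rewrite fE // (bopN (S_bop _)).
have Mc : hcont 0 T (fun r => Mt r (yt 0 x g r)) by apply: hcont_Myt gL; [rewrite lexx|exact: ltW].
have fm : is_mild S T f zeta.
  apply/(mildP _ fc) => t tT; rewrite !zE // S0; congr (S t _).
  have /andP[t0 tT'] := tT.
  have t00 : (0 : R) <= (0 : R) <= 0 by rewrite lexx.
  rewrite (pt_split x t00 tT gL).
  rewrite addrAC -[LHS]add0r; congr (_ + _).
  apply: rip_inj => w; rewrite rip0l ripDl.
  have Mt' : hcont 0 t (fun r => Mt r (yt 0 x g r)) by apply: hcontW Mc.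
  have ft' : hcont 0 t (fun s => S (- s) (f s)) by apply: hcont_SN; apply: hcontW fc.
  rewrite (vintE _ t0 Mt') (vintE _ t0 ft').
  rewrite (@eq_rI _ _ _ (fun s => rip (S (- s) (f s)) w) (fun s => - rip (Mt s (yt 0 x g s)) w)).
    by rewrite rIN ?subrr //; exact: hcont_intg.
  by move=> s st; rewrite fM ?ripNl //; lra.
split => //; apply: (Bstar_along_of fc fm); first exact: L2N.
move=> gam gamL; rewrite zE // SNK.
have t00 : (0 : R) <= (0 : R) <= (0 : R) by rewrite lexx.
(* Taken over the whole of [[0, T]], the Euler-Lagrange identity is the duality relation that
   [Bstar_along_of] asks for. *)
have := opt_EL t00 TT og gamL.
rewrite (@eq_rI _ _ _ (fun s => rip (S (- s) (f s)) (Lam 0 s gam))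
   (fun s => - rip (Mt s (yt 0 x g s)) (Lam 0 s gam))); last first.
  by move=> s sT; rewrite fM // ripNl.
rewrite (rIN (rcont_intg (hcont_rip Mc (Lam_cont zT0 gamL)))).
rewrite (@eq_rI _ _ _ (fun s => rip (- g s) (gam s)) (fun s => - rip (g s) (gam s))); last first.
  by move=> s _; rewrite ripNl.
rewrite (rIN (L2_intg gL gamL)).
by rewrite -addrA => /eqP; rewrite addr_eq0 => /eqP ->; rewrite !opprK addrC.
Qed.

(** * Representation of the optimal pair *)

Lemma optimal_pair0 y0 g (y : R -> Y) : optimal_pair A S Gr T C G 0 y0 g y ->
  opt 0 y0 g /\ forall r, 0 <= r <= T -> y r = S r (yt 0 y0 g r).
Proof.
move=> /opt_of_pair -/(_ _)[|og yE].
  by rewrite lexx ltW.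
by rewrite oppr0 S0 in og yE.
Qed.

Lemma opt_P y0 g t : opt 0 y0 g -> 0 <= t <= T ->
  P t (S t (yt 0 y0 g t)) = S t (pt 0 y0 g t).
Proof.
move=> og /andP[t0 tT]; rewrite -(opt_pt _ tT og) ?lexx ?t0 //.
by rewrite /Pt SKN.
Qed.

Lemma optimal_pair_P y0 g (y : R -> Y) : optimal_pair A S Gr T C G 0 y0 g y ->
  is_Bstar_along A S Gr T (fun t => P t (y t)) (fun t => - g t).
Proof.
move=> /optimal_pair0[og yE].
have [] // := @opt_Bstar y0 g (fun t => P t (y t)) (fun t => - hadj C (C (S t (yt 0 y0 g t)))) og _ _.
by move=> t tT; rewrite yE // opt_P.
Qed.

Lemma opinvQ t x : 0 <= t <= T -> opinv (Qop t) x = P t x.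
Proof.
move=> tT; rewrite -{1}(QP x tT) opinvK //.
by move=> u v uv; rewrite -(PQ u tT) uv PQ.
Qed.

Lemma Q_iso t : 0 <= t <= T -> isomorphism (Qop t).
Proof.
move=> tT; have [Qb _] := Q_sa tT; have [Pb _] := P_sa tT.
by split => //; exists (P t) => //; split => x; [exact: PQ|exact: QP].
Qed.

Definition mild_z y0 (z : R -> Y) :=
  [/\ hcontinuous_on `[0, T] z, z 0 = opinv (Qop 0) y0
    & is_mild S T (fun t => - hadj C (C (Qop t (z t)))) z].

Lemma opt_yQ0 y0 g t : opt 0 y0 g -> 0 <= t <= T ->
  Qop t (S t (pt 0 y0 g t)) = S t (yt 0 y0 g t).
Proof.
move=> og tT; have /andP[t0 tT'] := tT.
by rewrite (@opt_yQ 0 y0 g t) ?lexx // Qop_Qt SNK.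
Qed.

Lemma mild_z_opt y0 g : opt 0 y0 g -> mild_z y0 (fun t => S t (pt 0 y0 g t)).
Proof.
move=> og; have gL : is_L2 0 T g by case: og.
have zT0 : (0 : R) <= (0 : R) <= T by rewrite (ltW T0) andbT.
have [] // := @opt_Bstar y0 g (fun t => S t (pt 0 y0 g t))
  (fun t => - hadj C (C (Qop t (S t (pt 0 y0 g t))))) og _ _.
  by move=> t tT; rewrite opt_yQ0.
move=> fc fm _; split => //; last first.
  by rewrite opinvQ // -opt_P // yt_start // !S0.
move/(mildP _ fc): fm => zE.
apply/hcontP; apply: (@eq_hcont _ _ _ _ (fun t => S t (S 0 (pt 0 y0 g 0) + vint 0 t (fun s => S (- s) (- hadj C (C (Qop s (S s (pt 0 y0 g s))))))))).
  by move=> t tT; symmetry; exact: zE.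
by apply: hcont_S; apply: vint_hcont; exact: hcont_SN.
Qed.

Lemma hcont_Qop (f : R -> Y) : hcont 0 T f -> hcont 0 T (fun t => Qop t (f t)).
Proof.
move=> fc; apply: (@hcont_family _ _ _ 0 T Qop f cQ) => //.
- by move=> s sT; case: (Q_sa sT).
- by move=> s x sT; case: cQP => _; apply.
- by move=> x s sT; exact: Qop_hcont.
Qed.

Lemma mild_z_hcont y0 (z : R -> Y) : mild_z y0 z -> hcont 0 T (fun t => - hadj C (C (Qop t (z t)))).
Proof.
move=> [/hcontP zc _ _]; apply: hcontN; apply: (hcont_op (hadj_bounded Cb)).
by apply: hcont_op => //; exact: hcont_Qop.
Qed.

Lemma mild_z_unique y0 (z1 z2 : R -> Y) : mild_z y0 z1 -> mild_z y0 z2 ->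
  forall t, 0 <= t <= T -> z1 t = z2 t.
Proof.
move=> m1 m2; have f1c := mild_z_hcont m1; have f2c := mild_z_hcont m2.
case: m1 => /hcontP z1c z10 /(mildP _ f1c) z1E.
case: m2 => /hcontP z2c z20 /(mildP _ f2c) z2E.
have Db : bounded_op (fun v => hadj C (C v)) by apply: (comp_bounded Cb (hadj_bounded Cb)).
have [M M0 hM] := bop_bound Db.
pose D s v := S (- s) (- hadj C (C (Qop s v))).
have c1 : hcont 0 T (fun s => D s (z1 s)) by exact: hcont_SN.
have c2 : hcont 0 T (fun s => D s (z2 s)) by exact: hcont_SN.
have DB s : 0 <= s <= T -> D s (z1 s) - D s (z2 s) = - S (- s) (hadj C (C (Qop s (z1 s - z2 s)))).
  move=> sT; have [Qb _] := Q_sa sT.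
  rewrite /D (bopB Qb) (bopB Cb) (bopB (hadj_bounded Cb)) (bopB (S_bop _)) !(bopN (S_bop _)).
  by rewrite opprB opprK addrC.
have d0 : forall t, 0 <= t <= T -> S (- t) (z1 t - z2 t) = 0.
  apply: (@gronwall0 _ (fun s => D s (z1 s) - D s (z2 s)) (M * cQ)).
  - by rewrite mulr_ge0 ?cQ_ge0.
  - by apply: hcont_SN; exact: hcontB.
  - exact: hcontB.
  - move=> t tT; have /andP[t0 tT'] := tT.
    have e1 : S (- t) (z1 t) = z1 0 + vint 0 t (fun s => D s (z1 s)).
      exact: (etrans (congr1 (S (- t)) (z1E t tT)) (SNK _ _)).
    have e2 : S (- t) (z2 t) = z2 0 + vint 0 t (fun s => D s (z2 s)).
      exact: (etrans (congr1 (S (- t)) (z2E t tT)) (SNK _ _)).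
    rewrite (bopB (S_bop _)) e1 e2 z10 z20 opprD addrACA subrr add0r.
    have c1' : hcont 0 t (fun s => D s (z1 s)) by apply: hcontW c1.
    have c2' : hcont 0 t (fun s => D s (z2 s)) by apply: hcontW c2.
    rewrite vintD //; last exact: hcontN.
    congr (_ + _); apply: rip_inj => w.
    rewrite ripNl (vintE _ t0 c2') (vintE _ t0 (hcontN c2')).
    rewrite -(rIN (hcont_intg w c2')); apply: eq_rI => s _; by rewrite ripNl.
  - move=> t tT; rewrite DB // hnorm_opp !S_norm; apply: le_trans (hM _) _.
    by rewrite -mulrA; apply: ler_wpM2l => //; case: cQP => _; apply.
move=> t tT; have := congr1 (S t) (d0 t tT).
by rewrite SKN (bop0 (S_bop t)) => /eqP; rewrite subr_eq0 => /eqP.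
Qed.

Lemma optimal_pair_z y0 g (y z : R -> Y) : optimal_pair A S Gr T C G 0 y0 g y ->
  mild_z y0 z ->
  is_Bstar_along A S Gr T z (fun t => - g t) /\
  forall t, 0 <= t <= T -> y t = Qop t (z t).
Proof.
move=> /optimal_pair0[og yE] mz.
have zE t : 0 <= t <= T -> z t = S t (pt 0 y0 g t).
  by move=> tT; exact: (mild_z_unique mz (mild_z_opt og) tT).
split; last by move=> t tT; rewrite zE // opt_yQ0 // yE.
by have [] // := @opt_Bstar y0 g z (fun t => - hadj C (C (S t (yt 0 y0 g t)))) og zE _.
Qed.

(** * The case C = 0 and G = I *)

Section ZeroCost.
Hypotheses (C0 : forall x, C x = 0) (Gid : forall x, G x = x).

Lemma hadjC0 x : hadj C (C x) = 0.
Proof. by rewrite C0 (bop0 (hadj_bounded Cb)). Qed.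

Lemma Mt0 r x : Mt r x = 0.
Proof. by rewrite /Mt hadjC0 (bop0 (S_bop _)). Qed.

Lemma Nt_id x : Nt x = x.
Proof. by apply: rip_inj => w; rewrite Nt_rip /GS !Gid S_rip. Qed.

Lemma pt_id t x g s : s <= T -> pt t x g s = yt t x g T.
Proof. by move=> sT; rewrite /pt Nt_id vint0 ?add0r // => r; exact: Mt0. Qed.

(** Without running cost the adjoint state is constant, and the Euler-Lagrange identity on [[t, T]]
    identifies [- g] as the function representing [rip z (Lam t T gam)]. This extends [Phi z] to
    every [z] in [Y]. *)
Lemma free_opt t z g : 0 <= t <= T -> opt t (Qt t z) g ->
  (forall s, s <= T -> pt t (Qt t z) g s = z) /\
  (forall gam, is_L2 t T gam ->
     rI t T (fun r => rip (g r) (gam r)) = - rip z (Lam t T gam)).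
Proof.
move=> tT og; have /andP[t0 tT'] := tT.
have pz s : s <= T -> pt t (Qt t z) g s = z.
  by move=> sT; rewrite pt_id // -[RHS](traj_p_start tT og) [RHS]pt_id.
split=> // gam gamL.
have tt : 0 <= t <= t by rewrite t0 lexx.
have TT : t <= T <= T by rewrite tT' lexx.
have := opt_EL tt TT og gamL.
have -> : rI t T (fun r => rip (Mt r (yt t (Qt t z) g r)) (Lam t r gam)) = 0.
  rewrite (@eq_rI _ t T _ (cst 0)) ?rI_cst ?mul0r // => r _; by rewrite Mt0 rip0l.
by rewrite pz // addr0 => /eqP; rewrite addr_eq0 => /eqP.
Qed.

Lemma Qt_dom t z : 0 <= t <= T -> dom A z ->
  rip (Qt t z) z = rip z z + nsq t T (Phi z).
Proof.
move=> tT zA; have /andP[t0 tT'] := tT.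
have [g og] := opt_ex (Qt t z) tT; have gL : is_L2 t T g by case: og.
have [pz EL] := free_opt tT og.
have E : Qt t z = z - Lam t T g.
  by rewrite -[X in X - _](pz T (lexx T)) pt_id // addrK.
have tt : 0 <= t <= T by rewrite t0.
rewrite E ripDl ripNl (LamE tt (lexx T) gL zA) (EL _ (Phi_L2 t T zA)) opprK.
by congr (_ + _); rewrite ripC (LamE tt (lexx T) (Phi_L2 t T zA) zA).
Qed.

Lemma PhiS_shift t x r : Phi (S (- t) x) r = Phi x (r - t).
Proof. by rewrite /Phi -S_add. Qed.

Lemma nsq_shift t h : 0 <= t <= T -> is_L2 0 T h ->
  L2sq t T (fun r => h (r - t)) = (nsq 0 (T - t) h)%:E.
Proof.
move=> /andP[t0 tT] hL.
have hL' : is_L2 0 (T - t) h by apply: L2W hL => //; lra.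
rewrite -(L2sq_nsq hL') !L2sqE.
have := @integral_shift R 0 (T - t) t (fun r => (rip (h r) (h r))%:E).
rewrite add0r subrK; apply; last by move=> r; rewrite lee_fin rip_ge0.
by apply/measurable_EFinP; apply: measurable_rip => //; case: hL'.
Qed.

Lemma Qop_dom t x : 0 <= t <= T -> dom A x ->
  rip (Qop t x) x = rip x x + nsq 0 (T - t) (Phi x).
Proof.
move=> tT [x' xA]; have zA : dom A (S (- t) x) by exists (S (- t) x'); exact: A_S.
rewrite Qop_Qt S_radj (Qt_dom tT zA) S_rip; congr (_ + _).
have xD : dom A x by exists x'.
have e1 := L2sq_nsq (Phi_L2 t T zA); have e2 := nsq_shift tT (Phi_L2 0 T xD).
have e3 : Phi (S (- t) x) = (fun r => Phi x (r - t)) by apply/funext => r; exact: PhiS_shift.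
exact: (EFin_inj (etrans (etrans (esym e1) (congr1 _ e3)) e2)).
Qed.

(** For [z] in D(A) near [x], the error [k = h - Phi z] represents the functional attached to
    [x - z]. Tested with itself it has norm at most [cB * hnorm (x - z)], so both sides of the
    formula at [x] are close to those at [z], given by [Qop_dom]. *)
Lemma Qop_quad t x h : 0 <= t <= T -> is_L2 0 T h ->
  (forall gam, is_L2 0 T gam -> rI 0 T (fun r => rip (h r) (gam r)) = rip x (Lam 0 T gam)) ->
  rip (Qop t x) x = rip x x + nsq 0 (T - t) h.
Proof.
move=> tT hL hE; have /andP[t0 tT'] := tT.
have Tt : 0 <= T - t by rewrite subr_ge0.
have TtT : T - t <= T by lra.
pose N := hnorm x; have N0 : 0 <= N by exact: hnorm_ge0.
have B0 := cB_ge0; have Q0 := cQ_ge0.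
(* The three summands multiply [d] in the errors of the quadratic form of [Qop t] minus the
   identity, of the mixed integral and of [nsq 0 (T - t) k]. They use [hnorm z <= N + 1] and
   [d * d <= d], which the 1 in the minimum below secures. *)
pose K := (cQ + 1) * (2 * N + 1) + 2 * cB ^+ 2 * (N + 1) + cB ^+ 2.
have K0 : 0 <= K.
  by rewrite /K; apply: addr_ge0; [apply: addr_ge0; apply: mulr_ge0; nra|exact: sqr_ge0].
apply/eqP; rewrite -subr_eq0 -normr_eq0; apply/eqP/le_anti; rewrite normr_ge0 andbT.
apply/ler_addgt0Pr => e e0; rewrite add0r.
have K1 : 0 < K + 1 by rewrite ltr_wpDl.
have d0 : 0 < Num.min 1 (e / (K + 1)) by rewrite lt_min ltr01 divr_gt0.
have [z zA] := dense_near x domA_dense d0.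
rewrite lt_min ltr_pdivlMr // => /andP[d1 d2].
pose w := x - z; pose d := hnorm w; have dd0 : 0 <= d by exact: hnorm_ge0.
have dE : hnorm (z - x) = d by rewrite hnorm_sym.
rewrite dE in d1 d2.
have zN : hnorm z <= N + 1.
  have := hnorm_add (z - x) x; rewrite subrK dE -/N; lra.
pose k r := h r - Phi z r.
have PL := Phi_L2 0 T zA.
have kL : is_L2 0 T k by exact: L2B.
have zT0 : (0 : R) <= (0 : R) <= T by rewrite (ltW T0) andbT.
have kE : nsq 0 T k = rip w (Lam 0 T k).
  rewrite /nsq (@eq_rI _ _ _ _ (fun r => rip (h r) (k r) - rip (Phi z r) (k r))); last first.
    by move=> r _; rewrite {1}/k ripDl ripNl.
  rewrite (rIB (L2_intg hL kL) (L2_intg PL kL)) hE // /w ripDl ripNl; congr (_ - _).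
  rewrite [RHS]ripC (LamE zT0 (lexx T) kL zA); apply: eq_rI => r _; exact: ripC.
have kn : nL2 0 T k <= cB * d.
  have n0 := nL2_ge0 0 T k.
  have h1 : nL2 0 T k ^+ 2 <= cB * d * nL2 0 T k.
    rewrite nL2_sqr kE; apply: le_trans (rip_leW _ _) _; rewrite -/d.
    have := ler_wpM2l dd0 (Lam_norm zT0 (lexx T) kL); lra.
  have [->|Nn] := eqVneq (nL2 0 T k) 0; first by rewrite mulr_ge0.
  by rewrite -(ler_pM2r (x := nL2 0 T k)) ?lt_def ?Nn // -expr2.
have PL' : is_L2 0 (T - t) (Phi z) by exact: L2W PL.
have kL' : is_L2 0 (T - t) k by exact: L2W kL.
have kn' : nL2 0 (T - t) k <= cB * d by apply: le_trans kn; apply: nL2W kL.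
have pn' : nL2 0 (T - t) (Phi z) <= cB * (N + 1).
  apply: le_trans (Phi_le _ _ zA) _ => //; first by rewrite lexx.
  exact: ler_wpM2l.
have E : nsq 0 (T - t) h = nsq 0 (T - t) (Phi z)
    + (2 * rI 0 (T - t) (fun r => rip (Phi z r) (k r)) + nsq 0 (T - t) k).
  have i1 := L2_intg PL' PL'; have i2 := L2_intg PL' kL'; have i3 := L2_intg kL' kL'.
  rewrite /nsq -(rIZ 2 i2) -(rID (intgZ 2 i2) i3) -(rID i1 (intgD (intgZ 2 i2) i3)).
  apply: eq_rI => r _; rewrite (_ : h r = Phi z r + k r); last by rewrite addrC subrK.
  move: (Phi z r) (k r) => a b.
  by rewrite ripDl !ripDr [rip b a]ripC; clear; atomize; ring.
have c1 : `|rI 0 (T - t) (fun r => rip (Phi z r) (k r))| <= cB * (N + 1) * (cB * d).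
  by apply: le_trans (L2_CS PL' kL') _; apply: ler_pM; rewrite ?nL2_ge0.
have c2 : nsq 0 (T - t) k <= (cB * d) ^+ 2.
  by rewrite -nL2_sqr ler_pXn2r ?nnegrE ?nL2_ge0 ?mulr_ge0.
have c3 := nsq_ge0 0 (T - t) k.
pose F u := rip (Qop t u) u - rip u u.
have Qb : bounded_op (Qop t) by case: (Q_sa tT).
have F1 : F x - F z = rip (Qop t w) x + rip (Qop t z) w - rip w x - rip z w.
  by rewrite /F /w (bopB Qb) !(ripDl, ripDr, ripNl, ripNr); clear; atomize; ring.
have Qn u : hnorm (Qop t u) <= cQ * hnorm u by case: cQP => _; apply.
have F2 : `|F x - F z| <= (cQ + 1) * (2 * N + 1) * d.
  rewrite F1.
  have a1 : `|rip (Qop t w) x| <= cQ * d * N.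
    by apply: le_trans (rip_le _ _) _; apply: ler_wpM2r => //; exact: Qn.
  have a2 : `|rip (Qop t z) w| <= cQ * (N + 1) * d.
    apply: le_trans (rip_le _ _) _; apply: ler_wpM2r => //.
    by apply: le_trans (Qn z) _; exact: ler_wpM2l.
  have a3 : `|rip w x| <= d * N by exact: rip_le.
  have a4 : `|rip z w| <= (N + 1) * d.
    by apply: le_trans (rip_le _ _) _; exact: ler_wpM2r.
  have b1 := ler_normB (rip (Qop t w) x + rip (Qop t z) w - rip w x) (rip z w).
  have b2 := ler_normB (rip (Qop t w) x + rip (Qop t z) w) (rip w x).
  have b3 := ler_normD (rip (Qop t w) x) (rip (Qop t z) w).
  rewrite (_ : (cQ + 1) * (2 * N + 1) * d = cQ * d * N + cQ * (N + 1) * d + d * N + (N + 1) * d); last by ring.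
  lra.
have Fz : F z = nsq 0 (T - t) (Phi z) by rewrite /F (Qop_dom tT zA) addrC addKr.
rewrite (_ : rip (Qop t x) x - (rip x x + nsq 0 (T - t) h) =
  (F x - F z) - 2 * rI 0 (T - t) (fun r => rip (Phi z r) (k r)) - nsq 0 (T - t) k); last first.
  by rewrite Fz E /F; clear; atomize; ring.
apply: (@le_trans _ _ (K * d)); last by lra.
apply: le_trans (ler_normB _ _) _; rewrite [`|nsq _ _ _|]ger0_norm //.
apply: le_trans (lerD (ler_normB _ _) (lexx _)) _.
rewrite normrM ger0_norm //.
apply: le_trans (lerD (lerD F2 (ler_wpM2l _ c1)) c2) _ => //.
rewrite (_ : (cB * d) ^+ 2 = cB ^+ 2 * d * d); last by ring.
have : cB ^+ 2 * d * d <= cB ^+ 2 * d.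
  by apply: ler_piMr; [apply: mulr_ge0 => //; exact: sqr_ge0|exact: ltW].
rewrite (_ : K * d = (cQ + 1) * (2 * N + 1) * d + 2 * (cB * (N + 1) * (cB * d)) + cB ^+ 2 * d).
  by rewrite lerD2l.
by rewrite /K; clear; move: d => ?; move: N => ?; ring.
Qed.

Lemma free_mild v : is_mild S T (fun=> 0) (fun t => S t v).
Proof.
have c0 : hcont 0 T (fun=> 0 : Y) by exact: hcont_cst.
apply/(mildP _ c0) => t /andP[t0 _]; rewrite S0 vint0 ?addr0 // => r.
exact: (bop0 (S_bop _)).
Qed.

Lemma free_mild_z y0 : mild_z y0 (fun t => S t (opinv (Qop 0) y0)).
Proof.
split; [by apply/hcontP; exact: hcont_Sx|by rewrite S0|].
rewrite (_ : (fun t => _) = (fun=> 0)); first exact: free_mild.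
by apply/funext => t; rewrite hadjC0 oppr0.
Qed.

Lemma hadj_SS t x : hadj (S t) (S t x) = x.
Proof. by rewrite hadj_S SNK. Qed.

(** The group being unitary, the last term of the formula is the identity, so [W] can only be
    [Qop t] minus the identity; its quadratic form is then given by [Qop_quad]. *)
Lemma gramian t : 0 <= t <= T ->
  exists2 W : Y -> Y,
    self_adjoint_op W /\
    (forall x, exists2 h, is_Bstar_along A S Gr T (S^~ x) h &
       (complex.Re (ip (W x) x))%:E = L2sq t T (fun r => h (r - t)))
  & forall x, Qop t x = W x + hadj (S (T - t)) (S (T - t) x).
Proof.
move=> tT; exists (fun x => Qop t x - x); last by move=> x; rewrite hadj_SS subrK.
have [Qb Qs] := Q_sa tT.
split.
  split; last by move=> x y; rewrite ipDl ipDr ipNl ipNr Qs.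
  split; first by move=> a x y; rewrite (bopD Qb) (bopZ Qb) scalerBr opprD addrACA.
  have [M M0 hM] := bop_bound Qb; exists (M + 1) => x.
  by apply: le_trans (hnorm_add _ _) _; rewrite hnorm_opp mulrDl mul1r lerD2r.
move=> x; have zT : (0 : R) <= (0 : R) <= T by rewrite (ltW T0) andbT.
(* The extension of B^* e^{rA} x to all [x] is minus the optimal control issued from [Qt 0 x], whose
   adjoint state is constantly [x]. One such function on [[0, T]] serves every [t] after a shift. *)
have [g og] := opt_ex (Qt 0 x) zT; have gL : is_L2 0 T g by case: og.
have [pz EL] := free_opt zT og.
have [_ _ Bg] : [/\ hcont 0 T (fun=> 0 : Y), is_mild S T (fun=> 0) (S^~ x) &
    is_Bstar_along A S Gr T (S^~ x) (fun t => - g t)].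
  apply: (@opt_Bstar (Qt 0 x) g) => // s /andP[_ sT]; first by rewrite pz.
  by rewrite hadjC0 oppr0.
have hL : is_L2 0 T (fun t => - g t) by exact: L2N.
exists (fun t => - g t) => //; rewrite (nsq_shift tT hL); congr EFin.
rewrite -/(rip _ _) ripDl ripNl (Qop_quad tT hL); first by rewrite addrC addKr.
move=> gam gamL; rewrite -[RHS]opprK -(EL _ gamL) -(rIN (L2_intg gL gamL)).
by apply: eq_rI => r _; rewrite ripNl.
Qed.

End ZeroCost.

End Group.

Theorem proposition5p2 (R : realType) (T : R) (T_gt0 : 0 < T)
  (* the domain, its exterior normal and surface measure, the coefficients *)
  (Omega : set (pt3 R)) (Omega_C11 : C11_domain Omega)
  (nu : pt3 R -> 'cV[R]_3) (nuP : is_exterior_normal Omega nu)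
  (sg : {measure set (mpt3 R) -> \bar R}) (sgP : is_surface_measure Omega sg)
  (eps mu : pt3 R -> 'M[R]_3)
  (epsP : is_coefficient Omega eps) (muP : is_coefficient Omega mu)
  (* the spaces Y and U, the latter through L^2_tan and the Laplace-Beltrami
     operator *)
  (Y : hilbert R) (jY : (pt3 R -> 'cV[R[i]]_3 * 'cV[R[i]]_3) -> Y)
  (YP : is_L2_Omega Omega eps mu jY)
  (H : hilbert R) (jH : (pt3 R -> 'cV[R[i]]_3) -> H)
  (HP : is_L2_tan_Gamma Omega nu sg jH)
  (LB_sa : self_adjoint (laplace_beltrami Omega nu sg jH))
  (LB_pos : positive_op (laplace_beltrami Omega nu sg jH))
  (LB_inv : invertible_op (laplace_beltrami Omega nu sg jH))
  (sqrtL : H -> H -> Prop)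
  (sqrtLP : is_sqrt_op (laplace_beltrami Omega nu sg jH) sqrtL)
  (U : hilbert R) (iU : U -> H)
  (UP : is_H_half_tan Omega nu sg jH sqrtL iU)
  (* the operator A, its group e^{tA}, the Green map *)
  (A : Y -> Y -> Prop) (AE : A = maxwell_op Omega sg eps mu jY)
  (A_skew : skew_adjoint A)
  (S : R -> Y -> Y) (S_group : unitary_C0_group S) (S_gen : is_generator S A)
  (Gr : U -> Y) (GrP : is_green_map Omega nu sg eps mu jH iU jY Gr)
  (wellposed : admissible A S Gr T)
  (* the cost functional and the optimal cost operator *)
  (C G : Y -> Y) (C_bd : bounded_op C) (G_iso : isomorphism G)
  (P : R -> Y -> Y) (PP : optimal_cost_operator A S Gr T C G P) :
  exists Q : R -> Y -> Y,
  [/\ (* a *)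
      [/\ dual_riccati_solution A Gr T C G Q,
          (forall Q', dual_riccati_solution A Gr T C G Q' ->
             forall t, 0 <= t <= T -> Q' t =1 Q t),
          (forall t, 0 <= t <= T -> isomorphism (Q t) /\ P t =1 opinv (Q t))
        & (forall y0 g y, optimal_pair A S Gr T C G 0 y0 g y ->
             is_Bstar_along A S Gr T (fun t => P t (y t)) (fun t => - g t))],
      (* b *)
      (forall y0 g y, optimal_pair A S Gr T C G 0 y0 g y ->
         let mild_z (z : R -> Y) :=
           [/\ hcontinuous_on `[0, T] z, z 0 = opinv (Q 0) y0
             & is_mild S T (fun t => - hadj C (C (Q t (z t)))) z] in
         (exists z, mild_z z) /\
         forall z, mild_z z ->
           is_Bstar_along A S Gr T z (fun t => - g t) /\
           forall t, 0 <= t <= T -> y t = Q t (z t))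
    & (* c *)
      ((forall x, C x = 0) -> (forall x, G x = x) ->
       (forall y0 g y, optimal_pair A S Gr T C G 0 y0 g y ->
          is_Bstar_along A S Gr T (fun t => S t (opinv (Q 0) y0))
            (fun t => - g t) /\
          forall t, 0 <= t <= T -> y t = Q t (S t (opinv (Q 0) y0))) /\
       (* W is \int_t^T e^{(r-t)A^*} B B^* e^{(r-t)A} dr *)
       forall t, 0 <= t <= T ->
         exists2 W : Y -> Y,
           self_adjoint_op W /\
           (forall x, exists2 h, is_Bstar_along A S Gr T (S^~ x) h &
              (complex.Re (ip (W x) x))%:E =
              L2sq t T (fun r => h (r - t)))
         & forall x, Q t x = W x + hadj (S (T - t)) (S (T - t) x))].
Proof.
have Gb : bounded_op Gr by case: GrP.
exists (Qop P); split; [split| |].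
- exact: (Q_riccati A_skew S_group S_gen T_gt0 Gb wellposed C_bd G_iso PP).
- move=> Q' Q'R t tT x.
  exact: (riccati_unique A_skew S_group S_gen T_gt0 Gb wellposed C_bd G_iso PP Q'R).
- move=> t tT; split; first exact: (Q_iso A_skew S_group S_gen T_gt0 Gb wellposed C_bd G_iso PP).
  by move=> x; rewrite (opinvQ A_skew S_group S_gen T_gt0 Gb wellposed C_bd G_iso PP).
- move=> y0 g y oy.
  exact: (optimal_pair_P A_skew S_group S_gen T_gt0 Gb wellposed C_bd G_iso PP oy).
- move=> y0 g y oy mz; split; last first.
    move=> z zP.
    exact: (optimal_pair_z A_skew S_group S_gen T_gt0 Gb wellposed C_bd G_iso PP oy zP).
  have [og _] := optimal_pair0 A_skew S_group S_gen T_gt0 Gb wellposed C_bd PP oy.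
  exists (fun t => S t (pt A S T Gr C G 0 y0 g t)).
  exact: (mild_z_opt A_skew S_group S_gen T_gt0 Gb wellposed C_bd G_iso PP og).
- move=> C0 Gid; split; last first.
    move=> t tT.
    exact: (gramian A_skew S_group S_gen T_gt0 Gb wellposed C_bd G_iso PP C0 Gid tT).
  move=> y0 g y oy.
  apply: (optimal_pair_z A_skew S_group S_gen T_gt0 Gb wellposed C_bd G_iso PP oy).
  exact: free_mild_z.
Qed.
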